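(* Let $S\subset\mathbb{C}^n$ be a compact pseudoconvex smooth real hypersurface and let $1\le q\le n-1$ be an integer. Assume that $S$ is countably $q$-regular. Then $S$ satisfies property $(P_q)$.
   Context: $S$ is pseudoconvex if for every $p\in S$ there is a purely imaginary contact form $\theta$ near $p$ in $S$ (a nonzero $1$-form vanishing on $\mathbb{C}HS=H^{10}S\oplus\overline{H^{10}S}$, where $H^{10}S$ is the bundle of $(1,0)$ tangent vectors of $S$) with $\theta([L,\overline{L}])\ge0$ for all local sections $L$ of $H^{10}S$. A CR submanifold $M\subset S$ is a smooth real submanifold of $S$ such that $H^{10}_xM:=\mathbb{C}T_xM\cap H^{10}_xS$ has constant dimension for $x\in M$. $K^{10}_x\subset H^{10}_xS$ denotes the kernel of the Levi form of $S$ at $x$. A smooth real hypersurface $S\subset\mathbb{C}^n$ is countably $q$-regular if it is a countable disjoint union $S=\bigcup_{k=1}^\infty S_k$ of locally closed subsets $S_k\subset S$ such that for each $k$ and each $p\in S_k$ there exists a CR submanifold $M\subset S$ such that: (1) $M$ contains an open neighborhood of $p$ in $S_k$ (in the relative topology); (2) $\dim_{\mathbb{C}}(H^{10}_xM\cap K^{10}_x)<q$ for all $x\in M$. Property $(P_q)$: a compact $K\subset\mathbb{C}^n$ satisfies $(P_q)$ if for every $C>0$ there exist an open neighborhood $U$ of $K$ in $\mathbb{C}^n$ and a real $C^2$ function $\lambda\colon U\to\mathbb{R}$ with $0\le\lambda\le1$ such that the sum of any $q$ eigenvalues of the complex Hessian $(\lambda_{z_j\bar z_k})_{j,k=1}^n$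 is greater than $C$ on $U$. *)

(* Defs.v *)
From HB Require Import structures.
From mathcomp Require Import all_boot all_order all_algebra.
From mathcomp Require Import complex.
From mathcomp Require Import all_classical all_reals all_analysis.

Set Implicit Arguments.
Unset Strict Implicit.
Unset Printing Implicit Defensive.
Import Order.TTheory GRing.Theory Num.Theory.
Import numFieldNormedType.Exports.

Local Open Scope classical_set_scope.
Local Open Scope complex_scope.
Local Open Scope ring_scope.

(* C^n is the real space 'rV[R]_(n + n) with z_j = x_j + i y_j, where x_j is
   the coordinate [lshift n j] and y_j the coordinate [rshift n j].  A complex
   tangent vector of R^m is the row of its coefficients in the basis d/dx_k;
   the same convention (basis dx_k) is used for complex covectors. *)

Section Calculus.
Context {R : realType} {m : nat}.
Local Notation E := 'rV[R]_m.
Local Notation C := R[i].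

Definition pderiv (k : 'I_m) (f : E -> R) : E -> R := 'D_(delta_mx 0 k) f.

(* Meaningful for U open. *)
Fixpoint Cr (r : nat) (U : set E) (f : E -> R) : Prop :=
  match r with
  | 0 => forall x, U x -> {for x, continuous f}
  | r'.+1 => (forall x, U x -> differentiable f x) /\
             forall k, Cr r' U (pderiv k f)
  end.

Definition smooth (U : set E) (f : E -> R) : Prop := forall r, Cr r U f.

Definition csmooth (U : set E) (F : E -> C) : Prop :=
  smooth U (fun x => complex.Re (F x)) /\ smooth U (fun x => complex.Im (F x)).

Definition smooth_field (U : set E) (X : E -> 'rV[C]_m) : Prop :=
  forall k, csmooth U (fun x => X x 0 k).

Definition cpderiv (k : 'I_m) (F : E -> C) (x : E) : C :=
  pderiv k (fun y => complex.Re (F y)) x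
  +i* pderiv k (fun y => complex.Im (F y)) x.

Definition vapply (X : E -> 'rV[C]_m) (F : E -> C) (x : E) : C :=
  \sum_k X x 0 k * cpderiv k F x.

Definition bracket (X Y : E -> 'rV[C]_m) (x : E) : 'rV[C]_m :=
  \row_j (vapply X (fun y => Y y 0 j) x - vapply Y (fun y => X y 0 j) x).

Definition conjv (w : 'rV[C]_m) : 'rV[C]_m := map_mx (@conjc R) w.

Definition pairing (t w : 'rV[C]_m) : C := \sum_k t 0 k * w 0 k.

Definition has_cdim (A : set 'rV[C]_m) (d : nat) : Prop :=
  exists B : 'M[C]_(d, m), row_free B /\ A = [set w | (w <= B)%MS].

(* Embedded C^oo submanifold of R^m of codimension c. *)
Definition submanifold (c : nat) (M : set E) : Prop :=
  forall p, M p -> exists (U : set E) (r : 'I_c -> E -> R),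
    [/\ open U, U p, (forall i, smooth U (r i)),
        M `&` U = [set x | U x /\ forall i, r i x = 0] &
        forall x, (M `&` U) x -> row_free (\matrix_(i, k) pderiv k (r i) x)].

(* T_xM: the tangent vectors of R^m at x, viewed as derivations, which kill
   the germs of smooth functions vanishing on M. *)
Definition tangent (M : set E) (x : E) : set E :=
  [set v | forall (U : set E) (f : E -> R), open U -> U x -> smooth U f ->
     (forall y, (M `&` U) y -> f y = 0) -> 'D_v f x = 0].

(* CT_xM = T_xM + i T_xM *)
Definition ctangent (M : set E) (x : E) : set 'rV[C]_m :=
  [set w | tangent M x (map_mx (@complex.Re R) w) /\
           tangent M x (map_mx (@complex.Im R) w)].

End Calculus.

Section CR.
Context {R : realType} {n : nat}.
Local Notation E := 'rV[R]_(n + n).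
Local Notation C := R[i].
Local Notation ii := (0 +i* 1 : C).

(* Complex-linear extension of J : d/dx_j |-> d/dy_j, d/dy_j |-> - d/dx_j. *)
Definition Jstr (w : 'rV[C]_(n + n)) : 'rV[C]_(n + n) :=
  row_mx (- rsubmx w) (lsubmx w).

(* The (1,0) vectors are the i-eigenspace of J, i.e. the span of the
   d/dz_j = (d/dx_j - i d/dy_j) / 2. *)
Definition H10 (S : set E) (x : E) : set 'rV[C]_(n + n) :=
  ctangent S x `&` [set w | Jstr w = ii *: w].

Definition CH (S : set E) (x : E) : set 'rV[C]_(n + n) :=
  [set w | exists a b, [/\ H10 S x a, H10 S x b & w = a + conjv b]].

(* Forms and sections on S `&` U are given by smooth extensions to the open set
   U of C^n; these always exist locally, and the restriction to S of the
   bracket of two fields tangent to S does not depend on the extensions. *)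
Definition H10_section (S U : set E) (L : E -> 'rV[C]_(n + n)) : Prop :=
  smooth_field U L /\ forall x, (S `&` U) x -> H10 S x (L x).

(* Purely imaginary contact form of S on S `&` U. *)
Definition contact_form (S U : set E) (t : E -> 'rV[C]_(n + n)) : Prop :=
  smooth_field U t /\
  forall x, (S `&` U) x ->
    [/\ exists2 w, ctangent S x w & pairing (t x) w != 0,
        forall w, CH S x w -> pairing (t x) w = 0 &
        forall v, tangent S x v ->
          complex.Re (pairing (t x) (map_mx (real_complex R) v)) = 0].

Definition levi (t L L' : E -> 'rV[C]_(n + n)) (x : E) : C :=
  pairing (t x) (bracket L (fun y => conjv (L' y)) x).

(* The order of R[i] is used: 0 <= z means that z is real and nonnegative. *)
Definition pseudoconvex (S : set E) : Prop :=
  forall p, S p -> exists (U : set E) (t : E -> 'rV[C]_(n + n)),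
    [/\ open U, U p, contact_form S U t &
        forall (V : set E) (L : E -> 'rV[C]_(n + n)),
          open V -> V `<=` U -> H10_section S V L ->
          forall x, (S `&` V) x -> 0 <= levi t L L x].

(* K^{10}_x.  By tensoriality, [levi t L L' x] depends on L and L' only
   through L x and L' x. *)
Definition levi_kernel (S : set E) (x : E) : set 'rV[C]_(n + n) :=
  [set w | H10 S x w /\
    forall (U : set E) (t L L' : E -> 'rV[C]_(n + n)),
      open U -> U x -> contact_form S U t ->
      H10_section S U L -> H10_section S U L' ->
      L x = w -> levi t L L' x = 0].

Definition hypersurface (S : set E) : Prop := submanifold 1 S.

(* H^{10}_xM = CT_xM `&` H^{10}_xS coincides with [H10 M x], as M `<=` S; the
   definition is spelled relative to S nevertheless. *)
Definition H10_in (S M : set E) (x : E) : set 'rV[C]_(n + n) :=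
  ctangent M x `&` H10 S x.

Definition CR_submanifold (S M : set E) : Prop :=
  [/\ M `<=` S, exists c, submanifold c M &
      exists d, forall x, M x -> has_cdim (H10_in S M x) d].

(* Locally closed in the relative topology of S. *)
Definition locally_closed_in (S A : set E) : Prop :=
  exists O F : set E, [/\ open O, closed F & A = S `&` (O `&` F)].

(* Some of the pieces Sk k may be empty. *)
Definition countably_regular (q : nat) (S : set E) : Prop :=
  exists Sk : nat -> set E,
    [/\ S = \bigcup_k Sk k, trivIset setT Sk,
        forall k, locally_closed_in S (Sk k) &
        forall k p, Sk k p -> exists M : set E,
          [/\ CR_submanifold S M,
              exists V : set E, [/\ open V, V p & Sk k `&` V `<=` M] &
              forall x, M x -> exists2 d, (d < q)%N &
                has_cdim (H10_in S M x `&` levi_kernel S x) d]].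

(* d/dz_j and d/d(zbar_j) *)
Definition dz (j : 'I_n) (F : E -> C) (x : E) : C :=
  (cpderiv (lshift n j) F x - ii * cpderiv (rshift n j) F x) / 2.

Definition dzbar (j : 'I_n) (F : E -> C) (x : E) : C :=
  (cpderiv (lshift n j) F x + ii * cpderiv (rshift n j) F x) / 2.

Definition complex_hessian (f : E -> R) (x : E) : 'M[C]_n :=
  \matrix_(j, k) dzbar k (dz j (fun y => (f y)%:C)) x.

(* mu enumerates the eigenvalues of A with multiplicity. *)
Definition eigenvalues_of (A : 'M[C]_n) (mu : 'I_n -> C) : Prop :=
  char_poly A = \prod_(i < n) ('X - (mu i)%:P).

Definition property_P (q : nat) (K : set E) : Prop :=
  forall c : R, 0 < c -> exists (U : set E) (f : E -> R),
    [/\ open U, K `<=` U, Cr 2 U f,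
        forall x, U x -> 0 <= f x <= 1 &
        forall x, U x -> forall mu, eigenvalues_of (complex_hessian f x) mu ->
          forall I : {set 'I_n}, #|I| = q -> c%:C < \sum_(i in I) mu i].

End CR.

(* Main.v *)
From HB Require Import structures.
Require Import Defs.
From mathcomp Require Import all_boot all_order all_algebra.
From mathcomp Require Import complex.
From mathcomp Require Import all_classical all_reals all_analysis.
From mathcomp Require Import finmap perm ring lra.

Set Implicit Arguments.
Unset Strict Implicit.
Unset Printing Implicit Defensive.
Import Order.TTheory GRing.Theory Num.Theory.
Import numFieldNormedType.Exports.

Local Open Scope classical_set_scope.
Local Open Scope complex_scope.
Local Open Scope ring_scope.

(* Let T_G f denote the contraction of the real Hessian of f with a symmetric
   matrix G.  When G is the projector onto a complex q-plane of C^n, T_G f is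
   four times the trace of the complex Hessian of f on that plane, so (P_q) asks
   for bounded functions f with T_G f large for all these G.
   Such functions glue: if they exist near a compact L' of L, and near every
   compact of L \ L', then they exist near L, by a smooth maximum.  Together
   with the Baire category theorem on S this reduces the theorem to a
   neighbourhood in M of a point p of a CR submanifold M of S.  There one takes
   f = 1/2 + A (N sum r_l^2 + s rho), with r_l defining functions of M, rho one
   of S, and s a sign: T_G (sum r_l^2) is nonnegative at p, and vanishes only if
   the q-plane is tangent to M; on such a plane s T_G rho is nonnegative by
   pseudoconvexity, and it is positive since otherwise the q-plane would lie in
   the kernel of the Levi form, whose intersection with H^{10} M has dimension
   less than q.  By compactness of the set of q-planes, T_G of the parenthesis is
   bounded below by a positive constant when N is large; and A is free, since
   f = 1/2 on M. *)

(** The obstacle is that pieces of S accumulate on one another, while gluing handles two sets at a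
    time. Hence its asymmetric form: the function near L' is fixed first, the one near the rest of L
    is chosen afterwards with T_G so large that it absorbs the Hessian of the cut-off. The points of
    S without a good neighbourhood form a compact set; if it is nonempty, Baire's theorem puts a
    relatively open part of it into one piece, and gluing makes that part good, a contradiction. T_G
    is preferred to eigenvalues because it is linear in f and, for G positive semidefinite,
    compatible with convex functions, hence with a smooth maximum; eigenvalues return only at the
    end, through the spectral theorem. Tangent vectors are derivations, so that a vector killed by
    the dr_l must be shown to be tangent: points of M close to p + t v are found by minimizing sum
    r_l^2. The Levi form is defined by brackets and contact forms. Every contact form is a multiple
    of drho o J along S, which turns the bracket into the Hessian of rho; s comes from this
    multiple. *)

(** * Differentiability and C^r functions *)

Section DiffNear.
Context {R : realType} {V W : normedModType R}.

Lemma diff_nearP (f : V -> W) (x : V) : differentiable f x <->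
  continuous ('d f x : V -> W) /\
  forall e, 0 < e -> \forall h \near 0,
    `|f (h + x) - f x - 'd f x h| <= e * `|h|.
Proof.
rewrite diff_locallyP; split => -[dc H]; split => //.
  move=> e e0; move: H => /eqaddoP /(_ _ e0).
  by apply: filterS => h /=; rewrite !fctE opprD addrA.
by apply/eqaddoP => e e0; apply: filterS (H _ e0) => h; rewrite /= !fctE opprD addrA.
Qed.

Lemma differentiable_near (f g : V -> W) (x : V) :
  (\forall y \near x, f y = g y) -> differentiable f x ->
  differentiable g x.
Proof.
move=> fg /diff_locallyP[dc H].
have E : g \o shift x = cst (g x) + 'd f x +o_ 0 id.
  rewrite -(nbhs_singleton fg); apply/eqaddoP => e e0.
  move: H => /eqaddoP /(_ _ e0) H; near=> h; rewrite /= !fctE.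
  have <- : f (h + x) = g (h + x).
    near: h; move: fg; rewrite (near_shift 0 x) subr0; apply: filterS => h /=.
    by [].
  by near: h; apply: filterS H => h.
apply/diff_locallyP; rewrite (diff_unique dc E); split => //.
Unshelve. all: by end_near. Qed.
End DiffNear.

Section Cr_algebra.
Context {R : realType} {m : nat}.
Local Notation E := 'rV[R]_m.
Implicit Types (U : set E) (f g : E -> R) (x v : E).

Lemma pderiv_near k f g x :
  (\forall y \near x, f y = g y) -> pderiv k f x = pderiv k g x.
Proof. exact: near_eq_derive. Qed.

Lemma pderiv_near_near k f g x :
  (\forall y \near x, f y = g y) -> \forall y \near x, pderiv k f y = pderiv k g y.
Proof. by move=> /nbhs_interior; apply: filterS => y /pderiv_near. Qed.

Lemma continuous_near f g x : (\forall y \near x, f y = g y) ->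
  {for x, continuous f} -> {for x, continuous g}.
Proof.
move=> fg cf; rewrite /prop_for /continuous_at -(nbhs_singleton fg).
exact: cvg_trans (near_eq_cvg fg) cf.
Qed.

Lemma Cr_near r U f g : (forall x, U x -> \forall y \near x, f y = g y) ->
  Cr r U f -> Cr r U g.
Proof.
elim: r f g => [|r IH] f g fg /=.
  by move=> Hf x Ux; apply: continuous_near (fg x Ux) (Hf x Ux).
move=> [df Hf]; split=> [x Ux|k].
  by apply: differentiable_near (fg x Ux) (df x Ux).
apply: IH (Hf k) => x Ux; exact: pderiv_near_near (fg x Ux).
Qed.

Lemma Cr_eq_open r U f g : open U -> (forall x, U x -> f x = g x) ->
  Cr r U f -> Cr r U g.
Proof.
move=> oU fg; apply: Cr_near => x Ux.
by have := open_nbhs_nbhs (conj oU Ux); apply: filterS.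
Qed.

Lemma Cr_sub r U V f : V `<=` U -> Cr r U f -> Cr r V f.
Proof.
move=> VU; elim: r f => [|r IH] f /=; first by move=> H x /VU /H.
by move=> [df Hf]; split=> [x /VU /df //|k]; exact: IH.
Qed.

(** Every clause of [Cr] speaks of one point at a time, the derivatives being those of a function on
    the whole space. A function defined by cases can thus be checked near each point separately. *)
Lemma Cr_pointwise r U f : (forall x, U x -> Cr r [set x] f) -> Cr r U f.
Proof.
elim: r f => [|r IH] f H /=; first by move=> x Ux; apply: (H x Ux).
split=> [x Ux|k]; first by have [+ _] := H x Ux; apply.
by apply: IH => x Ux; have [_ +] := H x Ux; apply.
Qed.

Lemma Cr0P U f : Cr 0 U f <-> forall x, U x -> {for x, continuous f}.
Proof. by []. Qed.

Lemma CrS r U f : Cr r.+1 U f -> Cr r U f.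
Proof.
elim: r f => [|r IH] f /= [df Hf].
  by move=> x Ux; apply: differentiable_continuous; exact: df.
by split=> // k; apply: IH.
Qed.

Lemma CrW r s U f : (r <= s)%N -> Cr s U f -> Cr r U f.
Proof.
move=> /subnK <-; elim: (s - r)%N => // d IH H; exact/IH/CrS.
Qed.

Lemma Cr_differentiable r U f x : Cr r.+1 U f -> U x -> differentiable f x.
Proof. by move=> /= [+ _]; apply. Qed.

Lemma Cr_continuous r U f x : Cr r U f -> U x -> {for x, continuous f}.
Proof. by move=> /(@CrW 0) /=; apply. Qed.

Lemma Cr_pderiv r U f k : Cr r.+1 U f -> Cr r U (pderiv k f).
Proof. by move=> /= [_]; apply. Qed.

Lemma smooth_pderiv U f k : smooth U f -> smooth U (pderiv k f).
Proof. by move=> H r; apply: Cr_pderiv; exact: H. Qed.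

Lemma pderiv_cst k (a : R) : pderiv k (cst a : E -> R) = cst 0.
Proof. by apply/funext => x; rewrite /pderiv derive_cst. Qed.

Lemma Cr_cst r U (a : R) : Cr r U (cst a).
Proof.
elim: r a => [|r IH] a /=; first by move=> x _; exact: cst_continuous.
by split=> [x _|k]; [exact: differentiable_cst|rewrite pderiv_cst; exact: IH].
Qed.

Lemma coord_lin k : linear (fun x : E => x 0 k : R).
Proof. by move=> a x y; rewrite !mxE. Qed.

Lemma pderiv_coord k l : pderiv k (fun x : E => x 0 l) = cst ((k == l)%:R).
Proof.
apply/funext => x; rewrite /pderiv.
pose L : {linear E -> R} := HB.pack (fun x : E => x 0 l : R)
  (GRing.isLinear.Build _ _ _ _ _ (coord_lin l)).
have -> : (fun x : E => x 0 l) = L by [].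
rewrite deriveE; last by apply: linear_differentiable; exact: coord_continuous.
by rewrite diff_lin; [rewrite /= mxE eqxx eq_sym|exact: coord_continuous].
Qed.

Lemma Cr_coord r U l : Cr r U (fun x : E => x 0 l).
Proof.
case: r => [|r] /=; first by move=> x _; exact: coord_continuous.
split=> [x _|k]; first exact: differentiable_coord.
by rewrite pderiv_coord; exact: Cr_cst.
Qed.

Lemma pderivD k f g x : differentiable f x -> differentiable g x ->
  pderiv k (fun y => f y + g y) x = pderiv k f x + pderiv k g x.
Proof. by move=> df dg; rewrite /pderiv deriveD//; exact: diff_derivable. Qed.

Lemma pderivM k f g x : differentiable f x -> differentiable g x ->
  pderiv k (fun y => f y * g y) x = pderiv k f x * g x + f x * pderiv k g x.
Proof.
move=> df dg; rewrite /pderiv deriveM; try exact: diff_derivable.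
by rewrite /GRing.scale /= addrC; congr (_ + _); rewrite mulrC.
Qed.

Lemma CrD r U f g : open U -> Cr r U f -> Cr r U g ->
  Cr r U (fun y => f y + g y).
Proof.
move=> oU; elim: r f g => [|r IH] f g Hf Hg.
  by move=> x Ux; apply: continuousD; [exact: Hf|exact: Hg].
split=> [x Ux|k].
  by apply: differentiableD; [exact: Cr_differentiable Hf Ux|exact: Cr_differentiable Hg Ux].
apply: Cr_eq_open (IH _ _ (Cr_pderiv k Hf) (Cr_pderiv k Hg)) => // x Ux.
by rewrite pderivD//; [exact: Cr_differentiable Hf Ux|exact: Cr_differentiable Hg Ux].
Qed.

Lemma CrM r U f g : open U -> Cr r U f -> Cr r U g ->
  Cr r U (fun y => f y * g y).
Proof.
move=> oU; elim: r f g => [|r IH] f g Hf Hg.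
  by move=> x Ux; apply: continuousM; [exact: Hf|exact: Hg].
split=> [x Ux|k].
  by apply: differentiableM; [exact: Cr_differentiable Hf Ux|exact: Cr_differentiable Hg Ux].
have := CrD oU (IH _ _ (Cr_pderiv k Hf) (CrS Hg)) (IH _ _ (CrS Hf) (Cr_pderiv k Hg)).
apply: Cr_eq_open => // x Ux.
by rewrite pderivM//; [exact: Cr_differentiable Hf Ux|exact: Cr_differentiable Hg Ux].
Qed.

Lemma CrZ r U (a : R) f : open U -> Cr r U f -> Cr r U (fun y => a * f y).
Proof. by move=> oU; apply: CrM => //; exact: Cr_cst. Qed.

Lemma CrN r U f : open U -> Cr r U f -> Cr r U (fun y => - f y).
Proof.
move=> oU /(CrZ (-1) oU); congr (Cr _ _ _).
by apply/funext => x; rewrite mulN1r.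
Qed.

Lemma CrB r U f g : open U -> Cr r U f -> Cr r U g ->
  Cr r U (fun y => f y - g y).
Proof. by move=> oU Hf Hg; apply: CrD => //; exact: CrN. Qed.

Lemma Cr_sum r U (I : Type) (s : seq I) (F : I -> E -> R) : open U ->
  (forall i, Cr r U (F i)) -> Cr r U (fun y => \sum_(i <- s) F i y).
Proof.
move=> oU HF; elim: s => [|i s IH].
  by under eq_fun do rewrite big_nil; exact: Cr_cst.
by under eq_fun do rewrite big_cons; exact: CrD.
Qed.

Lemma pderivZ k (a : R) f x : differentiable f x ->
  pderiv k (fun y => a * f y) x = a * pderiv k f x.
Proof.
by move=> df; rewrite pderivM ?pderiv_cst ?mul0r ?add0r//; exact: differentiable_cst.
Qed.

Lemma pderivB k f g x : differentiable f x -> differentiable g x ->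
  pderiv k (fun y => f y - g y) x = pderiv k f x - pderiv k g x.
Proof. by move=> df dg; rewrite /pderiv deriveB//; exact: diff_derivable. Qed.

Lemma pderiv_sum k (I : Type) (s : seq I) (F : I -> E -> R) x :
  (forall i, differentiable (F i) x) ->
  pderiv k (fun y => \sum_(i <- s) F i y) x = \sum_(i <- s) pderiv k (F i) x.
Proof.
move=> dF.
suff [-> _] : pderiv k (fun y => \sum_(i <- s) F i y) x = \sum_(i <- s) pderiv k (F i) x
  /\ differentiable (fun y => \sum_(i <- s) F i y) x by [].
elim: s => [|i s [IH dIH]].
  under eq_fun do rewrite big_nil; rewrite big_nil; split; last exact: differentiable_cst.
  by rewrite -/(cst 0) pderiv_cst.
under eq_fun do rewrite big_cons; rewrite big_cons; split.
  by rewrite pderivD// IH.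
exact: differentiableD.
Qed.

Lemma pderiv_comp k (h : R -> R) (d : R) f x : is_derive (f x) 1 h d ->
  differentiable f x -> pderiv k (fun y => h (f y)) x = d * pderiv k f x.
Proof.
move=> [dh hd] df; rewrite /pderiv.
have dh' : differentiable h (f x) by apply/derivable1_diffP.
rewrite [LHS]deriveE; last exact: differentiable_comp.
rewrite diff_comp//= deriveE// diff1E// /= derive1E hd /GRing.scale /= mulrC.
by [].
Qed.

(** The outer function comes with the sequence [h i] of its successive derivatives, so that the
    induction on r merely shifts the sequence. *)
Lemma Cr_comp r U (h : nat -> R -> R) f : open U ->
  (forall i (s : R), (i < r)%N -> is_derive s 1 (h i) (h i.+1 s)) -> continuous (h r) ->
  Cr r U f -> Cr r U (fun y => h 0%N (f y)).
Proof.
move=> oU; elim: r h f => [|r IH] h f dh ch Hf.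
  by move=> x Ux; apply: continuous_comp; [exact: Hf|exact: ch].
have df x : U x -> differentiable f x by move=> Ux; apply: Cr_differentiable Hf Ux.
split=> [x Ux|k].
  apply: (@differentiable_comp _ _ _ _ f (h 0%N)); first exact: df.
  by apply/derivable1_diffP; have [] := dh 0%N (f x) (ltn0Sn _).
have Hc := IH (fun i => h i.+1) f (fun i s ir => dh i.+1 s ir) ch (CrS Hf).
have := CrM oU Hc (Cr_pderiv k Hf).
apply: Cr_eq_open => // x Ux; rewrite (pderiv_comp _ (dh 0%N (f x) _))//.
exact: df.
Qed.

Lemma derive_pderiv f x v : differentiable f x ->
  'D_v f x = \sum_k v 0 k * pderiv k f x.
Proof.
move=> df; rewrite deriveE // {1}(row_sum_delta v) linear_sum; apply: eq_bigr => k _.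
by rewrite linearZ /pderiv deriveE.
Qed.
End Cr_algebra.

Local Opaque Cr pderiv.

(** * A smooth maximum *)

Section SmoothMax.
Context {R : realType}.
Implicit Types s t : R.

Definition pospow (k : nat) (s : R) : R := (Num.max s 0) ^+ k.

(** The difference quotient at 0 is at most |h|. This settles the kink of [pospow] at 0. *)
Lemma is_derive_sq_bound (f : R -> R) :
  f 0 = 0 -> (forall h, `|h| <= 1 -> `|f h| <= h ^+ 2) -> is_derive (0 : R) (1 : R) f 0.
Proof.
move=> f0 fb.
have H : (fun h : R => h^-1 *: (f (h *: 1 + 0) - f 0)) @ (0:R)^' --> (0 : R).
  apply/cvgrPdist_le => e e0; near=> h.
  rewrite f0 subr0 addr0 sub0r normrN [_ *: 1]mulr1 /GRing.scale /=.
  have h0 : h != 0 by near: h; exact: nbhs_dnbhs_neq.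
  have h1 : `|h| <= 1 by near: h; exact: dnbhs0_le.
  have he : `|h| <= e by near: h; exact: dnbhs0_le.
  rewrite normrM normfV ler_pdivrMl ?normr_gt0//.
  apply: le_trans (fb _ h1) _; rewrite -normr_id -real_normK ?num_real// expr2.
  by rewrite normr_id ler_wpM2l.
split; last exact/cvg_lim.
by apply/cvg_ex; exists 0.
Unshelve. all: by end_near. Qed.

(** Away from 0 the function is locally 0 or a power; at 0 it is bounded by h^2, whence the exponent
    [k.+2]. *)
Lemma is_derive_pospow k s :
  is_derive s (1 : R) (pospow k.+2) (k.+2%:R * pospow k.+1 s).
Proof.
have [s0|s0|->] := ltgtP s 0.
- have -> : k.+2%:R * pospow k.+1 s = 0.
    by rewrite /pospow max_r ?(ltW s0)// expr0n mulr0.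
  apply: (@near_eq_is_derive _ R R (cst 0)).
  near=> y; rewrite /cst /pospow max_r ?expr0n//.
  by near: y; apply: filterS (lt_nbhsl s0) => y /ltW.
- have -> : pospow k.+1 s = s ^+ k.+1 by rewrite /pospow max_l// ltW.
  apply: (@near_eq_is_derive _ R R (fun y : R => y ^+ k.+2)).
    near=> y; rewrite /pospow max_l//.
    by near: y; apply: filterS (lt_nbhsr s0) => y /ltW.
  apply: DeriveDef; first exact: exprn_derivable.
  by rewrite exp_derive /GRing.scale /= mulr1.
- rewrite {2}/pospow maxxx expr0n mulr0; apply: is_derive_sq_bound.
    by rewrite /pospow maxxx expr0n.
  move=> h h1; rewrite /pospow.
  have [h0|h0] := leP h 0.
    by rewrite expr0n normr0 sqr_ge0.
  rewrite (gtr0_norm h0) in h1.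
  by rewrite ger0_norm ?exprn_ge0 ?(ltW h0)// -addn2 exprD ler_piMl ?sqr_ge0// exprn_ile1 ?(ltW h0).
Unshelve. all: by end_near. Qed.

Lemma continuous_pospow k : continuous (pospow k).
Proof.
move=> s; apply: (@continuous_comp _ _ _ (fun y : R => Num.max y 0) (fun y => y ^+ k)).
  by apply: continuous_max; [exact: cvg_id|exact: cvg_cst].
exact: exprn_continuous.
Qed.

(* [smoothpos 3] is a convex C^2 regularization of max(t, 0), equal to it for
   |t| >= 1: the second difference of max(t, 0)^3 / 6.  Its successive
   derivatives are [smoothpos 2] and [smoothpos 1]. *)
Definition smoothpos (k : nat) (t : R) : R :=
  (pospow k (t + 1) - 2 * pospow k t + pospow k (t - 1)) / k`!%:R.

Lemma continuous_smoothpos k : continuous (smoothpos k).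
Proof.
move=> t; rewrite /smoothpos.
have cs (a : R) : {for t, continuous (fun y : R => pospow k (y + a))}.
  apply: (@continuous_comp _ _ _ (fun y : R => y + a) (pospow k)); last exact: continuous_pospow.
  by apply: continuousD; [exact: cvg_id|exact: cvg_cst].
apply: cvgM; last exact: cvg_cst.
apply: cvgD; last exact: cs.
apply: cvgB; first exact: cs.
by apply: cvgM; [exact: cvg_cst|exact: continuous_pospow].
Qed.

Lemma is_derive_smoothpos k t :
  is_derive t (1 : R) (smoothpos k.+2) (smoothpos k.+1 t).
Proof.
have cs (a : R) : is_derive t (1 : R) (fun y : R => pospow k.+2 (y + a))
    (k.+2%:R * pospow k.+1 (t + a)).
  have D := is_derive_pospow k (t + a).
  have S : is_derive t (1 : R) (fun y : R => y + a) 1.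
    by apply: is_derive_eq; rewrite addr0.
  by have := @is_derive1_comp _ _ (fun y : R => y + a) t _ _ D S; rewrite mulr1.
rewrite /smoothpos; have D0 := is_derive_pospow k t.
have := is_deriveM (is_deriveD (is_deriveB (cs 1) (is_deriveM (is_derive_cst (2 : R) t 1) D0))
  (cs (-1)))
  (is_derive_cst (k.+2`!%:R^-1 : R) t 1).
move=> H; apply: (is_derive_eq H); rewrite /GRing.scale /= factS natrM.
have f0 : k.+1`!%:R != 0 :> R by rewrite pnatr_eq0 -lt0n fact_gt0.
have k0 : k.+2%:R != 0 :> R by rewrite pnatr_eq0.
rewrite /cst !mulr0 add0r addr0.
move: (k.+2%:R : R) k0 ((k.+1)`!%:R : R) f0 => K K0 F F0.
by field; rewrite F0 K0.
Qed.

Lemma smoothpos_le (t : R) : t <= -1 -> smoothpos 3 t = 0.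
Proof.
by move=> t1; rewrite /smoothpos /pospow !max_r; lra.
Qed.

Lemma smoothpos_ge (t : R) : 1 <= t -> smoothpos 3 t = t.
Proof.
move=> t1; rewrite /smoothpos /pospow !max_l; try lra.
have -> : 3`! = 6%N by [].
by field.
Qed.

Lemma pospow_pos k t : 0 <= t -> pospow k t = t ^+ k.
Proof. by move=> t0; rewrite /pospow max_l. Qed.

Lemma pospow_neg k t : t <= 0 -> pospow k.+1 t = 0.
Proof. by move=> t0; rewrite /pospow max_r// expr0n. Qed.

(** [smoothpos 1] is the tent function max(1 - |t|, 0); its sign is the convexity of
    [smoothpos 3]. *)
Lemma smoothpos1_ge0 t : 0 <= smoothpos 1 t.
Proof.
rewrite /smoothpos (_ : 1`! = 1%N)// divr1 /pospow !expr1 !maxEle.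
by do 3 case: ifP; lra.
Qed.

(** The slope of [smoothpos 3] serves as the weight of f in a convex combination, when T_G is
    applied to [smax f g]. *)
Lemma smoothpos2_bounds t : 0 <= smoothpos 2 t <= 1.
Proof.
rewrite /smoothpos (_ : 2`! = 2%N)//.
have [t1|t1] := leP t (-1); first by rewrite !pospow_neg; lra.
have [t0|t0] := leP t 0.
  rewrite (pospow_pos _ (t := t + 1)) ?(pospow_neg _ (t := t)) ?(pospow_neg _ (t := t - 1));
    [nra|lra..].
have [t2|t2] := leP t 1.
  rewrite (pospow_pos _ (t := t + 1)) ?(pospow_pos _ (t := t)) ?(pospow_neg _ (t := t - 1));
    [nra|lra..].
by rewrite !pospow_pos; [nra|lra..].
Qed.

(** The excess over max(t, 0) is (1 - |t|)^3 / 6 for |t| <= 1 and 0 elsewhere; 1 is a convenient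
    bound. *)
Lemma smoothpos3_bounds t : Num.max t 0 <= smoothpos 3 t <= Num.max t 0 + 1.
Proof.
rewrite /smoothpos (_ : 3`! = 6%N)//.
have [t1|t1] := leP t (-1); first by rewrite !pospow_neg ?max_r; lra.
have [t0|t0] := leP t 0.
  rewrite (pospow_pos _ (t := t + 1)) ?(pospow_neg _ (t := t)) ?(pospow_neg _ (t := t - 1));
    [|lra..].
  have : 0 <= (t + 1) ^+ 3 <= 1.
    by apply/andP; split; [apply: exprn_ge0|apply: exprn_ile1]; lra.
  move: (_ ^+ 3) => c; lra.
have [t2|t2] := leP t 1.
  rewrite (pospow_pos _ (t := t + 1)) ?(pospow_pos _ (t := t)) ?(pospow_neg _ (t := t - 1));
    [|lra..].
  have : 0 <= (1 - t) ^+ 3 <= 1.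
    by apply/andP; split; [apply: exprn_ge0|apply: exprn_ile1]; lra.
  have : (t + 1) ^+ 3 - 2 * t ^+ 3 + 0 = 6 * t + (1 - t) ^+ 3 by ring.
  move=> ->; move: ((1 - t) ^+ 3) => c; lra.
rewrite !pospow_pos; [|lra..].
have -> : (t + 1) ^+ 3 - 2 * t ^+ 3 + (t - 1) ^+ 3 = 6 * t by ring.
lra.
Qed.
End SmoothMax.

(** * The contraction of the Hessian with a matrix *)

Section TraceOperator.
Context {R : realType} {m : nat}.
Local Notation E := 'rV[R]_m.
Implicit Types (U : set E) (f g u : E -> R) (x : E) (G : 'M[R]_m).

Definition trG G f x : R := \sum_k \sum_l G k l * pderiv l (pderiv k f) x.

Definition quad G (a b : 'I_m -> R) : R := \sum_k \sum_l G k l * (a k * b l).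

Definition psd G : Prop := forall a : 'I_m -> R, 0 <= quad G a a.

Lemma trG_near G f g x : (\forall y \near x, f y = g y) -> trG G f x = trG G g x.
Proof.
move=> fg; apply: eq_bigr => k _; apply: eq_bigr => l _.
by rewrite (pderiv_near l (pderiv_near_near k fg)).
Qed.

Lemma pderiv2D U f g x k l : open U -> Cr 2 U f -> Cr 2 U g -> U x ->
  pderiv l (pderiv k (fun y => f y + g y)) x =
  pderiv l (pderiv k f) x + pderiv l (pderiv k g) x.
Proof.
move=> oU Hf Hg Ux.
rewrite -pderivD; [|exact: Cr_differentiable (Cr_pderiv k Hf) Ux|exact: Cr_differentiable
  (Cr_pderiv k Hg) Ux].
apply: pderiv_near; near=> y.
have Uy : U y by near: y; exact: open_nbhs_nbhs.
by rewrite pderivD//; [exact: Cr_differentiable Hf Uy|exact: Cr_differentiable Hg Uy].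
Unshelve. all: by end_near. Qed.

Lemma pderiv2M U f g x k l : open U -> Cr 2 U f -> Cr 2 U g -> U x ->
  pderiv l (pderiv k (fun y => f y * g y)) x =
  pderiv l (pderiv k f) x * g x + f x * pderiv l (pderiv k g) x
  + (pderiv k f x * pderiv l g x + pderiv l f x * pderiv k g x).
Proof.
move=> oU Hf Hg Ux.
have d2f := Cr_differentiable (Cr_pderiv k Hf) Ux.
have d2g := Cr_differentiable (Cr_pderiv k Hg) Ux.
have df := Cr_differentiable Hf Ux; have dg := Cr_differentiable Hg Ux.
transitivity (pderiv l (fun y => pderiv k f y * g y + f y * pderiv k g y) x).
  apply: pderiv_near; near=> y.
  have Uy : U y by near: y; exact: open_nbhs_nbhs.
  by rewrite pderivM//; [exact: Cr_differentiable Hf Uy|exact: Cr_differentiable Hg Uy].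
rewrite pderivD; [|exact: differentiableM..].
rewrite !pderivM//.
by rewrite [X in _ + X]addrC addrACA.
Unshelve. all: by end_near. Qed.

Lemma trGD U G f g x : open U -> Cr 2 U f -> Cr 2 U g -> U x ->
  trG G (fun y => f y + g y) x = trG G f x + trG G g x.
Proof.
move=> oU Hf Hg Ux; rewrite /trG -big_split; apply: eq_bigr => k _.
rewrite -big_split; apply: eq_bigr => l _.
by rewrite (pderiv2D _ _ oU Hf Hg Ux) mulrDr.
Qed.

Lemma trG_cst G (a : R) x : trG G (cst a) x = 0.
Proof.
rewrite /trG big1// => k _; rewrite big1// => l _.
by rewrite !pderiv_cst mulr0.
Qed.

Lemma trGM U G f g x : open U -> Cr 2 U f -> Cr 2 U g -> U x ->
  trG G (fun y => f y * g y) x = trG G f x * g x + f x * trG G g x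
   + (quad G (fun k => pderiv k f x) (fun k => pderiv k g x)
      + quad G (fun k => pderiv k g x) (fun k => pderiv k f x)).
Proof.
move=> oU Hf Hg Ux; rewrite /trG /quad mulr_suml mulr_sumr -!big_split; apply: eq_bigr => k _.
rewrite mulr_suml mulr_sumr -!big_split; apply: eq_bigr => l _ /=.
rewrite (pderiv2M _ _ oU Hf Hg Ux).
move: (pderiv _ _ _) (pderiv _ _ _) (pderiv _ _ _) (pderiv _ _ _) (pderiv _ _ _) (pderiv _ _ _)
  (f x) (g x) (G k l) => a1 a2 a3 a4 a5 a6 a7 a8 a9.
ring.
Qed.

Lemma trGZ U G (a : R) f x : open U -> Cr 2 U f -> U x ->
  trG G (fun y => a * f y) x = a * trG G f x.
Proof.
move=> oU Hf Ux; rewrite (trGM G oU (Cr_cst 2 U a) Hf Ux) trG_cst mul0r add0r.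
rewrite /quad !big1 ?addr0// => k _; rewrite big1// => l _; rewrite pderiv_cst.
  by rewrite mulr0 mulr0.
by rewrite mul0r mulr0.
Qed.

(** The second derivative of h multiplies G(du, du), so for convex h and positive semidefinite G
    this term can only increase T_G. *)
Lemma trG_comp U G (h : nat -> R -> R) u x : open U ->
  (forall i (s : R), (i < 2)%N -> is_derive s 1 (h i) (h i.+1 s)) -> Cr 2 U u -> U x ->
  trG G (fun y => h 0%N (u y)) x = h 1%N (u x) * trG G u x
    + h 2 (u x) * quad G (fun k => pderiv k u x) (fun k => pderiv k u x).
Proof.
move=> oU dh Hu Ux; rewrite /trG /quad !mulr_sumr -!big_split; apply: eq_bigr => k _.
rewrite !mulr_sumr -!big_split; apply: eq_bigr => l _ /=.
have d2u := Cr_differentiable (Cr_pderiv k Hu) Ux.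
have du := Cr_differentiable Hu Ux.
have -> : pderiv l (pderiv k (fun y => h 0%N (u y))) x =
    pderiv l (fun y => h 1%N (u y) * pderiv k u y) x.
  apply: pderiv_near; near=> y.
  have Uy : U y by near: y; exact: open_nbhs_nbhs.
  by rewrite (pderiv_comp _ (dh 0%N (u y) _))//; exact: Cr_differentiable Hu Uy.
have d1 : differentiable (fun y => h 1%N (u y)) x.
  apply: (@differentiable_comp _ _ _ _ u (h 1%N)); first exact: du.
  by apply/derivable1_diffP; have [] := dh 1%N (u x) isT.
rewrite pderivM// (pderiv_comp _ (dh 1%N (u x) _))//.
move: (pderiv _ _ _) (pderiv _ _ _) (pderiv _ _ _) (h 1%N _) (h 2 _) (G k l) => a1 a2 a3 a4 a5 a6.
ring.
Unshelve. all: by end_near. Qed.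

End TraceOperator.

(** * Sublevel sets and finite subcovers *)

Section Sublevel.
Context {R : realType} {T : topologicalType}.
Implicit Types (f : T -> R) (c : R).

Lemma open_sublevel f c : continuous f -> open [set x | f x < c].
Proof.
by move=> cf; apply: (@open_comp _ _ f [set t : R | t < c]) => [x _|]; [exact: cf|exact: open_lt].
Qed.

Lemma open_superlevel f c : continuous f -> open [set x | c < f x].
Proof.
by move=> cf; apply: (@open_comp _ _ f [set t : R | c < t]) => [x _|]; [exact: cf|exact: open_gt].
Qed.

Lemma closed_sublevel f c : continuous f -> closed [set x | f x <= c].
Proof.
by move=> cf; apply: (@preimage_closed _ _ f [set t : R | t <= c]) => [x _|];
  [exact: cf|exact: closed_le].
Qed.
End Sublevel.

Lemma compact_upper_bound {R : realType} {T : topologicalType} (K : set T) (f : T -> R) :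
  compact K -> continuous f -> exists M, forall x, K x -> f x < M.
Proof.
move=> cK cf; have cI : compact (f @` K).
  by apply: continuous_compact => //; exact: continuous_subspaceT.
have /pinfty_ex_gt0[M M0 HM] := compact_bounded cI.
exists (M + 1) => x Kx; apply: le_lt_trans (ler_norm _) _.
by apply: le_lt_trans (HM _ _) _; [exists x|rewrite ltrDl].
Qed.

Lemma compact_seq_cover {T : ptopologicalType} (K : set T) (O : T -> set T) :
  compact K -> (forall x, K x -> open (O x) /\ O x x) ->
  exists s : seq T, (forall x, x \in s -> K x) /\
    forall y, K y -> exists2 x, x \in s & O x y.
Proof.
rewrite compact_cover => cK HO; have [|y Ky|D DK KD] := cK _ K O.
- by move=> x /HO[].
- by exists y => //; have [] := HO y Ky.
exists (enum_fset D); split=> [x xD|y /KD[x /= xD Oxy]]; last by exists x.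
exact/set_mem/DK.
Qed.

(** * Gluing *)

Section Glue.
Context {R : realType} {m : nat}.
Local Notation E := 'rV[R]_m.
Implicit Types (U : set E) (f g u : E -> R) (x : E) (G : 'M[R]_m).

Lemma trGB U G f g x : open U -> Cr 2 U f -> Cr 2 U g -> U x ->
  trG G (fun y => f y - g y) x = trG G f x - trG G g x.
Proof.
move=> oU Hf Hg Ux; rewrite -mulN1r -(trGZ _ _ oU Hg Ux) -(trGD _ oU Hf _ Ux); last exact: CrZ.
by rewrite (_ : (fun y => _ + -1 * _) = (fun y => f y - g y))//; apply/funext => y; rewrite mulN1r.
Qed.

(** The regularized max(f, g): it equals f where f - g >= 1 and g where f - g <= -1. *)
Definition smax (f g : E -> R) x : R := g x + smoothpos 3 (f x - g x).

(** The i-th derivative of [smoothpos 3], in the indexing that [Cr_comp] and [trG_comp] expect. *)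
Definition smoothpos_chain (i : nat) : R -> R := smoothpos (3 - i).

Lemma is_derive_smoothpos_chain i (s : R) : (i < 2)%N ->
  is_derive s 1 (smoothpos_chain i) (smoothpos_chain i.+1 s).
Proof. by case: i => [|[|//]] _; apply: is_derive_smoothpos. Qed.

Lemma Cr_smoothpos U f : open U -> Cr 2 U f -> Cr 2 U (fun y => smoothpos 3 (f y)).
Proof.
move=> oU; exact: (@Cr_comp _ _ 2 U smoothpos_chain f oU
  is_derive_smoothpos_chain (@continuous_smoothpos _ 1)).
Qed.

Lemma Cr_smax U f g : open U -> Cr 2 U f -> Cr 2 U g -> Cr 2 U (smax f g).
Proof.
move=> oU Hf Hg; exact: (CrD oU Hg (Cr_smoothpos oU (CrB oU Hf Hg))).
Qed.

(** With h = [smoothpos 3] and its derivatives taken at f - g, T_G of the maximum is h' T_G f + (1 -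
    h') T_G g + h'' G(d(f - g), d(f - g)): a convex combination plus a nonnegative term. *)
Lemma trG_smax U G f g x c : open U -> psd G -> Cr 2 U f -> Cr 2 U g -> U x ->
  c < trG G f x -> c < trG G g x -> c < trG G (smax f g) x.
Proof.
move=> oU pG Hf Hg Ux cf cg.
have Hd := CrB oU Hf Hg.
rewrite (trGD _ oU Hg (Cr_smoothpos oU Hd) Ux).
rewrite (trG_comp _ oU is_derive_smoothpos_chain Hd Ux) (trGB _ oU Hf Hg Ux).
have := smoothpos2_bounds (f x - g x).
have := smoothpos1_ge0 (f x - g x).
have := pG (fun k => pderiv k (fun y => f y - g y) x).
rewrite /smoothpos_chain.
move: (quad _ _ _) (trG _ _ _) cf (trG _ _ _) cg (smoothpos _ _) (smoothpos _ _) => q t1 c1 t2 c2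
  h1 h2 q0 h20 /andP[h10 h11].
have := mulr_ge0 h20 q0; move: (h2 * q) => p p0.
have e1 : 0 <= h1 * (t1 - c) by apply: mulr_ge0; lra.
(* Strictness comes from g when the weight 1 - h' is positive, and from f in the remaining case h' =
   1. *)
have [h1E|h11'] := eqVneq h1 1; first by rewrite h1E; lra.
have e2 : 0 < (1 - h1) * (t2 - c) by apply: mulr_gt0; rewrite subr_gt0// lt_neqAle h11' h11.
have -> : t2 + (h1 * (t1 - t2) + p) = h1 * (t1 - c) + (1 - h1) * (t2 - c) + c + p by ring.
lra.
Qed.

(** The Euclidean norm is introduced because the norm of row vectors is the sup norm, which is not
    smooth. *)
Definition sqnorm (x : E) : R := \sum_k (x 0 k) ^+ 2.

Lemma sqnorm0 : sqnorm 0 = 0.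
Proof. by apply: big1 => k _; rewrite mxE expr0n. Qed.

Lemma norm_lt_sqnorm x (e : R) : 0 < e -> sqnorm x < e ^+ 2 -> `|x| < e.
Proof.
move=> e0 xe; rewrite [ltLHS]mx_normrE.
apply: bigmax_lt => // -[i j] _ /=; rewrite (ord1 i).
apply: contraTlt xe => xj; rewrite -leNgt /sqnorm (bigD1 j)//= -[leLHS]addr0.
apply: lerD; last by apply: sumr_ge0 => k _; exact: sqr_ge0.
by rewrite -[leRHS]real_normK ?num_real// ler_sqr ?nnegrE// ltW.
Qed.

Lemma Cr_sqnorm_sub r U x0 : open U -> Cr r U (fun x => sqnorm (x - x0)).
Proof.
move=> oU; apply: Cr_sum => // k.
have H : Cr r U (fun x : E => x 0 k - x0 0 k).
  by apply: CrB => //; [exact: Cr_coord|exact: Cr_cst].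
have := CrM oU H H; congr (Cr _ _ _); apply/funext => x.
by rewrite !mxE expr2.
Qed.

Lemma continuous_sqnorm_sub x0 : continuous (fun x => sqnorm (x - x0)).
Proof. by move=> x; apply: (Cr_continuous (Cr_sqnorm_sub 0 x0 openT)). Qed.

Lemma bump (K U : set E) : compact K -> open U -> K `<=` U ->
  exists (phi : E -> R) (Z : set E), [/\ Cr 2 setT phi, closed Z, Z `<=` U,
    forall x, 0 <= phi x & (forall x, ~ Z x -> phi x = 0) /\ forall x, K x -> 1 < phi x].
Proof.
move=> cK oU KU.
have /choice[r Hr] : forall x, exists r : R, 0 < r /\ (K x -> ball x r `<=` U).
  move=> x; have [Kx|nKx] := pselect (K x); last by exists 1.
  have /nbhs_ballP[r /= r0 H] := open_nbhs_nbhs (conj oU (KU _ Kx)).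
  by exists r.
have h0 (t : R) : 0 <= smoothpos 3 t.
  by have /andP[+ _] := smoothpos3_bounds t; apply: le_trans; rewrite le_max lexx orbT.
have [|D [DK KD]] := compact_seq_cover (O := fun x0 => [set x | sqnorm (x - x0) < (r x0) ^+ 2 /
  8]) cK.
  move=> x _; split; first exact/open_sublevel/continuous_sqnorm_sub.
  by rewrite /= subrr sqnorm0 divr_gt0// exprn_gt0//; have [] := Hr x.
(* The argument is at most -1 once |x - i| >= r_i / 2, so the summand vanishes there; it exceeds 1
   when |x - i|^2 < r_i^2 / 8, the radius used for the cover. *)
pose q (i x : E) := 3 - 16 * ((r i) ^- 2 * sqnorm (x - i)).
exists (fun x => \sum_(i <- D) smoothpos 3 (q i x)).
exists (\big[setU/set0]_(i <- D) [set x | sqnorm (x - i) <= (r i / 2) ^+ 2]).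
split.
- apply: Cr_sum => [|i]; first exact: openT.
  apply: Cr_smoothpos; first exact: openT.
  apply: CrB; [exact: openT|exact: Cr_cst|].
  apply: CrZ; first exact: openT.
  apply: CrZ; first exact: openT.
  exact/Cr_sqnorm_sub/openT.
- rewrite big_seq; apply: (big_ind closed); [exact: closed0|exact: closedU|].
  by move=> i _; exact/closed_sublevel/continuous_sqnorm_sub.
- rewrite -bigcup_seq => x [i /= iD xi].
  have [ri Hi] := Hr i; apply: (Hi (DK _ iD)).
  rewrite -ball_normE /= -opprB normrN; apply: norm_lt_sqnorm => //.
  apply: le_lt_trans xi _; rewrite ltr_pXn2r ?nnegrE//; lra.
- by move=> x; apply: sumr_ge0.
split=> [x nZ|x /KD[i iD /= xi]].
  rewrite big_seq big1// => i iD; apply: smoothpos_le.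
  have [ri _] := Hr i.
  rewrite leNgt; apply/negP => qi; apply: nZ; rewrite -bigcup_seq; exists i => //=.
  rewrite exprMn -ler_pdivrMl ?exprn_gt0//.
  move: qi; rewrite /q exprVn; move: (_ * sqnorm _) => t; lra.
have [ri _] := Hr i.
rewrite (big_rem _ iD)/= -[ltLHS]addr0.
apply: ltr_leD; last by apply: sumr_ge0.
have /andP[+ _] := smoothpos3_bounds (q i x).
apply: lt_le_trans; rewrite lt_max; apply/orP; left.
move: xi; rewrite /q -ltr_pdivrMl ?exprn_gt0//; move: (_ * sqnorm _) => t; lra.
Qed.

Definition property_G (GG : set 'M[R]_m) (K : set E) : Prop :=
  forall c : R, exists (U : set E) (f : E -> R),
    [/\ open U, K `<=` U, Cr 2 U f, forall x, U x -> 0 <= f x <= 1 &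
      forall x G, U x -> GG G -> c < trG G f x].

Lemma property_G_sub GG K K' : K' `<=` K -> property_G GG K -> property_G GG K'.
Proof.
move=> KK' HK c; have [U [f [oU KU Hf bf tf]]] := HK c.
by exists U, f; split => //; exact: subset_trans KU.
Qed.

Lemma trG_eq_open U f g G x : open U -> U x -> (forall y, U y -> f y = g y) ->
  trG G f x = trG G g x.
Proof.
move=> oU Ux fg; apply: trG_near.
by have := open_nbhs_nbhs (conj oU Ux); apply: filterS.
Qed.

Definition hessnorm (f : E -> R) x : R := \sum_k \sum_l `|pderiv l (pderiv k f) x|.

Lemma trG_hessnorm (B : R) G f x : (forall k l, `|G k l| <= B) ->
  `|trG G f x| <= B * hessnorm f x.
Proof.
move=> GB; rewrite mulr_sumr; apply: le_trans (ler_norm_sum _ _ _) _.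
apply: ler_sum => k _; rewrite mulr_sumr; apply: le_trans (ler_norm_sum _ _ _) _.
by apply: ler_sum => l _; rewrite normrM ler_wpM2r.
Qed.

Lemma continuous_hessnorm f : Cr 2 setT f -> continuous (hessnorm f).
Proof.
move=> Hf x.
suff H : Cr 0 setT (hessnorm f) by exact: (Cr_continuous H).
apply: Cr_sum => [|k]; first exact: openT.
apply: Cr_sum => [|l]; first exact: openT.
apply/Cr0P => y _.
apply: (@continuous_comp _ _ _ (pderiv l (pderiv k f)) (fun t : R => `|t|)).
  exact: (Cr_continuous (Cr_pderiv l (Cr_pderiv k Hf))).
exact: norm_continuous.
Qed.

(** The glued function takes its values in [0, 4] and is divided by 4 at the end, hence the
    threshold 4 c. *)
Definition local_data (GG : set 'M[R]_m) (c : R) (U : set E) (f : E -> R) : Prop :=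
  [/\ open U, Cr 2 U f, forall x, U x -> 0 <= f x <= 4 &
      forall x G, U x -> GG G -> 4 * c < trG G f x].

(** Regularity, bounds and T_G are local, so it is enough that f agrees near each point of K with a
    good function. The neighbourhood of K is the union of all open sets on which there is such an
    agreement. *)
Lemma property_G_local GG K (f : E -> R) c :
  (forall x, K x -> exists2 U, U x & exists2 g, local_data GG c U g & forall y, U y -> f y = g y) ->
  exists (U : set E) (f : E -> R),
    [/\ open U, K `<=` U, Cr 2 U f, forall x, U x -> 0 <= f x <= 1 &
      forall x G, U x -> GG G -> c < trG G f x].
Proof.
move=> H.
pose good U := exists2 g, local_data GG c U g & forall y, U y -> f y = g y.
have goodP U : good U -> local_data GG c U f.
  case=> g [oU Hg bg tg] fg; split => [||x Ux|x G Ux GGG].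
  - exact: oU.
  - by apply: Cr_eq_open Hg => // x Ux; rewrite fg.
  - by rewrite fg//; exact: bg.
  - by rewrite (trG_eq_open _ oU Ux fg); exact: tg.
exists (\bigcup_(U in good) U), (fun x => 4^-1 * f x).
have oO : open (\bigcup_(U in good) U) by apply: bigcup_open => U /goodP[].
have Hf : Cr 2 (\bigcup_(U in good) U) f.
  apply: Cr_pointwise => x [U /goodP[oU HU _ _] Ux].
  by apply: Cr_sub HU => y ->.
split.
- exact: oO.
- by move=> x /H[U Ux gU]; exists U.
- exact: CrZ.
- move=> x [U /goodP[_ _ bU _] Ux].
  by have := bU x Ux; lra.
- move=> x G Ox GGG; have [U /goodP[_ _ _ tU] Ux] := Ox.
  rewrite (trGZ _ _ oO Hf Ox); have := tU x G Ux GGG; move: (trG _ _ _) => t; lra.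
Qed.

Variables (GG : set 'M[R]_m) (B : R).
Hypotheses (GG_psd : forall G, GG G -> psd G)
  (GG_bound : forall G k l, GG G -> `|G k l| <= B).

(* The maximum of a function a good near L' and of b + 2 - 4 phi, where phi is a
   bump function at L' and b is good near the rest of L.  The bump depends on a
   but not on b, so b can be chosen to absorb its Hessian. *)
Lemma property_G_glue (L L' : set E) : compact L -> compact L' -> L' `<=` L ->
  property_G GG L' ->
  (forall K, compact K -> K `<=` L `\` L' -> property_G GG K) -> property_G GG L.
Proof.
move=> cL cL' L'L PL' PK c.
have [U [a [oU L'U Ha ba ta]]] := PL' (4 * c).
have [phi [Z [Hphi cZ ZU phi0 [phiZ phiL']]]] := bump cL' oU L'U.
have cphi : continuous phi by move=> x; apply: (Cr_continuous Hphi).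
(* On W the function a prevails over [b1], so b has to be good only near the rest of L. *)
pose W := [set x | 1 < phi x].
have oW : open W by exact: open_superlevel.
have WZ : W `<=` Z.
  move=> x Wx; apply: contrapT => /phiZ phix; move: Wx.
  by rewrite /W /= phix ltr10.
have [M HM] := compact_upper_bound cL (continuous_hessnorm Hphi).
pose V0 := [set x | hessnorm phi x < M].
have oV0 : open V0 by exact/open_sublevel/continuous_hessnorm.
(* The part of L outside W is compact and avoids L'. The surplus 4 |B| |M| pays for -4 T_G phi
   wherever [hessnorm phi] is below M. *)
have [||V [b [oV KV Hb bb tb]]] := PK (L `&` ~` W) _ _ (4 * c + 4 * (`|B| * `|M|)).
- exact: (compact_closedI cL (open_closedC oW)).
- by move=> x [Lx Wx]; split => // /phiL' /Wx.
(* Since a and b lie in [0, 1], [b1] < -1 where phi > 1 and [b1] >= 2 where phi = 0. In both places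
   a and [b1] differ by at least 1, the width beyond which [smax] is the exact maximum. *)
pose b1 x := (b x + 2) - 4 * phi x.
have Hb1 (O : set E) : open O -> O `<=` V -> Cr 2 O b1.
  move=> oO OV; apply: CrB; [exact: oO| |apply: CrZ; [exact: oO|exact: Cr_sub Hphi]].
  apply: CrD; [exact: oO|exact: Cr_sub Hb|exact: Cr_cst].
have tb1 x G : V x -> V0 x -> GG G -> 4 * c < trG G b1 x.
  move=> Vx V0x GGG; have Hphi' := Cr_sub (@subsetT _ V) Hphi.
  rewrite (trGB _ oV _ (CrZ _ oV Hphi') Vx); last first.
    by apply: CrD; [exact: oV|exact: Hb|exact: Cr_cst].
  rewrite (trGD _ oV Hb (Cr_cst _ _ _) Vx) (trGZ _ _ oV Hphi' Vx) trG_cst addr0.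
  have := tb x G Vx GGG; rewrite ltrBrDr; apply: le_lt_trans; rewrite lerD2l ler_pM2l//.
  apply: le_trans (ler_norm _) _.
  have GB k l : `|G k l| <= `|B| by apply: le_trans (GG_bound _ _ GGG) (ler_norm _).
  apply: le_trans (trG_hessnorm phi x GB) _.
  by rewrite ler_wpM2l// (le_trans (ltW V0x))// ler_norm.
(* Nothing is known of b at points of W outside V, nor of a outside U, which contains Z. Each
   function is used only where it is controlled, and the cases agree on overlaps by [phiW] and
   [phi0']. *)
pose f x := if 1 < phi x then a x else if `[< Z x >] then smax a b1 x else b1 x.
have phiW x : W x -> V x -> U x -> b1 x <= -1.
  move=> Wx Vx Ux; have := bb x Vx; move: Wx; rewrite /W /b1 /=; lra.
have phi0' x : ~ Z x -> V x -> 2 <= b1 x <= 3.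
  by move=> /phiZ p0 Vx; have := bb x Vx; rewrite /b1 p0; lra.
apply: (@property_G_local _ _ f) => x Lx.
have [Wx|Wx] := pselect (W x).
  exists W => //; exists a; last by move=> y Wy; rewrite /f ifT.
  split.
  - exact: oW.
  - by apply: Cr_sub Ha; exact: subset_trans ZU.
  - by move=> y /WZ/ZU/ba; lra.
  - by move=> y G /WZ/ZU; exact: ta.
have Vx : V x by apply: KV; split.
have [Zx|Zx] := pselect (Z x).
  have oO : open (U `&` V `&` V0) by apply: openI => //; exact: openI.
  have OU : U `&` V `&` V0 `<=` U by move=> y [[]].
  have OV : U `&` V `&` V0 `<=` V by move=> y [[]].
  exists (U `&` V `&` V0); first by split; [split => //; exact: ZU|exact: HM].
  exists (smax a b1).
    split.
    - exact: oO.
    - by apply: Cr_smax; [exact: oO|exact: Cr_sub Ha|exact: Hb1].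
    (* The values lie between a >= 0 and max(a, [b1]) + 1, where a <= 1 and [b1] <= 3. *)
    - move=> y [[Uy Vy] _]; rewrite /smax.
      have := smoothpos3_bounds (a y - b1 y); have := ba y Uy; have := bb y Vy; have := phi0 y.
      have b1E : b1 y = b y + 2 - 4 * phi y by [].
      have : a y - b1 y <= Num.max (a y - b1 y) 0 by rewrite le_max lexx.
      have : 0 <= Num.max (a y - b1 y) 0 by rewrite le_max lexx orbT.
      have : Num.max (a y - b1 y) 0 = a y - b1 y \/ Num.max (a y - b1 y) 0 = 0.
        by rewrite maxEle; case: ifP; [right|left].
      move: (Num.max _ _) (smoothpos _ _) b1E;
        move: (a y) (b1 y) (b y) (phi y) => a' b1' b' p' M' s' E; lra.
    - move=> y G Oy GGG; apply: (trG_smax oO).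
      + exact: GG_psd.
      + exact: Cr_sub Ha.
      + exact: Hb1.
      + exact: Oy.
      + by apply: ta => //; exact: OU.
      + by apply: tb1 => //; [exact: OV|case: Oy].
  move=> y [[Uy Vy] V0y]; rewrite /f.
  case: ifPn => [Wy|_].
    have := phiW y Wy Vy Uy; have := ba y Uy => aU b1U; rewrite /smax smoothpos_ge; lra.
  case: asboolP => // nZ; have := phi0' y nZ Vy; have := ba y Uy => aU b1U.
  by rewrite /smax smoothpos_le ?addr0//; lra.
have oO : open (V `&` V0 `&` ~` Z) by apply: openI; [exact: openI|exact: closed_openC].
have OV : V `&` V0 `&` ~` Z `<=` V by move=> y [[]].
exists (V `&` V0 `&` ~` Z); first by split => //; split => //; exact: HM.
exists b1.
  split.
  - exact: oO.
  - exact: Hb1.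
  - by move=> y [[Vy _] nZ]; have := phi0' y nZ Vy; lra.
  - by move=> y G [[Vy V0y] _] GGG; apply: tb1.
move=> y [[Vy _] nZ]; rewrite /f ifF; last by apply/negP => /WZ.
by case: asboolP.
Qed.
End Glue.

(** * The Baire category theorem for locally closed sets *)

Section Baire.
Context {R : realType} {V : normedModType R}.
Implicit Types (F : set V) (x y : V) (r : R).

Let cball x r : set V := [set y | `|x - y| <= r].

Let cball_sub (U : set V) x : open U -> U x -> exists2 r, 0 < r & cball x r `<=` U.
Proof.
move=> oU Ux; have /nbhs_ballP[r /= r0 H] := open_nbhs_nbhs (conj oU Ux).
exists (r / 2); first by rewrite divr_gt0.
move=> y xy; apply: H; rewrite -ball_normE /=; apply: le_lt_trans xy _; lra.
Qed.

Let closed_cball x r : closed (cball x r).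
Proof.
apply: closed_sublevel => y; apply: cvg_norm; apply: cvgB; [exact: cvg_cst|exact: cvg_id].
Qed.

(** Otherwise every ball centred in F contains a smaller one whose points of F avoid A k. If the
    ball misses O k on F, it does so itself; if not, inside O k there is a point of F outside A k,
    hence outside the closed set C k, and a small ball around it avoids C k. Nested balls then give
    a point of F in no A k. *)
Lemma baire_compact F (A O C : nat -> set V) : compact F -> F !=set0 ->
  F `<=` \bigcup_k A k -> (forall k, open (O k)) -> (forall k, closed (C k)) ->
  (forall k x, F x -> A k x <-> O k x /\ C k x) ->
  exists k x r, [/\ 0 < r, F x & F `&` ball x r `<=` A k].
Proof.
move=> cF [x0 Fx0] FA oO cC AE; apply: contrapT => H.
have {}H k x r : F x -> 0 < r -> exists y, [/\ F y, ball x r y & ~ A k y].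
  move=> Fx r0; apply: contrapT => H'; apply: H; exists k, x, r; split=> // y [Fy xy].
  by apply: contrapT => nA; apply: H'; exists y.
(* A pair is a centre and a radius. The condition is void unless the centre is in F and the radius
   positive, so that the choice function is total. *)
pose good k (s s' : V * R) := F s.1 /\ 0 < s.2 ->
  [/\ F s'.1, 0 < s'.2, cball s'.1 s'.2 `<=` cball s.1 s.2 &
    forall y, F y -> cball s'.1 s'.2 y -> ~ A k y].
have ballcball x r : ball x r `<=` cball x r by move=> y; rewrite -ball_normE /= => /ltW.
have step k s : exists s', good k s s'.
  have [[Fs s0]|ns] := pselect (F s.1 /\ 0 < s.2); last by exists s.
  have fin (U : set V) y : F y -> open U -> U y -> U `<=` ball s.1 s.2 ->
      (forall z, F z -> U z -> ~ A k z) -> exists s', good k s s'.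
    move=> Fy oU Uy Us UA; have [r r0 rU] := cball_sub oU Uy.
    exists (y, r) => _; split => //=.
      by apply: subset_trans rU _; apply: subset_trans Us _.
    by move=> z Fz /rU; exact: UA.
  have ob : open (ball s.1 s.2) by exact: ball_open.
  have avoidC y : F y -> ball s.1 s.2 y -> ~ C k y -> exists s', good k s s'.
    move=> Fy sy nC; apply: (fin (ball s.1 s.2 `&` ~` C k) y) => //.
    - by apply: openI => //; exact: closed_openC.
    - by move=> z Fz [_ nCz] /(AE _ _ Fz)[].
  have [[y [Fy sy Oy]]|nO] := pselect (exists y, [/\ F y, ball s.1 s.2 y & O k y]).
    have /nbhs_ballP[r /= r0 Hr] : nbhs y (ball s.1 s.2 `&` O k).
      by apply: open_nbhs_nbhs; split => //; exact: openI.
    have [z [Fz yz nAz]] := H k y r Fy r0.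
    have [sz Oz] := Hr _ yz.
    by apply: (avoidC z) => // Cz; apply: nAz; apply/AE.
  apply: (fin (ball s.1 s.2) s.1) => //; first exact: ballxx.
  by move=> z Fz sz /(AE _ _ Fz)[Oz _]; apply: nO; exists z.
have /choice[f Hf] : forall ks : nat * (V * R), exists s', good ks.1 ks.2 s'.
  by move=> [k s]; exact: step.
pose fix u n := if n is n'.+1 then f (n', u n') else (x0, 1).
have uF n : F (u n).1 /\ 0 < (u n).2.
  by elim: n => [//|n IH] /=; have [] := Hf (n, u n) IH.
have uS n := Hf (n, u n) (uF n).
have umono j n : cball (u (j + n)%N).1 (u (j + n)%N).2 `<=` cball (u n).1 (u n).2.
  elim: j => [//|j IH]; apply: subset_trans IH; rewrite addSn.
  by have [] := uS (j + n)%N.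
(* Compactness of F gives a cluster point of the centres, which lies in every ball because the balls
   are closed and nested. *)
have [|y [Fy cy]] := cF ((fun n => (u n).1) @ \oo) _ _.
  by exists 0%N => // n _ /=; have [] := uF n.
have [k _ Aky] := FA _ Fy.
have [_ _ _ /(_ y Fy) + ] := uS k; apply => //.
rewrite -[f _]/(u k.+1).
apply: (@closed_cball (u k.+1).1 (u k.+1).2).
move=> B yB; apply: cy => //.
exists k.+1 => // n /= kn; rewrite -(subnK kn); apply: (umono (n - k.+1)%N k.+1).
by rewrite /cball /= subrr normr0 ltW//; have [] := uF (n - k.+1 + k.+1)%N.
Qed.
End Baire.

(** * Reduction to a neighbourhood of a point in one piece *)

Section Localization.
Context {R : realType} {m : nat}.
Local Notation E := 'rV[R]_m.
Variables (GG : set 'M[R]_m) (B : R).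
Hypotheses (GG_psd : forall G, GG G -> psd G)
  (GG_bound : forall G k l, GG G -> `|G k l| <= B).

(** W is the largest open set whose compact subsets in S are good. Were S \ W nonempty, some ball
    around a point p of it would meet S \ W inside a single S_k. A compact K of S in a smaller ball
    is then good: its part outside W by the hypothesis on S_k, compacts of the rest because they lie
    in W. So p would belong to W. *)
Lemma property_G_bigcup (S : set E) (Sk O C : nat -> set E) :
  compact S -> S = \bigcup_k Sk k ->
  (forall k, open (O k)) -> (forall k, closed (C k)) ->
  (forall k, Sk k = S `&` (O k `&` C k)) ->
  (forall k p, Sk k p -> exists2 r, 0 < r &
     forall K, compact K -> K `<=` Sk k `&` ball p r -> property_G GG K) ->
  property_G GG S.
Proof.
move=> cS SE oO cC SkE loc.
pose good (U : set E) := open U /\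
  forall K, compact K -> K `<=` S `&` U -> property_G GG K.
pose W := \bigcup_(U in good) U.
have oW : open W by apply: bigcup_open => U [].
(* Induction on the cover: what remains of K outside U x is covered by the other open sets, and the
   compacts of the complementary part lie in U x. *)
have seq_good (s : seq E) (U : E -> set E) : (forall x, x \in s -> good (U x)) ->
    forall K, compact K -> K `<=` S -> (forall y, K y -> exists2 x, x \in s & U x y) ->
    property_G GG K.
  elim: s => [|x s IH] Hs K cK KS KU.
    apply: (@property_G_sub _ _ _ set0); first by move=> y /KU[].
    move=> c; exists set0, (cst 0); split => //; exact: Cr_cst.
  have [oUx gx] := Hs x (mem_head _ _).
  apply: (property_G_glue GG_psd GG_bound cK (L' := K `&` ~` U x)).
  - exact: (compact_closedI cK (open_closedC oUx)).
  - by move=> y [].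
  - apply: IH => //.
    + by move=> z zs; apply: Hs; rewrite in_cons zs orbT.
    + exact: (compact_closedI cK (open_closedC oUx)).
    + by move=> y [/KS].
    + move=> y [/KU[z]]; rewrite in_cons => /orP[/eqP -> //|zs Uzy _].
      by exists z.
  - move=> K' cK' K'K; apply: gx => // y /K'K[Ky nKy]; split; first exact: KS.
    by apply: contrapT => nU; apply: nKy.
have goodW K : compact K -> K `<=` S `&` W -> property_G GG K.
  move=> cK KW.
  have /choice[U HU] : forall x, exists U : set E, K x -> good U /\ U x.
    move=> x; have [/KW[_ [U gU Ux]]|nK] := pselect (K x); last by exists set0.
    by exists U.
  have [|s [sK Ks]] := compact_seq_cover (O := U) cK.
    by move=> x /HU[[oU _] Ux].
  apply: (seq_good s U) => //.
  - by move=> x /sK/HU[].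
  - by move=> x /KW[].
have [[x [Sx nWx]]|nF] := pselect ((S `&` ~` W) !=set0); last first.
  apply: goodW => // x Sx; split => //.
  by apply: contrapT => nW; apply: nF; exists x.
exfalso.
have cF : compact (S `&` ~` W) by exact: (compact_closedI cS (open_closedC oW)).
have [|||k [p [r [r0 [Sp nWp] FA]]]] := baire_compact (A := Sk) cF _ _ oO cC.
- by exists x.
- by rewrite {1}SE => y [].
- by move=> k y [Sy _]; rewrite SkE; split=> [[_ []]|].
have Skp : Sk k p by apply: FA; split; [split|exact: ballxx].
have [r' r'0 loc'] := loc k p Skp.
(* Within r the bad points lie in S_k; within r' the compacts of S_k are good. *)
apply: nWp; exists (ball p (Num.min r r')); last by apply: ballxx; rewrite lt_min r0.
split; first exact: ball_open.
move=> K cK KS.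
apply: (property_G_glue GG_psd GG_bound cK (L' := K `&` ~` W)).
- exact: (compact_closedI cK (open_closedC oW)).
- by move=> y [].
- apply: loc'; first exact: (compact_closedI cK (open_closedC oW)).
  move=> y [/KS[Sy py] nWy]; split; last by apply: le_ball py; rewrite ge_min lexx orbT.
  by apply: FA; split => //; apply: le_ball py; rewrite ge_min lexx.
- move=> K' cK' K'K; apply: goodW => // y /K'K[Ky nKy]; split; first by have [] := KS _ Ky.
  by apply: contrapT => nU; apply: nKy.
Qed.
End Localization.

(** * Symmetry of second derivatives, tangent spaces *)

Section Lines.
Context {R : realType}.

Lemma is_derive_line {V : normedModType R} (F : V -> R) (y v : V) (s : R) :
  differentiable F (y + s *: v) ->
  is_derive s (1 : R) (fun t : R => F (y + t *: v)) ('D_v F (y + s *: v)).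
Proof.
move=> dF.
have dl : is_diff s (fun t : R => y + t *: v) (fun t => t *: v).
  have := is_diffD (is_diff_cst y s) (is_diff_scalel s v).
  by rewrite add0r.
have dc : differentiable (fun t : R => F (y + t *: v)) s.
  exact: (@differentiable_comp _ _ _ _ (fun t : R => y + t *: v) F).
apply: DeriveDef; first exact: diff_derivable.
rewrite deriveE// (@diff_comp _ _ _ _ (fun t : R => y + t *: v) F)//=.
by rewrite diff_val scale1r deriveE.
Qed.

Lemma MVT_line {V : normedModType R} (F : V -> R) (y v : V) (h : R) : 0 < h ->
  (forall s, 0 <= s <= h -> differentiable F (y + s *: v)) ->
  exists s, [/\ 0 <= s <= h & F (y + h *: v) - F y = h * 'D_v F (y + s *: v)].
Proof.
move=> h0 dF.
have [||s] := @MVT R (fun t => F (y + t *: v)) (fun t => 'D_v F (y + t *: v)) 0 h h0.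
- move=> s /itvP si; apply: is_derive_line; apply: dF; rewrite !si//.
- apply: derivable_within_continuous => s /itvP si.
  by have [] := is_derive_line (dF s _); rewrite ?si.
move=> /itvP si; rewrite scale0r addr0 subr0 mulrC => E.
by exists s; rewrite !si.
Qed.
End Lines.

Section Schwarz.
Context {R : realType} {m : nat}.
Local Notation E := 'rV[R]_m.

Lemma pderivE k (f : E -> R) x : pderiv k f x = 'D_(delta_mx 0 k) f x.
Proof. by []. Qed.

Lemma pderiv_shift k (f : E -> R) w y : pderiv k (fun z => f (z + w)) y = pderiv k f (y + w).
Proof.
by rewrite !pderivE /derive; under eq_fun do rewrite /= -addrA.
Qed.

Lemma differentiable_shift (f : E -> R) w y : differentiable f (y + w) ->
  differentiable (fun z => f (z + w)) y.
Proof.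
by move=> df; apply: (@differentiable_comp _ _ _ _ (fun z => z + w) f).
Qed.

Lemma norm_delta k : `|delta_mx 0 k : E| = 1.
Proof.
apply/eqP; rewrite eq_le; apply/andP; split.
  rewrite [leLHS]mx_normrE; apply: bigmax_le => // -[i j] _ /=.
  by rewrite mxE; case: (_ && _); rewrite ?normr1 ?normr0.
rewrite [leRHS]mx_normrE; apply: le_trans (le_bigmax _ _ (0, k)); rewrite /= mxE !eqxx.
by rewrite normr1.
Qed.

(** The mean value theorem is used twice: along e_k for the increment of f in the direction e_l,
    then along e_l for the k-th derivative of f. *)
Lemma mixed_difference (U : set E) (f : E -> R) (x : E) k l (h : R) : 0 < h ->
  Cr 2 U f -> (forall y, `|y| <= 2 * h -> U (x + y)) ->
  let e i := delta_mx 0 i : E in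
  exists y, `|y| <= 2 * h /\
   f (x + h *: e k + h *: e l) - f (x + h *: e k) - (f (x + h *: e l) - f x) =
    h * (h * pderiv l (pderiv k f) (x + y)).
Proof.
move=> h0 Hf hU e.
have hU2 s t : 0 <= s <= h -> 0 <= t <= h -> `|s *: e k + t *: e l| <= 2 * h.
  move=> /andP[s0 s1] /andP[t0 t1]; apply: le_trans (ler_normD _ _) _.
  by rewrite !normrZ /e !norm_delta !mulr1 !ger0_norm//; lra.
have inU s t : 0 <= s <= h -> 0 <= t <= h -> U (x + s *: e k + t *: e l).
  by move=> s0 t0; rewrite -addrA; apply: hU; exact: hU2.
have hh : 0 <= h <= h by rewrite lexx ltW.
have h00 : 0 <= (0 : R) <= h by rewrite lexx ltW.
have inU' s : 0 <= s <= h -> U (x + s *: e k).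
  by move=> s0; have := inU s 0 s0 h00; rewrite scale0r addr0.
have [|s [s0 Es]] := @MVT_line _ _ (fun z => f (z + h *: e l) - f z) x (e k) h h0.
  move=> s s0; apply: differentiableB; last exact: (Cr_differentiable Hf (inU' _ s0)).
  exact: differentiable_shift (Cr_differentiable Hf (inU _ _ s0 hh)).
have [|t [t0 Et]] := @MVT_line _ _ (pderiv k f) (x + s *: e k) (e l) h h0.
  by move=> t t0; exact: (Cr_differentiable (Cr_pderiv k Hf) (inU _ _ s0 t0)).
exists (s *: e k + t *: e l); split; first exact: hU2.
move: Es => /= ->; congr (_ * _).
rewrite addrA [pderiv l _ _]pderivE -[RHS]Et -[LHS]pderivE pderivB ?pderiv_shift//.
  exact: differentiable_shift (Cr_differentiable Hf (inU _ _ s0 hh)).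
exact: (Cr_differentiable Hf (inU' _ s0)).
Qed.

(** The second difference is symmetric in k and l, so the two mixed derivatives take a common value
    at points arbitrarily close to x; both are continuous. *)
Lemma pderivC (U : set E) (f : E -> R) (x : E) k l : open U -> Cr 2 U f -> U x ->
  pderiv l (pderiv k f) x = pderiv k (pderiv l f) x.
Proof.
move=> oU Hf Ux.
have c1 := Cr_continuous (Cr_pderiv l (Cr_pderiv k Hf)) Ux.
have c2 := Cr_continuous (Cr_pderiv k (Cr_pderiv l Hf)) Ux.
have := fun h h0 => @mixed_difference U f x k l h h0 Hf.
have := fun h h0 => @mixed_difference U f x l k h h0 Hf.
move: (pderiv l (pderiv k f)) (pderiv k (pderiv l f)) c1 c2 => F G c1 c2 MG MF.
apply/eqP; rewrite -subr_eq0 -normr_le0; apply/ler_addgt0Pr => e e0.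
rewrite add0r.
have e2 : 0 < e / 2 by rewrite divr_gt0.
have H : \forall y \near x, [/\ U y, `|F x - F y| < e / 2 & `|G x - G y| < e / 2].
  move/cvgrPdist_lt : c1 => /(_ _ e2) c1; move/cvgrPdist_lt : c2 => /(_ _ e2) c2.
  by apply: filterS3 (open_nbhs_nbhs (conj oU Ux)) c1 c2 => y Uy b1 b2; split;
    [exact: Uy|exact: b1|exact: b2].
have /nbhs_ballP[r /= r0 Hr] := H.
pose h := r / 4.
have h0 : 0 < h by rewrite divr_gt0.
have hU y : `|y| <= 2 * h -> ball x r (x + y).
  move=> yh; rewrite -ball_normE /= opprD addNKr normrN; apply: le_lt_trans yh _; rewrite /h; lra.
have hU' y : `|y| <= 2 * h -> U (x + y) by move=> /hU/Hr[].
have [y [/hU/Hr[_ Hy _] Ey]] := MF h h0 hU'.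
have [z [/hU/Hr[_ _ Hz] Ez]] := MG h h0 hU'.
have hn : h != 0 by rewrite gt_eqF.
have EE : F (x + y) = G (x + z).
  apply: (mulfI hn); apply: (mulfI hn); rewrite -Ey -Ez.
  rewrite -[x + h *: _ + h *: _ in LHS]addrA [h *: _ + h *: _]addrC addrA.
  move: (f _) (f _) (f _) (f _) => a b c d; ring.
move: Hy Hz; rewrite -EE => Ha Hc.
rewrite (splitr e); apply: le_trans (ler_distD (F (x + y)) _ _) _; apply: lerD; first exact: ltW.
by rewrite distrC ltW.
Qed.
End Schwarz.

(** * Norm estimates for matrices *)

Section MatrixBounds.
Context {R : realType}.

Lemma ler_coord_norm n (x : 'rV[R]_n) k : `|x 0 k| <= `|x|.
Proof. by rewrite [leRHS]mx_normrE; exact: (le_bigmax _ (fun ij => `|x ij.1 ij.2|) (0, k)). Qed.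

Lemma norm_row_le n (x : 'rV[R]_n) (a : R) : 0 <= a -> (forall k, `|x 0 k| <= a) -> `|x| <= a.
Proof.
move=> a0 H; rewrite [leLHS]mx_normrE; apply: bigmax_le => // -[i j] _ /=.
by rewrite (ord1 i).
Qed.

Lemma mulmx_bound c n (A : 'M[R]_(c, n)) (a : R) (s : 'rV[R]_c) : 0 <= a ->
  (forall i k, `|A i k| <= a) -> `|s *m A| <= c%:R * a * `|s|.
Proof.
move=> a0 Aa; apply: norm_row_le; first by rewrite !mulr_ge0.
move=> k; rewrite mxE; apply: le_trans (ler_norm_sum _ _ _) _.
apply: (@le_trans _ _ (\sum_(i < c) `|s| * a)).
  by apply: ler_sum => i _; rewrite normrM ler_pM// ler_coord_norm.
by rewrite sumr_const card_ord -[leLHS]mulr_natl [X in _ * X]mulrC mulrA.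
Qed.

Lemma mulmx_lipschitz c n (A : 'M[R]_(c, n)) :
  exists2 C : R, 0 < C & forall s : 'rV_c, `|s *m A| <= C * `|s|.
Proof.
pose a := \sum_i \sum_k `|A i k|.
have a0 : 0 <= a by apply: sumr_ge0 => i _; apply: sumr_ge0.
have Aa i k : `|A i k| <= a.
  rewrite /a (bigD1 i)//= (bigD1 k)//= -addrA lerDl addr_ge0//; first exact: sumr_ge0.
  by apply: sumr_ge0 => j _; apply: sumr_ge0.
exists (c%:R * a + 1); first by rewrite ltr_wpDl// mulr_ge0.
move=> s; apply: le_trans (mulmx_bound _ a0 Aa) _.
by rewrite ler_wpM2r// lerDl.
Qed.

(** If u D D^T = 0 then |u D|^2 = 0, so u = 0 by independence of the rows of D. *)
Lemma gram_unit c n (D : 'M[R]_(c, n)) : row_free D -> D *m D^T \in unitmx.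
Proof.
move=> rD; rewrite -row_free_unit; apply: inj_row_free => u uN.
suff uD : u *m D = 0 by apply: (row_free_inj rD); rewrite uD mul0mx.
have : (u *m D) *m (u *m D)^T = 0 by rewrite trmx_mul mulmxA -(mulmxA u) uN mul0mx.
move: (u *m D) => w /matrixP /(_ 0 0); rewrite !mxE => /eqP.
under eq_bigr do rewrite mxE -expr2.
rewrite psumr_eq0; last by move=> k _; exact: sqr_ge0.
move=> /allP H; apply/rowP => k; have := H k; rewrite mem_index_enum mxE /= => /(_ isT).
by rewrite sqrf_eq0 => /eqP.
Qed.

Lemma continuous_mulmxr c n (D : 'M[R]_(c, n)) (q : 'rV[R]_n) :
  continuous (fun s : 'rV[R]_c => q + s *m D).
Proof.
move=> s; have [C C0 HC] := mulmx_lipschitz D.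
have H (e : R) : 0 < e -> \forall s' \near s, `|q + s *m D - (q + s' *m D)| <= e.
  move=> e0; apply/nbhs_ballP; exists (e / C); first exact: divr_gt0.
  move=> s'; rewrite -ball_normE /= => ss.
  rewrite opprD addrACA subrr add0r -mulmxBl; apply: le_trans (HC _) _.
  by rewrite mulrC -ler_pdivlMr// ltW.
by apply/(@cvgrPdist_le _ _ _ (nbhs s) (nbhs_filter s)).
Qed.

Lemma compact_norm_ball n (a : R) : compact [set s : 'rV[R]_n | `|s| <= a].
Proof.
apply: bounded_closed_compact.
  by exists a; split; [exact: num_real|move=> b ab s /= sa; apply: le_trans sa (ltW ab)].
by apply: closed_sublevel => s; exact: norm_continuous.
Qed.
End MatrixBounds.

(** * Tangent vectors of a regular level set *)

Section Submersion.
Context {R : realType} {m : nat}.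
Local Notation E := 'rV[R]_m.

Lemma diff_approx (f : E -> R) p (e : R) : 0 < e -> differentiable f p ->
  \forall w \near 0, `|f (p + w) - f p - 'D_w f p| <= e * `|w|.
Proof.
move=> e0 df; have /diff_nearP[_ /(_ _ e0)] := df.
by apply: filterS => w; rewrite (addrC w) deriveE.
Qed.

Lemma near_forall (I : finType) (P : I -> E -> Prop) (p : E) :
  (forall i, \forall w \near p, P i w) -> \forall w \near p, forall i, P i w.
Proof. exact: (@filter_forall _ _ _ (nbhs p) (nbhs_filter p)). Qed.

Definition gradmx c (r : 'I_c -> E -> R) x : 'M[R]_(c, m) :=
  \matrix_(i, k) pderiv k (r i) x.

Lemma derive_gradmx c (r : 'I_c -> E -> R) x v i : differentiable (r i) x ->
  'D_v (r i) x = (v *m (gradmx r x)^T) 0 i.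
Proof. by move=> /derive_pderiv ->; rewrite mxE; apply: eq_bigr => k _; rewrite !mxE. Qed.

(** At an interior minimum the derivative of sum r_i^2 along the j-th row of D vanishes; up to the
    factor 2 it is the j-th entry of the product. *)
Lemma critical_point c (r : 'I_c -> E -> R) (D : 'M[R]_(c, m)) (U : set E) (q : E) (s : 'rV[R]_c)
  (a : R) :
  open U -> (forall i, Cr 2 U (r i)) -> `|s| < a ->
  (forall s', `|s'| <= a -> U (q + s' *m D)) ->
  (forall s', `|s'| <= a -> \sum_i r i (q + s *m D) ^+ 2 <= \sum_i r i (q + s' *m D) ^+ 2) ->
  (\row_i r i (q + s *m D)) *m gradmx r (q + s *m D) *m D^T = 0.
Proof.
move=> oU Hr sa aU smin; set y := q + s *m D.
have Uy : U y by apply/aU/ltW.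
pose Phi z := \sum_i r i z * r i z.
have HPhi : Cr 2 U Phi by exact: (Cr_sum _ oU (fun i => CrM oU (Hr i) (Hr i))).
apply/rowP => j; rewrite [RHS]mxE.
pose d := row j D.
have dE t : y + t *: d = q + (s + t *: delta_mx 0 j) *m D.
  by rewrite mulmxDl addrA -scalemxAl -rowE.
pose b := a - `|s|.
have b0 : 0 < b by rewrite subr_gt0.
have inb t : `|t| <= b -> `|s + t *: delta_mx 0 j| <= a.
  move=> tb; apply: le_trans (ler_normD _ _) _.
  by rewrite normrZ norm_delta mulr1; move: tb; rewrite /b; lra.
have bt t : t \in `]-b, b[ -> `|t| <= b.
  by move=> tb; rewrite ler_norml !ltW ?(itvP tb).
have is_der t : t \in `]-b, b[ -> is_derive t (1:R) (fun t => Phi (y + t *: d)) ('D_d Phi (y + t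
  *: d)).
  move=> /bt/inb/aU Ut; apply: is_derive_line; rewrite dE.
  exact: (Cr_differentiable HPhi Ut).
have m0 : 0 \in `]-b, b[ by rewrite in_itv /= b0 oppr_lt0 b0.
have [|||_ +] := @derive1_at_min _ (fun t => Phi (y + t *: d)) (-b) b 0 _ _ m0 _.
- lra.
- by move=> t /is_der[].
- move=> t /bt/inb/smin; rewrite scale0r addr0 dE /Phi -/y.
  by under eq_bigr do rewrite expr2; under [X in _ <= X -> _]eq_bigr do rewrite expr2.
have [_ ->] := is_der 0 m0; rewrite scale0r addr0.
have dr i := Cr_differentiable (Hr i) Uy.
rewrite (derive_pderiv _ (Cr_differentiable HPhi Uy)) mxE => H.
have E1 : \sum_k d 0 k * pderiv k Phi y = 2 * \sum_k (\row_i r i y *m gradmx r y) 0 k * D^T k j.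
  rewrite mulr_sumr; apply: eq_bigr => k _.
  rewrite pderiv_sum; last by move=> i; apply: differentiableM.
  rewrite !mxE mulrC mulrA; congr (_ * _); rewrite mulr_sumr; apply: eq_bigr => i _.
  by rewrite pderivM// !mxE; move: (pderiv _ _ _) (r i y) => A B; ring.
by apply/eqP; have /eqP := H; rewrite E1 mulf_eq0 pnatr_eq0.
Qed.

(* s minimizes sum_i r_i (p + t v + s D)^2 over |s| <= e t.  The minimum is
   attained in the interior since r (p + t v) = o(t), and a critical point is a
   zero because D' D^T is invertible for D' close to D. *)
Lemma submersion_correction c (r : 'I_c -> E -> R) (U : set E) p v (e : R) : open U -> U p ->
  (forall i, Cr 2 U (r i)) -> row_free (gradmx r p) -> (forall i, r i p = 0) ->
  v *m (gradmx r p)^T = 0 -> 0 < e -> e <= 1 ->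
  exists2 t0, 0 < t0 & forall t, 0 < t < t0 -> exists s : 'rV_c, `|s| <= e * t /\
    U (p + t *: v + s *m gradmx r p) /\ forall i, r i (p + t *: v + s *m gradmx r p) = 0.
Proof.
move=> oU Up Hr rfree rp0 Dv e0 e1; set D := gradmx r p in rfree Dv *.
have [C C0 HC] := mulmx_lipschitz D.
have [C2 C20 HC2] := mulmx_lipschitz D^T.
have NU := gram_unit rfree.
have [K K0 HK'] := mulmx_lipschitz (invmx (D *m D^T)).
have HK (s : 'rV_c) : `|s| <= K * `|s *m (D *m D^T)|.
  by rewrite -{1}(mulmxK NU s).
(* With |w| <= t (|v| + C) and |r_i| <= (c + 1) h t |v| at the minimum, each entry of s D D^T is at
   most h Q t. The final 1 makes Q positive. *)
pose Q := (c%:R + 2) * `|v| + C + 1.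
have Q0 : 0 < Q by rewrite /Q ltr_wpDl// addr_ge0 ?(ltW C0)// mulr_ge0// addr_ge0.
(* The tolerance in the first-order expansion and in the variation of the gradients. The first bound
   gives K h Q < e and keeps the minimum interior; the second gives K C2 c h < 1 and forces a
   critical point to be a zero. *)
pose h := Num.min (e / (2 * K * Q)) (1 / (2 * K * C2 * (c%:R + 1))).
have c1 : 0 < c%:R + 1 :> R by rewrite ltr_wpDl.
have h0 : 0 < h by rewrite lt_min !divr_gt0// !mulr_gt0.
have h1 : K * h * Q < e.
  have : h <= e / (2 * K * Q) by rewrite ge_min lexx.
  rewrite ler_pdivlMr ?mulr_gt0//; have := mulr_gt0 (mulr_gt0 K0 h0) Q0.
  have -> : h * (2 * K * Q) = 2 * (K * h * Q) by ring.
  move: (K * h * Q) => X; lra.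
have h2 : K * C2 * (c%:R * h) < 1.
  have : h <= 1 / (2 * K * C2 * (c%:R + 1)) by rewrite ge_min lexx orbT.
  rewrite ler_pdivlMr ?mulr_gt0//.
  have := mulr_gt0 (mulr_gt0 K0 C20) h0;
    have := mulr_ge0 (ltW (mulr_gt0 (mulr_gt0 K0 C20) h0)) (ler0n R c).
  have -> : h * (2 * K * C2 * (c%:R + 1)) = 2 * (K * C2 * h * c%:R) + 2 * (K * C2 * h) by ring.
  have -> : K * C2 * (c%:R * h) = K * C2 * h * c%:R by ring.
  move: (K * C2 * h) => Y; move: (Y * _) => X; lra.
have drp i := Cr_differentiable (Hr i) Up.
have near0 : \forall w \near (0 : E), U (p + w) /\
   ((forall i, `|r i (p + w) - r i p - 'D_w (r i) p| <= h * `|w|) /\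
   (forall i k, `|D i k - gradmx r (p + w) i k| <= h)).
  have shiftP (P : set E) : nbhs p P -> \forall w \near (0 : E), P (p + w).
    move=> /nbhs_ballP[d /= d0 dP]; apply/nbhs_ballP; exists d => // w.
    rewrite -ball_normE /= sub0r normrN => wd; apply: dP.
    by rewrite -ball_normE /= opprD addNKr normrN.
  apply: filterI; first exact/shiftP/open_nbhs_nbhs.
  apply: filterI; first exact: (near_forall (fun i => diff_approx h0 (drp i))).
  have N k i : \forall w \near (0 : E), `|D i k - gradmx r (p + w) i k| <= h.
    have /cvgrPdist_le /(_ _ h0) H := Cr_continuous (Cr_pderiv k (Hr i)) Up.
    by have := shiftP _ H; apply: filterS => w /=; rewrite !mxE.
  exact: (near_forall (fun i => near_forall (fun k => N k i))).
have /nbhs_ballP[dl /= dl0 Hdl] := near0.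
have vC : 0 < `|v| + C by rewrite ltr_wpDl.
exists (dl / (`|v| + C)); first by rewrite divr_gt0.
move=> t /andP[t0]; rewrite ltr_pdivlMr// => tdl.
pose w s := t *: v + s *m D.
have wb s : `|s| <= e * t -> `|w s| <= t * (`|v| + C).
  move=> st; apply: le_trans (ler_normD _ _) _; rewrite mulrDr lerD//.
    by rewrite normrZ gtr0_norm.
  apply: le_trans (HC s) _; rewrite mulrC ler_pM2r//; apply: le_trans st _.
  by rewrite ler_piMl// ltW.
have near_w s : `|s| <= e * t -> U (p + w s) /\
   ((forall i, `|r i (p + w s) - r i p - 'D_(w s) (r i) p| <= h * `|w s|) /\
   (forall i k, `|D i k - gradmx r (p + w s) i k| <= h)).
  move=> st; apply: Hdl; rewrite -ball_normE /= sub0r normrN.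
  exact: le_lt_trans (wb s st) tdl.
have et0 : 0 < e * t by exact: mulr_gt0.
pose Phi s := \sum_i r i (p + w s) ^+ 2.
have wE s : p + w s = p + t *: v + s *m D by rewrite addrA.
have [||s0 /set_mem /= s0b smin] := @EVT_min_rV R c Phi [set s | `|s| <= e * t] _
  (@compact_norm_ball R c (e * t)) _.
- by exists 0; rewrite /= normr0 ltW.
- apply: continuous_in_subspaceT => s /set_mem /= sb.
  have Us := (near_w s sb).1.
  apply: (@continuous_comp _ _ _ (fun s => p + w s) (fun z => \sum_i r i z ^+ 2)).
    by rewrite (_ : (fun s => p + w s) = (fun s => p + t *: v + s *m D));
      [exact: continuous_mulmxr|apply/funext => s'; exact: wE].
  exact: (Cr_continuous (Cr_sum _ oU (fun i => CrM oU (Hr i) (Hr i))) Us).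
have {}smin s' : `|s'| <= e * t -> Phi s0 <= Phi s'.
  by move=> s'b; apply: smin; apply: mem_set.
have dE s i : 'D_(w s) (r i) p = (s *m (D *m D^T)) 0 i.
  by rewrite (derive_gradmx _ (drp i)) mulmxDl -scalemxAl Dv scaler0 add0r mulmxA.
pose a := h * (t * `|v|).
have a0 : 0 <= a by rewrite /a !mulr_ge0// ltW.
have u0b i : `|r i (p + w 0)| <= a.
  have /near_w[_ [/(_ i) + _]] : `|0 : 'rV[R]_c| <= e * t by rewrite normr0 ltW.
  by rewrite dE mul0mx mxE rp0 !subr0 /w mul0mx addr0 normrZ (gtr0_norm t0).
(* Comparison with s = 0: each r_i^2 is at most the minimum, hence at most c a^2 <= ((c + 1)
   a)^2. *)
have ub i : `|r i (p + w s0)| <= (c%:R + 1) * a.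
  have ca : 0 <= (c%:R + 1) * a by rewrite mulr_ge0 ?(ltW c1).
  rewrite -ler_sqr ?nnegrE// real_normK ?num_real//.
  apply: (@le_trans _ _ (Phi s0)).
    by rewrite /Phi (bigD1 i)//= lerDl sumr_ge0// => k _; exact: sqr_ge0.
  apply: le_trans (smin 0 _) _; first by rewrite normr0 ltW.
  apply: (@le_trans _ _ (\sum_(i < c) a ^+ 2)).
    by apply: ler_sum => k _; rewrite -real_normK ?num_real// ler_sqr ?nnegrE.
  rewrite sumr_const card_ord -[leLHS]mulr_natl [leRHS]exprMn ler_wpM2r ?sqr_ge0//.
  have := ler0n R c; move: (c%:R) => X X0; nra.
have s0lt : `|s0| < e * t.
  apply: le_lt_trans (HK s0) _.
  apply: (@le_lt_trans _ _ (K * h * Q * t)); last by rewrite ltr_pM2r.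
  rewrite -!mulrA ler_pM2l//.
  have Qt0 : 0 <= Q * t by rewrite mulr_ge0// ltW.
  apply: norm_row_le; first by rewrite mulr_ge0 ?(ltW h0).
  move=> i; rewrite -dE.
  have [_ [/(_ i) Hi _]] := near_w s0 s0b.
  have := ub i; have := wb s0 s0b; move: Hi; rewrite rp0 subr0 distrC => Hi Hw Hu.
  have T1 := le_trans (ler_normD _ _) (lerD Hi Hu); rewrite subrK in T1.
  apply: le_trans T1 _; apply: (@le_trans _ _ (h * (t * (`|v| + C)) + (c%:R + 1) * a)).
    by rewrite lerD2r ler_pM2l.
  rewrite /a /Q [(_ + 1) * (h * _)]mulrCA -mulrDr ler_pM2l//.
  have -> : ((c%:R + 2) * `|v| + C + 1) * t = t * (`|v| + C) + (c%:R + 1) * (t * `|v|) + t by ring.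
  by rewrite lerDl ltW.
exists s0; split; first exact: ltW.
rewrite -wE; split; first exact: (near_w s0 s0b).1.
have Hc : (\row_i r i (p + t *: v + s0 *m D)) *m gradmx r (p + t *: v + s0 *m D) *m D^T = 0.
  apply: (critical_point oU Hr s0lt) => s' s'b; rewrite -wE; first exact: (near_w s' s'b).1.
  by rewrite -wE; exact: smin.
move: Hc; rewrite -wE; set u := \row_i _ => Hc.
suff u0 : u = 0 by move=> i; have := congr1 (fun x : 'rV_c => x 0 i) u0; rewrite !mxE.
(* With D' the gradient matrix at the minimum, u D' D^T = 0 gives u D D^T = u (D - D') D^T, so |u|
   <= K C2 c h |u| with a factor less than 1. *)
apply/eqP; rewrite -normr_le0 leNgt; apply/negP => un0.
have : `|u| <= K * (C2 * (c%:R * h * `|u|)).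
  apply: le_trans (HK u) _; rewrite ler_pM2l//.
  have -> : u *m (D *m D^T) = u *m (D - gradmx r (p + w s0)) *m D^T.
    by rewrite mulmxBr mulmxBl Hc subr0 mulmxA.
  apply: le_trans (HC2 _) _; rewrite ler_pM2l//.
  apply: mulmx_bound; first exact: ltW.
  by move=> i k; rewrite !mxE; have [_ [_ /(_ i k)]] := near_w s0 s0b; rewrite !mxE.
rewrite !mulrA -mulrA -[leLHS]mul1r mulrA ler_pM2r// leNgt.
by rewrite -(mulrA _ c%:R) h2.
Qed.
(** For v in the kernel of the dr_i and any e, M contains points p + t v + s D with |s| <= e t. If f
    vanishes on M, expanding it at these points gives |D_v f| <= e Q with Q independent of e, hence
    D_v f = 0. *)
Lemma submersion_tangent c (r : 'I_c -> E -> R) (U M : set E) p v : open U -> U p -> M p ->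
  (forall i, smooth U (r i)) -> M `&` U = [set x | U x /\ forall i, r i x = 0] ->
  row_free (gradmx r p) -> tangent M p v <-> forall i, 'D_v (r i) p = 0.
Proof.
move=> oU Up Mp Hr MU rfree.
have rp0 i : r i p = 0.
  have : (M `&` U) p by [].
  by rewrite MU => -[_]; apply.
split=> [tv i|Dv].
  apply: (tv U); [exact: oU|exact: Up|exact: Hr|].
  by move=> y; rewrite MU => -[_]; apply.
move=> U' f oU' U'p Hf fM.
have Hr2 i := Hr i 2.
have drp i := Cr_differentiable (Hr2 i) Up.
have Dv0 : v *m (gradmx r p)^T = 0.
  by apply/rowP => i; rewrite [RHS]mxE -(derive_gradmx _ (drp i)) Dv.
set D := gradmx r p in rfree Dv0.
have [C C0 HC] := mulmx_lipschitz D.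
pose F := (gradmx (fun _ : 'I_1 => f) p)^T.
have [C3 C30 HC3] := mulmx_lipschitz F.
have df := Cr_differentiable (Hf 1) U'p.
have fE w : 'D_w f p = (w *m F) 0 0 by rewrite -(derive_gradmx (r := fun _ => f)).
(* The first two terms come from the remainder of f at w, the third from the differential of f on
   the correction s D. *)
pose Q := `|v| + C + C3 * C.
have Q0 : 0 < Q by rewrite /Q ltr_pwDr ?mulr_gt0// addr_ge0// ltW.
have small e : 0 < e -> e <= 1 -> `|'D_v f p| <= e * Q.
  move=> e0 e1.
  have [t0 t00 Ht0] := submersion_correction oU Up Hr2 rfree rp0 Dv0 e0 e1.
  have vC : 0 < `|v| + C by rewrite ltr_wpDl.
  have /nbhs_ballP[d1 /= d10 Hd1] := diff_approx e0 df.
  have /nbhs_ballP[d2 /= d20 Hd2] := open_nbhs_nbhs (conj oU' U'p).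
  pose t := Num.min (t0 / 2) (Num.min d1 d2 / (2 * (`|v| + C))).
  have t1 : 0 < t by rewrite lt_min !divr_gt0 ?lt_min ?d10// mulr_gt0.
  have tt0 : 0 < t < t0.
    by rewrite t1 /= gt_min; apply/orP; left; lra.
  have td : t * (`|v| + C) < Num.min d1 d2.
    have : t <= Num.min d1 d2 / (2 * (`|v| + C)) by rewrite ge_min lexx orbT.
    rewrite ler_pdivlMr ?mulr_gt0// mulrCA.
    by have := mulr_gt0 t1 vC; move: (t * _) (Num.min _ _) => a b; lra.
  have [s [st [Us rs]]] := Ht0 t tt0.
  pose w := t *: v + s *m D.
  have wb : `|w| <= t * (`|v| + C).
    apply: le_trans (ler_normD _ _) _; rewrite mulrDr lerD//.
      by rewrite normrZ gtr0_norm.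
    apply: le_trans (HC s) _; rewrite mulrC ler_pM2r//; apply: le_trans st _.
    by rewrite ler_piMl// ltW.
  have := le_lt_trans wb td; rewrite lt_min => /andP[wd1 wd2].
  have My : M (p + w).
    have : (M `&` U) (p + w) by rewrite MU /w addrA; split.
    by case.
  have f0 : f (p + w) = 0.
    apply: fM; split => //; apply: Hd2; rewrite -ball_normE /=.
    by rewrite opprD addNKr normrN.
  have fp0 : f p = 0 by apply: fM.
  have : `|'D_w f p| <= e * (t * (`|v| + C)).
    have : `|f (p + w) - f p - 'D_w f p| <= e * `|w|.
      by apply: Hd1; rewrite -ball_normE /= sub0r normrN.
    rewrite f0 fp0 subrr sub0r normrN => /le_trans; apply.
    by rewrite ler_pM2l.
  have -> : 'D_w f p = t * 'D_v f p + (s *m D *m F) 0 0.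
    by rewrite !fE /w mulmxDl -scalemxAl !mxE.
  have H3 : `|(s *m D *m F) 0 0| <= C3 * (C * (e * t)).
    apply: le_trans (ler_coord_norm _ _) _; apply: le_trans (HC3 _) _.
    by rewrite ler_pM2l//; apply: le_trans (HC _) _; rewrite ler_pM2l.
  move=> H4; rewrite -(ler_pM2l t1) -{1}(gtr0_norm t1) -normrM.
  have -> : t * 'D_v f p = (t * 'D_v f p + (s *m D *m F) 0 0) - (s *m D *m F) 0 0 by rewrite addrK.
  apply: le_trans (ler_normB _ _) _; apply: le_trans (lerD H4 H3) _.
  by rewrite le_eqVlt; apply/orP; left; apply/eqP; rewrite /Q; ring.
apply/eqP; rewrite -normr_le0 leNgt; apply/negP => D0.
have /small : 0 < Num.min 1 (`|'D_v f p| / (2 * Q)).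
  by rewrite lt_min ltr01 divr_gt0// mulr_gt0.
rewrite ge_min lexx => /(_ isT); apply/negP; rewrite -ltNge.
rewrite -ltr_pdivlMr// gt_min; apply/orP; right.
by rewrite ltr_pM2l// ltf_pV2 ?posrE ?mulr_gt0//; lra.
Qed.
End Submersion.

(** * The Levi form *)

Section ComplexCalculus.
Context {R : realType} {m : nat}.
Local Notation E := 'rV[R]_m.
Local Notation C := R[i].
Implicit Types (U : set E) (F G : E -> C) (f : E -> R) (x : E) (w : 'rV[C]_m).

Lemma smoothD U f g : open U -> smooth U f -> smooth U g -> smooth U (fun y => f y + g y).
Proof. by move=> oU Hf Hg r; exact: (CrD oU (Hf r) (Hg r)). Qed.

Lemma smoothB U f g : open U -> smooth U f -> smooth U g -> smooth U (fun y => f y - g y).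
Proof. by move=> oU Hf Hg r; exact: (CrB oU (Hf r) (Hg r)). Qed.

Lemma smoothN U f : open U -> smooth U f -> smooth U (fun y => - f y).
Proof. by move=> oU Hf r; exact: (CrN oU (Hf r)). Qed.

Lemma smoothM U f g : open U -> smooth U f -> smooth U g -> smooth U (fun y => f y * g y).
Proof. by move=> oU Hf Hg r; exact: (CrM oU (Hf r) (Hg r)). Qed.

Lemma smooth_cst U (a : R) : smooth U (fun=> a).
Proof. by move=> r; exact: (Cr_cst r U a). Qed.

Lemma smooth_differentiable U f x : smooth U f -> U x -> differentiable f x.
Proof. by move=> /(_ 1) H; exact: (Cr_differentiable H). Qed.

Lemma smooth_sub U V f : V `<=` U -> smooth U f -> smooth V f.
Proof. by move=> VU Hf r; exact: (Cr_sub VU (Hf r)). Qed.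

Lemma csmoothD U F G : open U -> csmooth U F -> csmooth U G -> csmooth U (fun y => F y + G y).
Proof.
move=> oU [F1 F2] [G1 G2]; split.
  rewrite (_ : (fun x => _) = fun x => complex.Re (F x) + complex.Re (G x)); first exact: smoothD.
  by apply/funext => y; case: (F y); case: (G y).
rewrite (_ : (fun x => _) = fun x => complex.Im (F x) + complex.Im (G x)); first exact: smoothD.
by apply/funext => y; case: (F y); case: (G y).
Qed.

Lemma csmoothM U F G : open U -> csmooth U F -> csmooth U G -> csmooth U (fun y => F y * G y).
Proof.
move=> oU [F1 F2] [G1 G2]; split.
  rewrite (_ : (fun x => _) = fun x => complex.Re (F x) * complex.Re (G x) -
     complex.Im (F x) * complex.Im (G x)); first by apply: smoothB => //; exact: smoothM.
  by apply/funext => y; case: (F y) => a b; case: (G y) => c d.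
rewrite (_ : (fun x => _) = fun x => complex.Re (F x) * complex.Im (G x) +
   complex.Im (F x) * complex.Re (G x)); first by apply: smoothD => //; exact: smoothM.
by apply/funext => y; case: (F y) => a b; case: (G y) => c d.
Qed.

Lemma csmooth_cst U (a : C) : csmooth U (fun=> a).
Proof. by split; exact: smooth_cst. Qed.

Lemma csmooth_real U f : smooth U f -> csmooth U (fun y => (f y)%:C).
Proof. by move=> Hf; split => //=; exact: smooth_cst. Qed.

Lemma csmooth_conj U F : open U -> csmooth U F -> csmooth U (fun y => (F y)^*%C).
Proof.
move=> oU [F1 F2]; split.
  by rewrite (_ : (fun x => _) = fun x => complex.Re (F x))//; apply/funext => y; case: (F y).
rewrite (_ : (fun x => _) = fun x => - complex.Im (F x)); first exact: smoothN.
by apply/funext => y; case: (F y).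
Qed.

Lemma csmooth_sum U (I : Type) (s : seq I) (F : I -> E -> C) : open U ->
  (forall i, csmooth U (F i)) -> csmooth U (fun y => \sum_(i <- s) F i y).
Proof.
move=> oU HF; elim: s => [|i s IH].
  by under eq_fun do rewrite big_nil; exact: csmooth_cst.
by under eq_fun do rewrite big_cons; exact: csmoothD.
Qed.

Lemma csmooth_sub U V F : V `<=` U -> csmooth U F -> csmooth V F.
Proof. by move=> VU [F1 F2]; split; exact: smooth_sub VU _. Qed.

Definition cdiff F x := differentiable (fun y => complex.Re (F y)) x /\
  differentiable (fun y => complex.Im (F y)) x.

Lemma csmooth_cdiff U F x : csmooth U F -> U x -> cdiff F x.
Proof. by move=> [F1 F2] Ux; split; exact: smooth_differentiable Ux. Qed.

Lemma cpderivD k F G x : cdiff F x -> cdiff G x ->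
  cpderiv k (fun y => F y + G y) x = cpderiv k F x + cpderiv k G x.
Proof.
move=> [F1 F2] [G1 G2]; rewrite /cpderiv.
rewrite (_ : (fun y => complex.Re (F y + G y)) = fun x => complex.Re (F x) + complex.Re (G x));
  last first.
  by apply/funext => y; case: (F y); case: (G y).
rewrite (_ : (fun y => complex.Im (F y + G y)) = fun x => complex.Im (F x) + complex.Im (G x));
  last first.
  by apply/funext => y; case: (F y); case: (G y).
by rewrite !pderivD.
Qed.

Lemma cpderivM k F G x : cdiff F x -> cdiff G x ->
  cpderiv k (fun y => F y * G y) x = cpderiv k F x * G x + F x * cpderiv k G x.
Proof.
move=> [F1 F2] [G1 G2]; rewrite /cpderiv.
rewrite (_ : (fun y => complex.Re (F y * G y)) = fun x => complex.Re (F x) * complex.Re (G x) -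
     complex.Im (F x) * complex.Im (G x)); last first.
  by apply/funext => y; case: (F y) => a b; case: (G y) => c d.
rewrite (_ : (fun y => complex.Im (F y * G y)) = fun x => complex.Re (F x) * complex.Im (G x) +
     complex.Im (F x) * complex.Re (G x)); last first.
  by apply/funext => y; case: (F y) => a b; case: (G y) => c d.
rewrite pderivB ?pderivD ?pderivM//; try exact: differentiableM.
case: (F x) (G x) => a b [c d] /=.
move: (pderiv _ _ _) (pderiv _ _ _) (pderiv _ _ _) (pderiv _ _ _) => p1 p2 p3 p4.
by apply/eqP; rewrite eq_complex /=; apply/andP; split; apply/eqP; ring.
Qed.

Lemma cpderiv_cst k (a : C) x : cpderiv k (fun=> a) x = 0.
Proof. by rewrite /cpderiv -!/(cst _) !pderiv_cst. Qed.

Lemma cpderiv_real k f x : cpderiv k (fun y => (f y)%:C) x = (pderiv k f x)%:C.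
Proof. by rewrite /cpderiv /= -/(cst 0) pderiv_cst. Qed.

Lemma cdiff_sum (I : Type) (s : seq I) (F : I -> E -> C) x :
  (forall i, cdiff (F i) x) -> cdiff (fun y => \sum_(i <- s) F i y) x.
Proof.
move=> HF; elim: s => [|i s [IH1 IH2]].
  by under eq_fun do rewrite big_nil; split; exact: differentiable_cst.
have [H1 H2] := HF i; under eq_fun do rewrite big_cons; split.
  rewrite (_ : (fun y => _) = fun x => complex.Re (F i x) + complex.Re (\sum_(i <- s) F i x)).
    exact: differentiableD.
  by apply/funext => y; case: (F i y); case: (\sum_(i <- s) F i y).
rewrite (_ : (fun y => _) = fun x => complex.Im (F i x) + complex.Im (\sum_(i <- s) F i x)).
  exact: differentiableD.
by apply/funext => y; case: (F i y); case: (\sum_(i <- s) F i y).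
Qed.

Lemma cpderiv_sum k (I : Type) (s : seq I) (F : I -> E -> C) x :
  (forall i, cdiff (F i) x) ->
  cpderiv k (fun y => \sum_(i <- s) F i y) x = \sum_(i <- s) cpderiv k (F i) x.
Proof.
move=> HF; elim: s => [|i s IH].
  by under eq_fun do rewrite big_nil; rewrite big_nil cpderiv_cst.
under eq_fun do rewrite big_cons; rewrite big_cons cpderivD ?IH//.
exact: cdiff_sum.
Qed.

(** Derivative along a constant complex vector: [vapply X F x] is [dapply (X x) F x]. *)
Definition dapply w F x : C := \sum_k w 0 k * cpderiv k F x.

Lemma dapplyM w F G x : cdiff F x -> cdiff G x ->
  dapply w (fun y => F y * G y) x = dapply w F x * G x + F x * dapply w G x.
Proof.
move=> dF dG; rewrite /dapply mulr_suml mulr_sumr -big_split; apply: eq_bigr => k _.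
by rewrite cpderivM// mulrDr mulrA mulrCA.
Qed.

Lemma dapply_cst w (a : C) x : dapply w (fun=> a) x = 0.
Proof. by rewrite /dapply big1// => k _; rewrite cpderiv_cst mulr0. Qed.

Lemma dapply_sum w (I : Type) (s : seq I) (F : I -> E -> C) x :
  (forall i, cdiff (F i) x) ->
  dapply w (fun y => \sum_(i <- s) F i y) x = \sum_(i <- s) dapply w (F i) x.
Proof.
move=> HF; rewrite /dapply exchange_big; apply: eq_bigr => k _.
by rewrite cpderiv_sum// mulr_sumr.
Qed.

Lemma sum_complex (I : Type) (s : seq I) (a b : I -> R) :
  \sum_(i <- s) (a i +i* b i) = (\sum_(i <- s) a i) +i* (\sum_(i <- s) b i).
Proof.
elim: s => [|i s IH]; first by rewrite !big_nil.
by rewrite !big_cons IH.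
Qed.

(** Tangency is stated for real vectors and real functions; the four combinations of real and
    imaginary parts of w and F recover the complex statement. *)
Lemma ctangent_dapply (S U : set E) x w F : ctangent S x w -> open U -> U x ->
  csmooth U F -> (forall y, (S `&` U) y -> F y = 0) -> dapply w F x = 0.
Proof.
move=> [t1 t2] oU Ux [F1 F2] FS.
have z1 y : (S `&` U) y -> complex.Re (F y) = 0 by move=> /FS ->.
have z2 y : (S `&` U) y -> complex.Im (F y) = 0 by move=> /FS ->.
have d1 := smooth_differentiable F1 Ux; have d2 := smooth_differentiable F2 Ux.
have := t1 U _ oU Ux F1 z1; have := t1 U _ oU Ux F2 z2.
have := t2 U _ oU Ux F1 z1; have := t2 U _ oU Ux F2 z2.
rewrite !derive_pderiv// => e1 e2 e3 e4.
have E1 : dapply w F x =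
   (\sum_k map_mx (@complex.Re R) w 0 k * pderiv k (fun y => complex.Re (F y)) x
   - \sum_k map_mx (@complex.Im R) w 0 k * pderiv k (fun y => complex.Im (F y)) x) +i*
   (\sum_k map_mx (@complex.Re R) w 0 k * pderiv k (fun y => complex.Im (F y)) x
   + \sum_k map_mx (@complex.Im R) w 0 k * pderiv k (fun y => complex.Re (F y)) x).
  rewrite -sumrB -big_split /=.
  rewrite (_ : dapply w F x = \sum_k ((complex.Re (w 0 k) * pderiv k (fun y => complex.Re (F y)) x
     - complex.Im (w 0 k) * pderiv k (fun y => complex.Im (F y)) x) +i*
     (complex.Re (w 0 k) * pderiv k (fun y => complex.Im (F y)) x
     + complex.Im (w 0 k) * pderiv k (fun y => complex.Re (F y)) x))).
    under [in RHS]eq_bigr do rewrite !mxE.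
    under [X in _ +i* X]eq_bigr do rewrite !mxE.
    by rewrite sum_complex.
  by apply: eq_bigr => k _; rewrite /cpderiv; case: (w 0 k).
by rewrite E1 e1 e2 e3 e4 subrr addr0.
Qed.

End ComplexCalculus.

Section ComplexStructureMatrix.
Variable n : nat.

(** The complex structure acting on rows from the right, over any ring so that one matrix serves
    both real and complex vectors. *)
Definition Jmx (K : pzRingType) : 'M[K]_(n + n) := block_mx 0 1%:M (- 1%:M) 0.

Lemma Jmx_sqr (K : pzRingType) : Jmx K *m Jmx K = - 1%:M.
Proof.
rewrite /Jmx mulmx_block !(mul0mx, mulmx0, mulmx1, mul1mx, add0r, addr0).
by rewrite [in RHS]scalar_mx_block opp_block_mx !oppr0.
Qed.

Lemma tr_Jmx (K : pzRingType) : (Jmx K)^T = - Jmx K.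
Proof. by rewrite /Jmx tr_block_mx opp_block_mx !trmx0 linearN /= trmx1 opprK !oppr0. Qed.

Lemma map_Jmx (K K' : pzRingType) (f : {rmorphism K -> K'}) : map_mx f (Jmx K) = Jmx K'.
Proof. by rewrite /Jmx map_block_mx map_mxN !map_mx0 map_mx1. Qed.

Lemma Jstr_Jmx (R : realType) (w : 'rV[R[i]]_(n + n)) : Jstr w = w *m Jmx _.
Proof.
rewrite /Jstr /Jmx -{3}(hsubmxK w) mul_row_block !mulmx0 add0r addr0 mulmx1.
by rewrite mulmxN mulmx1.
Qed.
End ComplexStructureMatrix.

Section GradientPairing.
Context {R : realType} {m : nat}.
Local Notation E := 'rV[R]_m.
Local Notation C := R[i].
Local Notation RC := (real_complex R).
Variable rho : E -> R.

Definition grad (x : E) : 'rV[R]_m := \row_k pderiv k rho x.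
Definition hess (x : E) : 'M[R]_m := \matrix_(l, k) pderiv l (pderiv k rho) x.
Definition gradpair (x : E) (w : 'rV[C]_m) : C := (w *m (map_mx RC (grad x))^T) 0 0.
(** The extension is bilinear, not sesquilinear; conjugations are written explicitly where the Levi
    form needs them. *)
Definition hessform (x : E) (w w' : 'rV[C]_m) : C := (w *m map_mx RC (hess x) *m w'^T) 0 0.

Lemma gradpairD x w w' : gradpair x (w + w') = gradpair x w + gradpair x w'.
Proof. by rewrite /gradpair mulmxDl mxE. Qed.

Lemma gradpairZ x a w : gradpair x (a *: w) = a * gradpair x w.
Proof. by rewrite /gradpair -scalemxAl mxE. Qed.

Lemma hessformDl x w1 w2 w : hessform x (w1 + w2) w = hessform x w1 w + hessform x w2 w.
Proof. by rewrite /hessform !mulmxDl mxE. Qed.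

Lemma hessformZl x a w1 w : hessform x (a *: w1) w = a * hessform x w1 w.
Proof. by rewrite /hessform -!scalemxAl mxE. Qed.

Lemma hessformDr x w1 w2 w : hessform x w (w1 + w2) = hessform x w w1 + hessform x w w2.
Proof. by rewrite /hessform linearD /= mulmxDr mxE. Qed.

Lemma hessformZr x a w1 w : hessform x w (a *: w1) = a * hessform x w w1.
Proof. by rewrite /hessform linearZ /= -!scalemxAr mxE. Qed.

Lemma conj_real (a : R) : ((a%:C)^*)%C = a%:C.
Proof. by apply/eqP; rewrite eq_complex /= oppr0 !eqxx. Qed.

Lemma conjvM k l (w : 'M[C]_(k, l)) p (A : 'M[R]_(l, p)) :
  map_mx (@conjc R) (w *m map_mx RC A) = map_mx (@conjc R) w *m map_mx RC A.
Proof.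
rewrite map_mxM; congr (_ *m _); apply/matrixP => i j; rewrite !mxE; exact: conj_real.
Qed.

Lemma gradpair_conj x w : gradpair x (conjv w) = (gradpair x w)^*%C.
Proof.
rewrite /gradpair map_trmx; transitivity (map_mx (@conjc R) (w *m map_mx RC (grad x)^T) 0 0).
  by rewrite conjvM.
by rewrite [LHS]mxE.
Qed.

Lemma conjvK w : conjv (conjv w) = w :> 'rV[C]_m.
Proof. by apply/rowP => i; rewrite !mxE; exact: conjcK. Qed.

Lemma conjvD (w w' : 'rV[C]_m) : conjv (w + w') = conjv w + conjv w'.
Proof. by rewrite /conjv map_mxD. Qed.

Lemma conjvZ a (w : 'rV[C]_m) : conjv (a *: w) = a^*%C *: conjv w.
Proof. by rewrite /conjv map_mxZ. Qed.

Lemma hessform_sym U x w w' : open U -> Cr 2 U rho -> U x -> hessform x w w' = hessform x w' w.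
Proof.
move=> oU Hr Ux; rewrite /hessform.
have Hsym : (hess x)^T = hess x.
  by apply/matrixP => k l; rewrite !mxE; exact: (pderivC _ _ oU Hr Ux).
transitivity ((w *m map_mx RC (hess x) *m w'^T)^T 0 0); first by rewrite [RHS]mxE.
by rewrite !trmx_mul trmxK map_trmx Hsym mulmxA.
Qed.

Lemma hessform_conj x w w' : hessform x (conjv w) (conjv w') = (hessform x w w')^*%C.
Proof.
rewrite /hessform; transitivity (map_mx (@conjc R) (w *m map_mx RC (hess x) *m w'^T) 0 0);
  last by rewrite [LHS]mxE.
by rewrite map_mxM conjvM map_trmx.
Qed.

(** The flat derivative of Y along w, taken componentwise; the bracket is its antisymmetrization. *)
Definition derive_field (w : 'rV[C]_m) (Y : E -> 'rV[C]_m) (x : E) : 'rV[C]_m :=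
  \row_k dapply w (fun y => Y y 0 k) x.

Lemma csmooth_gradpair U Y : open U -> smooth U rho -> smooth_field U Y ->
  csmooth U (fun y => gradpair y (Y y)).
Proof.
move=> oU Hr HY; rewrite /gradpair; under eq_fun do rewrite mxE.
apply: csmooth_sum => // k; apply: csmoothM => //.
rewrite (_ : (fun y => _) = (fun y => (pderiv k rho y)%:C)).
  exact/csmooth_real/smooth_pderiv.
by apply/funext => y; rewrite !mxE.
Qed.

(** Leibniz rule for drho(Y). If Y and w are tangent to S the left side vanishes, and the normal
    part of the derivative of Y is minus the Hessian of rho. *)
Lemma dapply_gradpair U w Y x : open U -> smooth U rho -> smooth_field U Y -> U x ->
  dapply w (fun y => gradpair y (Y y)) x = hessform x w (Y x) + gradpair x (derive_field w Y x).
Proof.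
move=> oU Hr HY Ux.
have E1 : (fun y => gradpair y (Y y)) = (fun y => \sum_k Y y 0 k * (pderiv k rho y)%:C).
  by apply/funext => y; rewrite /gradpair mxE; apply: eq_bigr => k _; rewrite !mxE.
have dY k := csmooth_cdiff (HY k) Ux.
have dr k : cdiff (fun y => (pderiv k rho y)%:C) x.
  exact: csmooth_cdiff (csmooth_real (smooth_pderiv k Hr)) Ux.
rewrite E1 dapply_sum; last first.
  move=> k; exact: csmooth_cdiff (csmoothM oU (HY k) (csmooth_real (smooth_pderiv k Hr))) Ux.
rewrite /hessform /gradpair !mxE -big_split; apply: eq_bigr => k _.
rewrite dapplyM// addrC !mxE; congr (_ + _).
rewrite mulrC; congr (_ * _); rewrite /dapply; apply: eq_bigr => l _.
by rewrite cpderiv_real !mxE.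
Qed.

(** A linear condition with constant coefficients that Y satisfies along S passes to its derivatives
    in tangent directions. *)
Lemma derive_field_mulmx S U w Y p (A : 'M[C]_(m, p)) x : ctangent S x w -> open U -> U x ->
  smooth_field U Y -> (forall y, (S `&` U) y -> Y y *m A = 0) -> derive_field w Y x *m A = 0.
Proof.
move=> tw oU Ux HY YA; apply/rowP => j; rewrite [RHS]mxE.
have := @ctangent_dapply _ _ S U x w (fun y => \sum_k Y y 0 k * A k j) tw oU Ux.
have H k : csmooth U (fun y => Y y 0 k * A k j) by apply: csmoothM => //; exact: csmooth_cst.
rewrite dapply_sum; last by move=> k; exact: csmooth_cdiff (H k) Ux.
move=> H0; rewrite mxE; apply: etrans (H0 _ _).
- apply: eq_bigr => k _; rewrite dapplyM ?dapply_cst ?mulr0 ?addr0 ?mxE//.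
  exact: csmooth_cdiff (HY k) Ux.
- exact: csmooth_sum.
- by move=> y /YA /rowP /(_ j); rewrite !mxE.
Qed.
End GradientPairing.

Section LeviFormula.
Context {R : realType} {n : nat}.
Local Notation E := 'rV[R]_(n + n).
Local Notation C := R[i].
Local Notation RC := (real_complex R).
Local Notation J := (Jmx n C).
Local Notation ii := (0 +i* 1 : C).

Variables (S U : set E) (rho : E -> R).
Hypotheses (oU : open U) (rho_smooth : smooth U rho).
Hypothesis tanP : forall x v, (S `&` U) x -> tangent S x v <-> 'D_v rho x = 0.
Hypothesis nondeg : forall x, (S `&` U) x -> grad rho x != 0.

Lemma sqr_ii : ii * ii = -1.
Proof. by apply/eqP; rewrite eq_complex /= !mul0r mul1r mulr0 addr0 sub0r oppr0 !eqxx. Qed.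

Lemma conj_ii : (ii^*)%C = - ii.
Proof. by apply/eqP; rewrite eq_complex /= oppr0 !eqxx. Qed.

Lemma conj_Nii : ((- ii)^*)%C = ii.
Proof. by apply/eqP; rewrite eq_complex /= oppr0 opprK !eqxx. Qed.

Lemma conjvJ (w : 'rV[C]_(n + n)) : conjv (w *m J) = conjv w *m J.
Proof. by rewrite -(map_Jmx n RC) /conjv conjvM. Qed.

Lemma gradpair_ReIm x (w : 'rV[C]_(n + n)) : gradpair rho x w =
  ((map_mx (@complex.Re R) w *m (grad rho x)^T) 0 0) +i*
  ((map_mx (@complex.Im R) w *m (grad rho x)^T) 0 0).
Proof.
rewrite /gradpair !mxE -sum_complex; apply: eq_bigr => k _; rewrite !mxE.
by case: (w 0 k) => a b; apply/eqP; rewrite eq_complex /= !mulr0 subr0 add0r !eqxx.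
Qed.

Lemma derive_grad x v : U x -> 'D_v rho x = (v *m (grad rho x)^T) 0 0.
Proof.
move=> Ux; rewrite derive_pderiv; last exact: smooth_differentiable Ux.
by rewrite mxE; apply: eq_bigr => k _; rewrite !mxE.
Qed.

Lemma ctangentP x w : (S `&` U) x -> ctangent S x w <-> gradpair rho x w = 0.
Proof.
move=> Sx; have Ux : U x by case: Sx.
rewrite /ctangent /= !tanP// !derive_grad// gradpair_ReIm; split=> [[-> ->]//|/eqP].
by rewrite eq_complex /= => /andP[/eqP -> /eqP ->].
Qed.

Lemma H10P x w : (S `&` U) x -> H10 S x w <-> gradpair rho x w = 0 /\ w *m J = ii *: w.
Proof. by move=> Sx; rewrite /H10 /= ctangentP// Jstr_Jmx. Qed.

Let g2 x : R := (grad rho x *m (grad rho x)^T) 0 0.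

Lemma g2_gt0 x : (S `&` U) x -> 0 < g2 x.
Proof.
move=> /nondeg g0; rewrite /g2 mxE; under eq_bigr do rewrite !mxE -expr2.
rewrite lt_def sumr_ge0 ?andbT; last by move=> k _; exact: sqr_ge0.
apply: contra_neq g0 => /eqP; rewrite psumr_eq0; last by move=> k _; exact: sqr_ge0.
move=> /allP H; apply/rowP => k; have := H k; rewrite mem_index_enum !mxE /= => /(_ isT).
by rewrite sqrf_eq0 => /eqP.
Qed.

Let T x : 'rV[C]_(n + n) := map_mx RC (grad rho x) *m J.

Lemma gradpair_T x : gradpair rho x (T x) = 0.
Proof.
have : (T x *m (map_mx RC (grad rho x))^T)^T 0 0 = - (T x *m (map_mx RC (grad rho x))^T) 0 0.
  by rewrite /T !trmx_mul trmxK tr_Jmx mulNmx mulmxN mulmxA [LHS]mxE.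
rewrite [X in X = _ -> _]mxE /gradpair; move: (_ 0 0) => a /eqP;
  rewrite -addr_eq0 -mulr2n mulrn_eq0 /=.
by move/eqP.
Qed.

Lemma gradpair_TJ x : gradpair rho x (T x *m J) = - (g2 x)%:C.
Proof.
rewrite /T -mulmxA Jmx_sqr mulmxN mulmx1 /gradpair mulNmx mxE; congr (- _).
by rewrite map_trmx -map_mxM mxE.
Qed.

Lemma pairingD (t w w' : 'rV[C]_(n + n)) : pairing t (w + w') = pairing t w + pairing t w'.
Proof. by rewrite /pairing -big_split; apply: eq_bigr => k _; rewrite mxE mulrDr. Qed.

Lemma pairingZ a (t w : 'rV[C]_(n + n)) : pairing t (a *: w) = a * pairing t w.
Proof. by rewrite /pairing mulr_sumr; apply: eq_bigr => k _; rewrite mxE mulrCA. Qed.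

(** w is the sum of its (1,0) part (w - i Jw) / 2 and its (0,1) part (w + i Jw) / 2. *)
Lemma CH_intro x w : (S `&` U) x -> gradpair rho x w = 0 -> gradpair rho x (w *m J) = 0 -> CH S x w.
Proof.
move=> Sx gw gwJ.
exists (2^-1 *: (w + (- ii) *: (w *m J))), (conjv (2^-1 *: (w + ii *: (w *m J)))); split.
- apply/H10P => //; rewrite gradpairZ gradpairD gradpairZ gw gwJ !mulr0 addr0 mulr0; split=> //.
  rewrite -scalemxAl mulmxDl -scalemxAl -mulmxA Jmx_sqr mulmxN mulmx1 scalerA [ii * _]mulrC
    -scalerA.
  by congr (_ *: _); rewrite scalerDr scalerA mulrN sqr_ii opprK scale1r scalerN scaleNr opprK
    addrC.
- apply/H10P => //; rewrite gradpair_conj gradpairZ gradpairD gradpairZ gw gwJ !mulr0 addr0 mulr0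
  conjc0; split=> //.
  rewrite -conjvJ -[ii in RHS]conjcK conj_ii -conjvZ; congr conjv.
  rewrite -scalemxAl mulmxDl -scalemxAl -mulmxA Jmx_sqr mulmxN mulmx1 scalerA [- ii * _]mulrC
    -scalerA.
  by congr (_ *: _); rewrite conj_Nii scalerDr scalerA mulNr sqr_ii opprK scale1r scalerN scaleNr
    addrC.
rewrite conjvK -scalerDr addrACA -scalerDl addNr scale0r addr0.
rewrite (_ : w + w = 2 *: w) ?scalerA ?mulVf ?scale1r ?pnatr_eq0//.
by rewrite scaler_nat.
Qed.

(* T = J grad rho is tangent and transverse to CH, so a contact form is
   proportional to drho o J. *)
Lemma contact_eq (U0 : set E) t x v : contact_form S U0 t -> (S `&` U0) x -> (S `&` U) x ->
  gradpair rho x v = 0 -> pairing (t x) v * (g2 x)%:C = - (gradpair rho x (v *m J) * pairing (t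
    x) (T x)).
Proof.
move=> [_ ct] Sx0 Sx gv; have [_ tCH _] := ct x Sx0.
(* The coefficient of T makes drho vanish on J of the combination too, since drho(J T) = -|grad
   rho|^2. *)
have : CH S x ((g2 x)%:C *: v + gradpair rho x (v *m J) *: T x).
  apply: CH_intro => //.
    by rewrite gradpairD !gradpairZ gv gradpair_T !mulr0 addr0.
  by rewrite mulmxDl -!scalemxAl gradpairD !gradpairZ gradpair_TJ mulrN [X in _ - X]mulrC subrr.
by move=> /tCH; rewrite pairingD !pairingZ => /eqP; rewrite addr_eq0 mulrC => /eqP.
Qed.

Lemma bracketE (X Y : E -> 'rV[C]_(n + n)) x :
  bracket X Y x = derive_field (X x) Y x - derive_field (Y x) X x.
Proof. by apply/rowP => j; rewrite !mxE. Qed.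

Lemma smooth_field_conj (V : set E) L : open V -> smooth_field V L ->
  smooth_field V (fun y => conjv (L y)).
Proof.
move=> oV HL k; rewrite (_ : (fun y => _) = fun y => (L y 0 k)^*%C).
  exact: csmooth_conj.
by apply/funext => y; rewrite mxE.
Qed.

(** J has constant coefficients, so flat derivatives along S preserve the type (1,0) or (0,1). *)
Lemma derive_field_J (V : set E) w Y a x : (S `&` V) x -> ctangent S x w -> open V ->
  smooth_field V Y -> (forall y, (S `&` V) y -> Y y *m J = a *: Y y) ->
  derive_field w Y x *m J = a *: derive_field w Y x.
Proof.
move=> [Sx Vx] tw oV HY YJ.
have H := @derive_field_mulmx _ _ S V w Y _ (J - a%:M) x tw oV Vx HY.
apply/eqP; rewrite -subr_eq0 -mul_mx_scalar -mulmxBr H// => y Sy.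
by rewrite mulmxBr mul_mx_scalar YJ// subrr.
Qed.

(** Write Y for the conjugate of L' and h = Hess(L, Y). By symmetry of the Hessian, drho takes the
    value -h on both D_L Y and D_Y L, so the bracket is tangent; they have types (0,1) and (1,0), so
    drho(J [L, Y]) = 2 i h, and [contact_eq] applies. *)
Lemma levi_formula (U0 V : set E) t L L' x : contact_form S U0 t -> U0 x -> open V ->
  H10_section S V L -> H10_section S V L' -> (S `&` U) x -> V x ->
  levi t L L' x * (g2 x)%:C =
  - (2 * ii * hessform rho x (L x) (conjv (L' x)) * pairing (t x) (T x)).
Proof.
move=> ct U0x oV [HL tL] [HL' tL'] Sx Vx; have [Sx' Ux] := Sx.
pose W := U `&` V.
have oW : open W by exact: openI.
have WU : W `<=` U by move=> y [].
have WV : W `<=` V by move=> y [].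
have Wx : W x by [].
have {}HL : smooth_field W L by move=> k; exact: csmooth_sub WV (HL k).
have {}HL' : smooth_field W L' by move=> k; exact: csmooth_sub WV (HL' k).
have HY := smooth_field_conj oW HL'; set Y := fun y => conjv (L' y) in HY *.
have rW := smooth_sub WU rho_smooth.
have tLW y : (S `&` W) y -> gradpair rho y (L y) = 0 /\ L y *m J = ii *: L y.
  by move=> [Sy [Uy Vy]]; apply/H10P => //; exact: tL.
have tYW y : (S `&` W) y -> gradpair rho y (Y y) = 0 /\ Y y *m J = - ii *: Y y.
  move=> [Sy [Uy Vy]].
  have /H10P[//|g1 J1] := tL' y (conj Sy Vy).
  by rewrite /Y gradpair_conj g1 conjc0 -conjvJ J1 conjvZ conj_ii.
have SWx : (S `&` W) x by [].
have [gL JL] := tLW x SWx; have [gY JY] := tYW x SWx.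
have ctL : ctangent S x (L x) by apply/ctangentP.
have ctY : ctangent S x (Y x) by apply/ctangentP.
have e1 : gradpair rho x (derive_field (L x) Y x) = - hessform rho x (L x) (Y x).
  apply/eqP; rewrite -addr_eq0 addrC -(dapply_gradpair _ oW rW HY Wx).
  apply/eqP; apply: (ctangent_dapply ctL oW Wx); first exact: csmooth_gradpair.
  by move=> y /tYW[].
have e2 : gradpair rho x (derive_field (Y x) L x) = - hessform rho x (L x) (Y x).
  rewrite (hessform_sym _ _ oU (rho_smooth 2) Ux).
  apply/eqP; rewrite -addr_eq0 addrC -(dapply_gradpair _ oW rW HL Wx).
  apply/eqP; apply: (ctangent_dapply ctY oW Wx); first exact: csmooth_gradpair.
  by move=> y /tLW[].
have j1 : derive_field (L x) Y x *m J = - ii *: derive_field (L x) Y x.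
  by apply: (derive_field_J SWx ctL oW HY) => y /tYW[].
have j2 : derive_field (Y x) L x *m J = ii *: derive_field (Y x) L x.
  by apply: (derive_field_J SWx ctY oW HL) => y /tLW[].
have SU0 : (S `&` U0) x by [].
rewrite /levi -/Y bracketE.
have gradpairN w : gradpair rho x (- w) = - gradpair rho x w by rewrite -scaleN1r gradpairZ mulN1r.
rewrite (contact_eq ct SU0 Sx); last by rewrite gradpairD gradpairN e1 e2 subrr.
rewrite mulmxBl j1 j2 gradpairD gradpairN !gradpairZ e1 e2; congr (- (_ * _)).
by rewrite -/(Y x); move: (hessform _ _ _ _) => h; ring.
Qed.
Lemma smooth_fieldD (V : set E) (X Y : E -> 'rV[C]_(n + n)) : open V ->
  smooth_field V X -> smooth_field V Y -> smooth_field V (fun y => X y + Y y).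
Proof.
move=> oV HX HY k; rewrite (_ : (fun y => _) = fun y => X y 0 k + Y y 0 k).
  exact: csmoothD.
by apply/funext => y; rewrite mxE.
Qed.

Lemma smooth_fieldZ (V : set E) F (Y : E -> 'rV[C]_(n + n)) : open V ->
  csmooth V F -> smooth_field V Y -> smooth_field V (fun y => F y *: Y y).
Proof.
move=> oV HF HY k; rewrite (_ : (fun y => _) = fun y => F y * Y y 0 k).
  exact: csmoothM.
by apply/funext => y; rewrite mxE.
Qed.

Lemma smooth_field_mulmx (V : set E) (Y : E -> 'rV[C]_(n + n)) A : open V ->
  smooth_field V Y -> smooth_field V (fun y => Y y *m A).
Proof.
move=> oV HY k; rewrite (_ : (fun y => _) = fun y => \sum_l Y y 0 l * A l k).
  by apply: csmooth_sum => // l; apply: csmoothM => //; exact: csmooth_cst.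
by apply/funext => y; rewrite mxE.
Qed.

Let cg x := map_mx RC (grad rho x).

Lemma smooth_field_cg : smooth_field U cg.
Proof.
move=> k; rewrite (_ : (fun y => _) = fun y => (pderiv k rho y)%:C).
  exact/csmooth_real/smooth_pderiv.
by apply/funext => y; rewrite !mxE.
Qed.

Lemma gradpair_cg x : gradpair rho x (cg x) = (g2 x)%:C.
Proof. by rewrite /gradpair /cg map_trmx -map_mxM mxE. Qed.

(* |grad rho|^2 w corrected along the (1,0) gradient N of rho, for which
   drho (N) = |grad rho|^2. *)
Lemma H10_extension x w : (S `&` U) x -> H10 S x w ->
  exists L, H10_section S U L /\ L x = (g2 x)%:C *: w.
Proof.
move=> Sx /(H10P _ Sx)[gw Jw].
pose N y := cg y + (- ii) *: (cg y *m J).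
have HN : smooth_field U N.
  apply: smooth_fieldD => //; first exact: smooth_field_cg.
  apply: smooth_fieldZ => //; first exact: csmooth_cst.
  exact/smooth_field_mulmx/smooth_field_cg.
have Hw : smooth_field U (fun=> w) by move=> k; exact: csmooth_cst.
exists (fun y => gradpair rho y (cg y) *: w + (- gradpair rho y w) *: N y); split; last first.
  by rewrite gw oppr0 scale0r addr0 gradpair_cg.
split=> [|y Sy].
  apply: smooth_fieldD => //; apply: smooth_fieldZ => //.
    by apply: csmooth_gradpair => //; exact: smooth_field_cg.
  rewrite (_ : (fun y => _) = fun y => -1 * gradpair rho y w).
    by apply: csmoothM => //; [exact: csmooth_cst|exact: csmooth_gradpair].
  by apply/funext => y; rewrite mulN1r.
apply/H10P => //; split.
  rewrite gradpairD !gradpairZ /N gradpairD !gradpairZ -/(T y) gradpair_T mulr0 addr0 gradpair_cg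
    mulNr mulrC.
  by rewrite subrr.
rewrite mulmxDl -!scalemxAl Jw scalerDr !scalerA [ii * gradpair _ _ _]mulrC; congr (_ + _).
rewrite [ii * - _]mulrC -[in RHS]scalerA; congr (_ *: _).
rewrite /N mulmxDl -scalemxAl -mulmxA Jmx_sqr mulmxN mulmx1 scalerDr scalerA mulrN sqr_ii opprK
  scale1r.
by rewrite scalerN scaleNr opprK addrC.
Qed.

(** If the form vanished at T it would vanish on all of CTS by [contact_eq]. Its value there is
    purely imaginary because T is a real tangent vector. *)
Lemma contact_T (U0 : set E) t x : contact_form S U0 t -> (S `&` U0) x -> (S `&` U) x ->
  exists2 tau : R, tau != 0 & pairing (t x) (T x) = ii * tau%:C.
Proof.
move=> ct Sx0 Sx; have [_ /(_ x Sx0)[[w ctw tw] tCH treal]] := ct.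
have Tx0 : pairing (t x) (T x) != 0.
  apply: contraNneq tw => T0; have /ctangentP gw := ctw.
  have := contact_eq ct Sx0 Sx (gw Sx); rewrite T0 mulr0 oppr0 => /eqP.
  rewrite mulf_eq0 => /orP[//|/eqP/(congr1 (@complex.Re R)) /= g20].
  by have := g2_gt0 Sx; rewrite g20 ltxx.
pose v := grad rho x *m Jmx n R.
have TE : T x = map_mx RC v by rewrite /T /v map_mxM map_Jmx.
have ctT : ctangent S x (T x) by apply/ctangentP => //; exact: gradpair_T.
have tv : tangent S x v.
  have [+ _] := ctT; rewrite TE; congr (tangent S x _).
  by apply/rowP => k; rewrite !mxE.
have := treal v tv; rewrite -TE.
move: Tx0; case: (pairing _ _) => a b ab /= a0; move: ab; rewrite a0 => ab.
exists b; first by apply: contraNneq ab => ->.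
by apply/eqP; rewrite eq_complex /= !mul0r !mul1r subr0 add0r !eqxx.
Qed.

(** With t(T) = i s, [levi_formula] says that |grad rho|^2 times the Levi form is 2 s times the
    Hessian: s carries the orientation of the contact form. Extending |grad rho|^2 w in place of w
    costs only a positive factor. *)
Lemma pseudoconvex_semidefinite x : pseudoconvex S -> (S `&` U) x ->
  exists2 s : R, s != 0 & forall w, H10 S x w -> 0 <= s%:C * hessform rho x w (conjv w).
Proof.
move=> psc Sx; have [Sx' Ux] := Sx.
have [U0 [t [oU0 U0x ct pos]]] := psc x Sx'.
have [s s0 Ts] := contact_T ct (conj Sx' U0x) Sx.
exists s => // w Hw.
have [L [HL Lx]] := H10_extension Sx Hw.
have oV : open (U `&` U0) by exact: openI.
have HL' : H10_section S (U `&` U0) L.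
  case: HL => H1 H2; split=> [k|y [Sy [Uy _]]]; last exact: H2.
  by apply: csmooth_sub (H1 k) => y [].
have U0V : U `&` U0 `<=` U0 by move=> y [].
have := pos _ L oV U0V HL' x (conj Sx' (conj Ux U0x)).
have := levi_formula ct U0x oV HL' HL' Sx (conj Ux U0x).
have g0 := g2_gt0 Sx; have gc0 : 0 < (g2 x)%:C :> C by rewrite ltcR.
rewrite Lx conjvZ conj_real hessformZl hessformZr Ts => E1 P1.
have : 0 <= levi t L L x * (g2 x)%:C by rewrite mulr_ge0// ltW.
rewrite E1; move: (hessform _ _ _ _) (g2 x)%:C gc0 => h g gc0.
have -> : - (2 * ii * (g * (g * h)) * (ii * s%:C)) = - (ii * ii) * (2 * g * g * (s%:C * h)) by ring.
by rewrite sqr_ii opprK mul1r pmulr_rge0// !mulr_gt0.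
Qed.

(* Cauchy-Schwarz for a semidefinite hermitian form. *)
Lemma pseudoconvex_levi_kernel x w (s : R) : (S `&` U) x -> s != 0 ->
  (forall w, H10 S x w -> 0 <= s%:C * hessform rho x w (conjv w)) ->
  H10 S x w -> hessform rho x w (conjv w) = 0 -> levi_kernel S x w.
Proof.
move=> Sx s0 pos Hw h0; have [Sx' Ux] := Sx.
split=> // V t L L' oV Vx ct HL HL' Lx.
have gc0 : (g2 x)%:C != 0 :> C by rewrite lt0r_neq0// ltcR g2_gt0.
apply: (mulIf gc0); rewrite mul0r (levi_formula ct Vx oV HL HL' Sx Vx) Lx.
suff -> : hessform rho x w (conjv (L' x)) = 0 by rewrite mulr0 mul0r oppr0.
have Hw' : H10 S x (L' x) by have [_] := HL'; apply.
move: (L' x) Hw' => w' Hw'.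
set a := hessform rho x w (conjv w').
have aE : hessform rho x w' (conjv w) = (a^*)%C.
  by rewrite (hessform_sym _ _ oU (rho_smooth 2) Ux) -[in LHS](conjvK w') hessform_conj.
set b := s%:C * hessform rho x w' (conjv w').
have b0 : 0 <= b by exact: pos.
have Hl (l : C) : 0 <= s%:C * (l^*%C * a + l * a^*%C) + l * l^*%C * b.
  have : H10 S x (w + l *: w').
    have [g1 J1] := (H10P w Sx).1 Hw; have [g2' J2] := (H10P w' Sx).1 Hw'.
    apply/H10P => //; rewrite gradpairD gradpairZ g1 g2' mulr0 addr0; split => //.
    by rewrite mulmxDl -scalemxAl J1 J2 scalerDr !scalerA [l * _]mulrC.
  move=> /pos; rewrite conjvD conjvZ hessformDl !hessformDr !hessformZl !hessformZr h0 aE -/a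
    add0r /b.
  by congr (0 <= _); move: (hessform _ _ _ _) => h; ring.
have [be be0 bE] : exists2 be : R, 0 <= be & b = be%:C.
  move: b0; case: (b) => p q; rewrite lecE /= => /andP[/eqP -> p0]; exists p => //.
(* With l = e s a the inequality [Hl] reads 0 <= s^2 |a|^2 (2 e + e^2 be). This e makes the last
   factor -(be + 2) / (be + 1)^2, so a = 0, also when be = 0. *)
pose e := - (be + 1)^-1.
have lc : (((e * s)%:C * a)^*)%C = (e * s)%:C * a^*%C.
  by case: (a) => p q; apply/eqP; rewrite eq_complex /=; apply/andP; split; apply/eqP; ring.
have := Hl ((e * s)%:C * a); rewrite lc bE; case: (a) => p q.
have -> : (((p +i* q)^*)%C) = p +i* (- q) by [].
have b1 : 0 < be + 1 by rewrite ltr_wpDl.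
have E1 : s%:C * ((e * s)%:C * (p +i* - q) * (p +i* q) + (e * s)%:C * (p +i* q) * (p +i* - q)) +
    (e * s)%:C * (p +i* q) * ((e * s)%:C * (p +i* - q)) * be%:C =
    (s ^+ 2 * (p ^+ 2 + q ^+ 2) * (2 * e + e ^+ 2 * be))%:C.
  by apply/eqP; rewrite eq_complex /=; apply/andP; split; apply/eqP; ring.
rewrite E1 lecR => H.
have eneg : 2 * e + e ^+ 2 * be < 0.
  have bn : be + 1 != 0 by rewrite gt_eqF.
  have -> : 2 * e + e ^+ 2 * be = - ((be + 2) * (be + 1) ^- 2).
    by rewrite /e; field.
  by rewrite oppr_lt0 mulr_gt0 ?invr_gt0 ?exprn_gt0//; lra.
have s2 : 0 < s ^+ 2 by rewrite lt_def sqrf_eq0 s0 sqr_ge0.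
have pq0 : p ^+ 2 + q ^+ 2 = 0.
  apply/eqP; rewrite eq_le addr_ge0 ?sqr_ge0// andbT leNgt; apply/negP => pq.
  move: H; rewrite leNgt => /negP; apply.
  by rewrite (pmulr_rlt0 _ (mulr_gt0 s2 pq)).
move/eqP: pq0; rewrite paddr_eq0 ?sqr_ge0// !sqrf_eq0 => /andP[/eqP -> /eqP ->].
by [].
Qed.
End LeviFormula.

(** * The local problem *)

Section DefiningFunction.
Context {R : realType} {m : nat}.
Local Notation E := 'rV[R]_m.
Variables (GG : set 'M[R]_m) (B : R).
Hypothesis GG_bound : forall G k l, GG G -> `|G k l| <= B.

(** Continuity of the finitely many second derivatives gives a neighbourhood common to all G, since
    T_G is linear in G and the entries of G are bounded by B. *)
Lemma trG_near_gt (V : set E) g p (e : R) : open V -> V p -> Cr 2 V g ->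
  (forall G, GG G -> e < trG G g p) -> 0 < e ->
  \forall y \near p, forall G, GG G -> e / 2 < trG G g y.
Proof.
move=> oV Vp Hg tg e0.
pose d := e / (2 * (`|B| + 1) * (m%:R * m%:R + 1)).
have mm : 0 < m%:R * m%:R + 1 :> R by rewrite ltr_wpDl// mulr_ge0.
have B1 : 0 < `|B| + 1 by rewrite ltr_wpDl.
have d0 : 0 < d by rewrite divr_gt0// !mulr_gt0.
have N k l : \forall y \near p, `|pderiv l (pderiv k g) p - pderiv l (pderiv k g) y| <= d.
  have /cvgrPdist_le := Cr_continuous (Cr_pderiv l (Cr_pderiv k Hg)) Vp.
  by apply.
apply: filterS (near_forall (fun k => near_forall (fun l => N k l))) => y Hy G GGG.
have : `|trG G g p - trG G g y| <= \sum_(k < m) \sum_(l < m) (`|B| * d).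
  rewrite /trG -sumrB; apply: le_trans (ler_norm_sum _ _ _) _; apply: ler_sum => k _.
  rewrite -sumrB; apply: le_trans (ler_norm_sum _ _ _) _; apply: ler_sum => l _.
  rewrite -mulrBr normrM; apply: ler_pM (Hy k l); [exact: normr_ge0|exact: normr_ge0|].
  exact: le_trans (GG_bound _ _ GGG) (ler_norm _).
rewrite sumr_const card_ord sumr_const card_ord -mulrnA -[leRHS]mulr_natl natrM => H.
have H2 : m%:R * m%:R * (`|B| * d) <= e / 2.
  have <- : (m%:R * m%:R + 1) * ((`|B| + 1) * d) = e / 2.
    by rewrite /d; field; rewrite !gt_eqF.
  apply: ler_pM; [exact: mulr_ge0|by rewrite mulr_ge0// ltW|by rewrite lerDl|].
  by rewrite ler_pM2r// lerDl.
have := tg G GGG; have := le_trans (ler_norm _) (le_trans H H2).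
move: (trG _ _ _) (trG _ _ _) => a b; lra.
Qed.

(** The radius depends on g alone and is fixed before c; c only affects how far the neighbourhood is
    shrunk around the zero set of g. *)
Lemma property_G_defining (M V : set E) g p (e : R) : open V -> V p -> Cr 2 V g ->
  (forall G, GG G -> e < trG G g p) -> 0 < e -> (forall y, (M `&` V) y -> g y = 0) ->
  exists2 r, 0 < r & forall K, K `<=` M `&` ball p r -> property_G GG K.
Proof.
move=> oV Vp Hg tg e0 g0.
have H : \forall y \near p, V y /\ forall G, GG G -> e / 2 < trG G g y.
  apply: filterI; first exact: open_nbhs_nbhs.
  exact: trG_near_gt oV Vp Hg tg e0.
have /nbhs_ballP[r /= r0 Hr] := H.
exists r => // K KM c.
(* T_G g > e / 2 on the ball, and A e / 2 = |c| + e / 2 exceeds c. *)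
pose A := (2 * `|c|) / e + 1.
have A0 : 0 < A by rewrite ltr_wpDl// divr_ge0 ?mulr_ge0// ltW.
have oB : open (ball p r) by exact: ball_open.
have HgB : Cr 2 (ball p r) g by apply: Cr_sub Hg => y /Hr[].
(* Where |A g| < 1/2 the function 1/2 + A g stays in [0, 1]. *)
pose I := [set t : R | `|A * t| < 1 / 2].
have oI : open I.
  apply: (open_sublevel (f := fun t => `|A * t|)) => t.
  by apply: cvg_norm; apply: cvgM; [exact: cvg_cst|exact: cvg_id].
have oU : open (ball p r `&` g @^-1` I).
  rewrite openE => y [yB gy]; apply: filterI; first exact: open_nbhs_nbhs.
  have cg : {for y, continuous g} by exact: (Cr_continuous HgB yB).
  by apply: cg; exact: open_nbhs_nbhs.
have UB : ball p r `&` g @^-1` I `<=` ball p r by move=> y [].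
have HgU := Cr_sub UB HgB.
exists (ball p r `&` g @^-1` I), (fun y => 1 / 2 + A * g y); split.
- exact: oU.
- move=> y /KM[My yB]; split => //=.
  by rewrite g0 /I /= ?mulr0 ?normr0//; split => //; have [] := Hr _ yB.
- by apply: CrD; [exact: oU|exact: Cr_cst|exact: CrZ].
- by move=> y [_]; rewrite /I /= ltr_norml; move: (A * g y) => t; lra.
move=> y G Uy GGG.
rewrite (trGD _ oU (Cr_cst _ _ _) (CrZ A oU HgU) Uy) trG_cst add0r (trGZ _ _ oU HgU Uy).
have [_ /(_ G GGG)] := Hr _ (UB _ Uy); move: (trG _ _ _) => t te.
apply: le_lt_trans (ler_norm c) _.
apply: (@lt_trans _ _ (A * (e / 2))); last by rewrite ltr_pM2l.
rewrite /A mulrDl mul1r.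
have -> : 2 * `|c| / e * (e / 2) = `|c| by field; rewrite gt_eqF.
by rewrite ltrDl divr_gt0.
Qed.
End DefiningFunction.

(** * Unitary frames of complex q-planes and their compactness *)

Section Frames.
Context {R : realType} {n q : nat}.
Local Notation J := (Jmx n R).
Local Notation RC := (real_complex R).

(* The rows of V are orthonormal for the standard hermitian form of C^n. *)
Definition frame (V : 'M[R]_(q, n + n)) : Prop := V *m V^T = 1%:M /\ V *m J *m V^T = 0.

(** For a frame the rows v together with the Jv are orthonormal, and this is the orthogonal
    projector onto their real span. *)
Definition Gmx (V : 'M[R]_(q, n + n)) : 'M[R]_(n + n) := V^T *m V + (V *m J)^T *m (V *m J).

Definition frame_forms : set 'M[R]_(n + n) := [set G | exists2 V, frame V & G = Gmx V].

Lemma quad_mx m (G : 'M[R]_m) (a b : 'I_m -> R) :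
  quad G a b = ((\row_k a k) *m G *m (\row_k b k)^T) 0 0.
Proof.
rewrite /quad mxE exchange_big; apply: eq_bigr => l _; rewrite mxE mulr_suml.
by apply: eq_bigr => k _; rewrite !mxE mulrA mulrC [a k * _]mulrC mulrC.
Qed.

Lemma sqsum_mx k (w : 'rV[R]_k) : (w *m w^T) 0 0 = \sum_i w 0 i ^+ 2.
Proof. by rewrite mxE; apply: eq_bigr => i _; rewrite mxE expr2. Qed.

Lemma quad_Gmx V (a : 'I_(n + n) -> R) : quad (Gmx V) a a =
  \sum_i (((\row_k a k) *m V^T) 0 i) ^+ 2 + \sum_i (((\row_k a k) *m (V *m J)^T) 0 i) ^+ 2.
Proof.
rewrite quad_mx -!sqsum_mx /Gmx mulmxDr mulmxDl mxE; congr (_ + _).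
  by rewrite trmx_mul trmxK !mulmxA.
by move: (V *m J) => W; rewrite trmx_mul trmxK !mulmxA.
Qed.

Lemma psd_Gmx V : psd (Gmx V).
Proof. by move=> a; rewrite quad_Gmx addr_ge0// sumr_ge0// => i _; exact: sqr_ge0. Qed.

Lemma frame_entry V i k : frame V -> `|V i k| <= 1.
Proof.
move=> [/matrixP /(_ i i) + _]; rewrite !mxE eqxx => H.
rewrite -(@ler_pXn2r _ 2) ?nnegrE// real_normK ?num_real// expr1n -[leRHS]H.
rewrite (bigD1 k)//= mxE -expr2 lerDl sumr_ge0// => j _.
by rewrite mxE -expr2 sqr_ge0.
Qed.

Lemma frame_J V : frame V -> frame (V *m J).
Proof.
move=> [H1 H2]; split; rewrite trmx_mul tr_Jmx mulmxA.
  by rewrite mulmxN mulNmx -(mulmxA V) Jmx_sqr mulmxN mulmx1 mulNmx opprK H1.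
rewrite mulmxN mulNmx -(mulmxA (V *m J)) Jmx_sqr mulmxN mulmx1 mulNmx opprK.
by rewrite H2.
Qed.

Lemma Gmx_bound G k l : frame_forms G -> `|G k l| <= q%:R + q%:R.
Proof.
move=> [V fV ->]; rewrite !mxE; apply: le_trans (ler_normD _ _) _.
have H (W : 'M[R]_(q, n + n)) : frame W -> `|\sum_j W^T k j * W j l| <= q%:R.
  move=> fW; apply: le_trans (ler_norm_sum _ _ _) _.
  apply: (@le_trans _ _ (\sum_(j < q) 1)); last by rewrite sumr_const card_ord.
  apply: ler_sum => j _; rewrite mxE normrM -[leRHS]mulr1 ler_pM//; exact: frame_entry.
by apply: lerD; apply: H => //; exact: frame_J.
Qed.

Lemma trG_Gmx V (f : 'rV[R]_(n + n) -> R) x : trG (Gmx V) f x =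
  \sum_i ((V *m hess f x *m V^T) i i + (V *m J *m hess f x *m (V *m J)^T) i i).
Proof.
have -> : trG (Gmx V) f x = \tr (Gmx V *m hess f x).
  by rewrite /mxtrace; apply: eq_bigr => k _; rewrite mxE; apply: eq_bigr => l _;
    rewrite [hess _ _ _ _]mxE.
rewrite /Gmx mulmxDl mxtraceD big_split; congr (_ + _).
  by rewrite -mulmxA mxtrace_mulC.
by rewrite -mulmxA mxtrace_mulC.
Qed.
End Frames.

Section FrameCompactness.
Context {R : realType}.

(** At each point some N works, because either Q > 0 or N P outweighs Q; by openness and compactness
    finitely many N suffice. The lower bound 1 / (N + 1) lets one integer serve as both penalty and
    margin. *)
Lemma compact_penalty {T : ptopologicalType} (K : set T) (P Q : T -> R) : compact K ->
  continuous P -> continuous Q -> (forall u, K u -> 0 <= P u) ->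
  (forall u, K u -> P u = 0 -> 0 < Q u) ->
  exists N : nat, forall u, K u -> N.+1%:R^-1 < Q u + N%:R * P u.
Proof.
move=> cK cP cQ P0 PQ.
have /choice[N HN] : forall u, exists N : nat, K u -> N.+1%:R^-1 < Q u + N%:R * P u.
  move=> u; have [Ku|nK] := pselect (K u); last by exists 0%N.
  have [Pu|Pu] := eqVneq (P u) 0.
    have Qu := PQ u Ku Pu; exists (Num.bound (Q u)^-1) => _.
    rewrite Pu mulr0 addr0 invf_plt ?posrE//.
    apply: lt_trans (archi_boundP _) _; first by rewrite invr_ge0 ltW.
    by rewrite ltr_nat.
  have Pp : 0 < P u by rewrite lt_def Pu P0.
  exists (Num.bound ((1 + `|Q u|) / P u)) => _; set N := Num.bound _.
  have : (1 + `|Q u|) / P u < N%:R by apply: archi_boundP; rewrite divr_ge0 ?addr_ge0// ltW.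
  rewrite ltr_pdivrMr// => H1.
  apply: (@le_lt_trans _ _ 1); first by rewrite invf_le1// ler1n.
  have := ler_norm (- Q u); rewrite normrN; move: H1; move: (N%:R * P u) `|Q u| => a b; lra.
have [|s [sK Ks]] := compact_seq_cover
    (O := fun u => [set v | (N u).+1%:R^-1 < Q v + (N u)%:R * P v]) cK.
  move=> u Ku; split; last exact: HN.
  apply: (open_superlevel (f := fun v => Q v + (N u)%:R * P v)) => v.
  by apply: cvgD; [exact: cQ|apply: cvgM; [exact: cvg_cst|exact: cP]].
(* The sum dominates each N u, and a larger N lowers 1 / (N + 1) and raises N P. *)
exists (\sum_(u <- s) N u)%N => v Kv.
have [u us /= Hu] := Ks v Kv.
have leN : (N u <= \sum_(u <- s) N u)%N by rewrite (big_rem u us) /= leq_addr.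
apply: le_lt_trans _ (lt_le_trans Hu _).
  by rewrite lef_pV2 ?posrE// ler_nat.
by rewrite lerD2l ler_wpM2r ?P0// ler_nat.
Qed.

Variables (n q : nat).
Local Notation J := (Jmx n R).
Local Notation mxof u := (vec_mx u : 'M[R]_(q, n + n)).
Local Notation P := 'rV[R]_(q * (n + n)).

(** Matrices are parametrized by row vectors, where closed bounded sets are compact. Continuity is
    stated as [Cr 0], so that the calculus above yields it for polynomial expressions. *)
Let poly_entry (A : P -> 'M[R]_(q, n + n)) := forall i k, Cr 0 setT (fun u => A u i k).

Let entry0 : poly_entry (fun u => mxof u).
Proof.
move=> i k; rewrite (_ : (fun u => _) = fun u : P => u 0 (mxvec_index i k)).
  exact: Cr_coord.
by apply/funext => u; rewrite mxE.
Qed.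

Let Cr0_mulmx a b c (A : P -> 'M[R]_(a, b)) (B : P -> 'M[R]_(b, c)) :
  (forall i k, Cr 0 setT (fun u => A u i k)) -> (forall i k, Cr 0 setT (fun u => B u i k)) ->
  forall i k, Cr 0 setT (fun u => (A u *m B u) i k).
Proof.
move=> HA HB i k; rewrite (_ : (fun u => _) = fun u => \sum_j A u i j * B u j k).
  by apply: Cr_sum => [|j]; [exact: openT|apply: CrM; [exact: openT|exact: HA|exact: HB]].
by apply/funext => u; rewrite mxE.
Qed.

Let Cr0_tr a b (A : P -> 'M[R]_(a, b)) :
  (forall i k, Cr 0 setT (fun u => A u i k)) ->
  forall i k, Cr 0 setT (fun u => (A u)^T i k).
Proof.
move=> HA i k; rewrite (_ : (fun u => _) = fun u => A u k i); first exact: HA.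
by apply/funext => u; rewrite mxE.
Qed.

Let Cr0_cst a b (A : 'M[R]_(a, b)) : forall i k, Cr 0 setT (fun _ : P => A i k).
Proof. by move=> i k; exact: Cr_cst. Qed.

Let entryJ i k : Cr 0 setT (fun u : P => (mxof u *m J) i k).
Proof. exact: (Cr0_mulmx (A := fun u => mxof u) (B := fun=> J) entry0 (@Cr0_cst _ _ J)). Qed.

Lemma Gmx_continuous k l : Cr 0 setT (fun u : P => Gmx (mxof u) k l).
Proof.
rewrite (_ : (fun u => _) = fun u : P => ((mxof u)^T *m mxof u) k l +
   ((mxof u *m J)^T *m (mxof u *m J)) k l).
  apply: CrD; first exact: openT.
    exact: (Cr0_mulmx (Cr0_tr entry0) entry0).
  exact: (Cr0_mulmx (Cr0_tr entryJ) entryJ).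
by apply/funext => u; rewrite mxE.
Qed.

(** The sum of the squares of the frame equations is continuous and its zero set is closed; entries
    of a frame are bounded by 1. *)
Lemma frame_compact : compact [set u : P | frame (mxof u)].
Proof.
pose F (u : P) := \sum_i \sum_j (((mxof u *m (mxof u)^T) i j - (1%:M : 'M[R]_q) i j) ^+ 2
   + ((mxof u *m J *m (mxof u)^T) i j) ^+ 2).
have F0 u : 0 <= F u.
  by apply: sumr_ge0 => i _; apply: sumr_ge0 => j _; rewrite addr_ge0 ?sqr_ge0.
have FP : [set u : P | frame (mxof u)] = [set u | F u <= 0].
  apply/seteqP; split=> u /=.
    move=> [H1 H2]; rewrite /F big1// => i _; rewrite big1// => j _.
    by rewrite H1 H2 subrr !mxE expr0n addr0.
  move=> Fu; have {Fu}/eqP : F u = 0 by apply/eqP; rewrite eq_le Fu F0.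
  rewrite psumr_eq0; last by move=> i _; apply: sumr_ge0 => j _; rewrite addr_ge0 ?sqr_ge0.
  move=> /allP H.
  have {}H i j : (mxof u *m (mxof u)^T) i j = (1%:M : 'M[R]_q) i j /\ (mxof u *m J *m (mxof u)^T)
    i j = 0.
    have := H i; rewrite mem_index_enum => /(_ isT) /=.
    rewrite psumr_eq0; last by move=> k _; rewrite addr_ge0 ?sqr_ge0.
    move=> /allP /(_ j); rewrite mem_index_enum => /(_ isT) /=.
    rewrite paddr_eq0 ?sqr_ge0// !sqrf_eq0 subr_eq0 => /andP[/eqP -> /eqP ->].
    by [].
  by split; apply/matrixP => i j; have [H1 H2] := H i j; rewrite ?H1 ?H2 ?mxE.
apply: bounded_closed_compact.
  exists 1; split; first exact: num_real.
  move=> b b1 u /= fu; apply: le_trans (ltW b1).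
  apply: norm_row_le; first exact: ler01.
  move=> k; rewrite -(vec_mxK u); case/mxvec_indexP: k => i j.
  by rewrite mxvecE; exact: frame_entry.
rewrite FP; apply: closed_sublevel => u.
have H : Cr 0 setT F.
  apply: Cr_sum => [|i]; first exact: openT.
  apply: Cr_sum => [|j]; first exact: openT.
  have H1 : Cr 0 setT (fun u : P => (mxof u *m (mxof u)^T) i j - (1%:M : 'M[R]_q) i j).
    apply: CrB; [exact: openT| |exact: Cr_cst].
    exact: (Cr0_mulmx (A := fun u => mxof u) (B := fun u => (mxof u)^T) entry0 (Cr0_tr entry0)).
  have H2 : Cr 0 setT (fun u : P => (mxof u *m J *m (mxof u)^T) i j).
    exact: (Cr0_mulmx (A := fun u => mxof u *m J) (B := fun u => (mxof u)^T) entryJ (Cr0_tr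
      entry0)).
  exact: (CrD openT (CrM openT H1 H1) (CrM openT H2 H2)).
exact: (Cr_continuous H).
Qed.

(** The coefficients a and b stand for Hessians at one fixed point; only the frame varies. *)
Lemma frame_penalty (a b : 'I_(n + n) -> 'I_(n + n) -> R) :
  let L (c : 'I_(n + n) -> 'I_(n + n) -> R) V := \sum_k \sum_l Gmx V k l * c k l in
  (forall V : 'M[R]_(q, n + n), frame V -> 0 <= L a V) ->
  (forall V : 'M[R]_(q, n + n), frame V -> L a V = 0 -> 0 < L b V) ->
  exists N : nat, forall V : 'M[R]_(q, n + n), frame V -> N.+1%:R^-1 < L b V + N%:R * L a V.
Proof.
move=> L La Lb.
have cL c : continuous (fun u : P => L c (mxof u)).
  suff H : Cr 0 setT (fun u : P => L c (mxof u)) by move=> u; exact: (Cr_continuous H).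
  apply: Cr_sum => [|k]; first exact: openT.
  apply: Cr_sum => [|l]; first exact: openT.
  by apply: CrM; [exact: openT|exact: Gmx_continuous|exact: (Cr_cst 0 setT (c k l))].
have [||N HN] := compact_penalty frame_compact (cL a) (cL b).
- by move=> u /La.
- by move=> u /Lb.
by exists N => V fV; have := HN (mxvec V); rewrite /= mxvecK; apply.
Qed.
End FrameCompactness.

Section ComplexFrames.
Context {R : realType} {n q : nat}.
Local Notation E := 'rV[R]_(n + n).
Local Notation C := R[i].
Local Notation RC := (real_complex R).
Local Notation J := (Jmx n R).
Local Notation ii := (0 +i* 1 : C).
Implicit Types V : 'M[R]_(q, n + n).

(* For V with rows v, the rows v - i Jv are the corresponding (1,0) vectors. *)
Definition cframe V : 'M[C]_(q, n + n) := map_mx RC V - ii *: map_mx RC (V *m J).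

Lemma cframe_J V : cframe V *m Jmx n C = ii *: cframe V.
Proof.
rewrite /cframe mulmxBl -scalemxAl -(map_Jmx n RC) -!map_mxM -mulmxA Jmx_sqr mulmxN mulmx1.
by rewrite scalerBr scalerA sqr_ii scaleN1r opprK map_mxN scalerN opprK addrC.
Qed.

(** (V - i VJ)(V + i VJ)^T = 2 for a frame, so the (1,0) rows are independent over the complex
    numbers. *)
Lemma cframe_dim V d (B : 'M[C]_(d, n + n)) : frame V ->
  (forall i, (row i (cframe V) <= B)%MS) -> (q <= d)%N.
Proof.
move=> fV HB.
have [VV VJV] := fV; have [JJ _] := frame_J fV.
have VVJ : V *m (V *m J)^T = 0 by rewrite -[LHS]trmxK trmx_mul trmxK VJV trmx0.
have sub : (cframe V <= B)%MS by apply/row_subP.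
have rk : row_free (cframe V).
  apply/row_freeP; exists (2^-1 *: (map_mx RC V + ii *: map_mx RC (V *m J))^T).
  rewrite -scalemxAr [X in _ *: (_ *m X)]linearD /= [X in _ + X]linearZ /=.
  rewrite /cframe mulmxDr !mulmxBl -!scalemxAr -!scalemxAl !map_trmx -!map_mxM VV JJ VVJ VJV.
  rewrite map_mx0 map_mx1 !scaler0 subr0 sub0r scalerA sqr_ii scaleN1r opprK.
  rewrite (_ : 1%:M + 1%:M = 2 *: 1%:M) ?scalerA ?mulVf ?scale1r ?pnatr_eq0//.
  by rewrite scaler_nat.
by have := mxrankS sub; rewrite (eqP rk) => /leq_trans; apply; exact: rank_leq_row.
Qed.

Lemma hessform_real (rho : E -> R) x (u v : E) :
  hessform rho x (map_mx RC u) (map_mx RC v) = ((u *m hess rho x *m v^T) 0 0)%:C.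
Proof. by rewrite /hessform map_trmx -!map_mxM mxE. Qed.

Lemma row_form (A : 'M[R]_(n + n)) V i :
  (row i V *m A *m (row i V)^T) 0 0 = (V *m A *m V^T) i i.
Proof. by rewrite -row_mul !mxE; apply: eq_bigr => k _; rewrite !mxE. Qed.

(** In Hess(v - i Jv, v + i Jv) the mixed terms cancel by symmetry, leaving Hess(v, v) + Hess(Jv,
    Jv). *)
Lemma hessform_cframe U (rho : E -> R) x V i : open U -> Cr 2 U rho -> U x ->
  hessform rho x (row i (cframe V)) (conjv (row i (cframe V))) =
  ((V *m hess rho x *m V^T) i i + (V *m J *m hess rho x *m (V *m J)^T) i i)%:C.
Proof.
move=> oU Hr Ux; rewrite -!row_form rmorphD /= -!hessform_real.
set a := map_mx RC (row i V); set b := map_mx RC (row i (V *m J)).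
have -> : row i (cframe V) = a + (- ii) *: b.
  by rewrite /cframe linearB linearZ /= /a /b !map_row scaleNr.
have conj_RC (u : E) : conjv (map_mx RC u) = map_mx RC u.
  by apply/rowP => k; rewrite !mxE; exact: conj_real.
rewrite conjvD conjvZ conj_Nii !conj_RC -/a -/b hessformDl !hessformDr !hessformZl !hessformZr.
rewrite (hessform_sym b a oU Hr Ux).
move: (hessform _ _ a a) (hessform _ _ a b) (hessform _ _ b b) => x1 x2 x3.
transitivity (x1 - ii * ii * x3); first by ring.
by rewrite sqr_ii; ring.
Qed.
End ComplexFrames.

(** * The local function at a point of a CR submanifold *)

Section LocalProperty.
Context {R : realType} {n : nat}.
Local Notation E := 'rV[R]_(n + n).
Local Notation RC := (real_complex R).
Local Notation J := (Jmx n R).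

Lemma tangent_sub (S M : set E) x v : M `<=` S -> tangent M x v -> tangent S x v.
Proof.
move=> MS tv U f oU Ux Hf fS; apply: tv oU Ux Hf _ => y [My Uy].
by apply: fS; split => //; exact: MS.
Qed.

Lemma trG_sum U G (I : Type) (s : seq I) (F : I -> E -> R) x : open U ->
  (forall i, Cr 2 U (F i)) -> U x ->
  trG G (fun y => \sum_(i <- s) F i y) x = \sum_(i <- s) trG G (F i) x.
Proof.
move=> oU HF Ux; elim: s => [|i s IH].
  by under eq_fun do rewrite big_nil; rewrite big_nil trG_cst.
under eq_fun do rewrite big_cons.
by rewrite big_cons (trGD _ oU (HF i) (Cr_sum s oU HF) Ux) IH.
Qed.

(** All estimates are made at p alone; [property_G_defining] then spreads them to a ball. *)
Lemma local_property_G (S M : set E) p (d q : nat) : hypersurface S -> pseudoconvex S ->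
  M `<=` S -> (exists c, submanifold c M) -> M p -> (d < q)%N ->
  has_cdim (H10_in S M p `&` levi_kernel S p) d ->
  exists2 r, 0 < r & forall K, K `<=` M `&` ball p r ->
    property_G (@frame_forms R n q) K.
Proof.
move=> Shyp psc MS [c Msub] Mp dq [B [_ BE]].
have Sp := MS p Mp.
have [U1 [r1 [oU1 U1p Hr1 SU1 rk1]]] := Shyp p Sp.
have [U2 [r [oU2 U2p Hr MU2 rk2]]] := Msub p Mp.
pose rho := r1 ord0.
have tanS x v : (S `&` U1) x -> tangent S x v <-> 'D_v rho x = 0.
  move=> Sx; have [Sx1 U1x] := Sx.
  rewrite (submersion_tangent v oU1 U1x Sx1 Hr1 SU1 (rk1 x Sx)).
  by split=> [|H i]; [apply|rewrite (ord1 i)].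
have nondeg x : (S `&` U1) x -> grad rho x != 0.
  move=> /rk1; apply: contraTneq => g0.
  rewrite (_ : (\matrix_(i, k) _) = 0); first by rewrite /row_free mxrank0.
  apply/matrixP => i k; rewrite (ord1 i).
  by have := congr1 (fun w : E => w 0 k) g0; rewrite !mxE.
have Hrho : smooth U1 rho by exact: Hr1.
have SUp : (S `&` U1) p by [].
have [s s0 pos] := pseudoconvex_semidefinite oU1 Hrho tanS nondeg psc SUp.
have rp i : r i p = 0.
  by have : (M `&` U2) p by []; rewrite MU2 => -[_]; apply.
have dr i := smooth_differentiable (Hr i) U2p.
(* The Hessians at p of sum r_i^2, where r_i(p) = 0 leaves only the gradient terms, and of s rho. *)
pose a k l := \sum_i 2 * (pderiv k (r i) p * pderiv l (r i) p).
pose b k l := s * pderiv l (pderiv k rho) p.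
have aE (V : 'M[R]_(q, n + n)) : \sum_k \sum_l Gmx V k l * a k l =
    \sum_i 2 * quad (Gmx V) (fun k => pderiv k (r i) p) (fun k => pderiv k (r i) p).
  rewrite /quad; under [RHS]eq_bigr do rewrite mulr_sumr.
  rewrite [RHS]exchange_big /=; apply: eq_bigr => k _.
  under [RHS]eq_bigr do rewrite mulr_sumr.
  rewrite [RHS]exchange_big /=; apply: eq_bigr => l _.
  by rewrite /a mulr_sumr; apply: eq_bigr => i _; rewrite mulrCA.
have bE (V : 'M[R]_(q, n + n)) : \sum_k \sum_l Gmx V k l * b k l = s * trG (Gmx V) rho p.
  rewrite /trG mulr_sumr; apply: eq_bigr => k _; rewrite mulr_sumr; apply: eq_bigr => l _.
  by rewrite /b mulrCA.
have a0 (V : 'M[R]_(q, n + n)) : frame V -> 0 <= \sum_k \sum_l Gmx V k l * a k l.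
  by move=> _; rewrite aE sumr_ge0// => i _; rewrite mulr_ge0//; exact: psd_Gmx.
have ab (V : 'M[R]_(q, n + n)) : frame V -> \sum_k \sum_l Gmx V k l * a k l = 0 ->
    0 < \sum_k \sum_l Gmx V k l * b k l.
  move=> fV; rewrite aE bE => /eqP; rewrite psumr_eq0; last first.
    by move=> i _; rewrite mulr_ge0//; exact: psd_Gmx.
  move=> /allP Ha.
  have D0 i j : 'D_(row j V) (r i) p = 0 /\ 'D_(row j (V *m J)) (r i) p = 0.
    have := Ha i; rewrite mem_index_enum => /(_ isT) /=.
    rewrite mulf_eq0 pnatr_eq0 /= quad_Gmx paddr_eq0; try by apply: sumr_ge0 => ? _; exact: sqr_ge0.
    have aux (W : 'M[R]_(q, n + n)) :
        \sum_j ((\row_k pderiv k (r i) p *m W^T) 0 j) ^+ 2 == 0 -> 'D_(row j W) (r i) p = 0.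
      rewrite psumr_eq0; last by move=> ? _; exact: sqr_ge0.
      move=> /allP /(_ j); rewrite mem_index_enum => /(_ isT) /=.
      rewrite sqrf_eq0 => /eqP H; rewrite derive_pderiv// -[RHS]H mxE.
      by apply: eq_bigr => k _; rewrite !mxE mulrC.
    by move=> /andP[/aux H1 /aux H2].
  have tMv v : (forall i, 'D_v (r i) p = 0) -> tangent M p v.
    by move=> Dv; apply/(submersion_tangent v oU2 U2p Mp Hr MU2 (rk2 p (conj Mp U2p))).
  (* The real and imaginary parts of a (1,0) row are v and -Jv, both killed by the dr_i. *)
  have tM j : ctangent M p (row j (cframe V)).
    have t1 : tangent M p (row j V) by apply: tMv => i; have [] := D0 i j.
    have t2 : tangent M p (- row j (V *m J)).
      apply: tMv => i; have [_ H2] := D0 i j.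
      by rewrite deriveE// linearN /= -deriveE// H2 oppr0.
    split.
      rewrite (_ : map_mx _ _ = row j V)//; apply/rowP => k; rewrite !mxE /=.
      by rewrite mul0r !mulr0 subrr oppr0 addr0.
    rewrite (_ : map_mx _ _ = - row j (V *m J))//; apply/rowP => k; rewrite !mxE /=.
    by rewrite mul0r add0r mul1r add0r.
  have tS j : H10 S p (row j (cframe V)).
    split; last first.
      by rewrite /= Jstr_Jmx -row_mul cframe_J linearZ.
    by have [t1 t2] := tM j; split; [exact: tangent_sub t1|exact: tangent_sub t2].
  have hE j := hessform_cframe V j oU1 (Hrho 2) U1p.
  have h0 j : 0 <= s * ((V *m hess rho p *m V^T) j j + (V *m J *m hess rho p *m (V *m J)^T) j j).
    by have := pos _ (tS j); rewrite hE -rmorphM lecR.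
  (* A sum of nonnegative Levi values: if it vanished, every row would lie in the Levi kernel, and q
     independent vectors would fit in dimension d. *)
  rewrite trG_Gmx mulr_sumr lt_def sumr_ge0 ?andbT; last by move=> j _; exact: h0.
  apply/negP; rewrite psumr_eq0 => [/allP Hj|j _]; last exact: h0.
  have ker j : levi_kernel S p (row j (cframe V)).
    apply: (pseudoconvex_levi_kernel oU1 Hrho tanS nondeg SUp s0 pos (tS j)).
    have := Hj j; rewrite mem_index_enum => /(_ isT) /=.
    by rewrite hE mulf_eq0 (negbTE s0) /= => /eqP ->.
  have : (q <= d)%N.
    apply: (@cframe_dim _ _ _ V d B fV) => j.
    have : (H10_in S M p `&` levi_kernel S p) (row j (cframe V)).
      by split; [split; [exact: tM|exact: tS]|exact: ker].
    by rewrite BE.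
  by rewrite leqNgt dq.
have [N HN] := frame_penalty a0 ab.
pose g y := N%:R * (\sum_i r i y * r i y) + s * rho y.
have oW : open (U1 `&` U2) by exact: openI.
have W1 : U1 `&` U2 `<=` U1 by move=> y [].
have W2 : U1 `&` U2 `<=` U2 by move=> y [].
have Wp : (U1 `&` U2) p by [].
have HrW i : Cr 2 (U1 `&` U2) (r i) := Cr_sub W2 (Hr i 2).
have HrhoW : Cr 2 (U1 `&` U2) rho := Cr_sub W1 (Hrho 2).
have Hrr i := CrM oW (HrW i) (HrW i).
have Hsum : Cr 2 (U1 `&` U2) (fun y => \sum_i r i y * r i y) by exact: (Cr_sum _ oW Hrr).
have Hg : Cr 2 (U1 `&` U2) g := CrD oW (CrZ N%:R oW Hsum) (CrZ s oW HrhoW).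
apply: (property_G_defining (B := q%:R + q%:R) _ oW Wp Hg (e := N.+1%:R^-1)).
- by move=> G k l; exact: Gmx_bound.
- move=> G [V fV ->].
  rewrite (trGD _ oW (CrZ N%:R oW Hsum) (CrZ s oW HrhoW) Wp).
  rewrite (trGZ _ _ oW Hsum Wp) (trGZ _ _ oW HrhoW Wp) -bE.
  suff -> : trG (Gmx V) (fun y => \sum_i r i y * r i y) p = \sum_k \sum_l Gmx V k l * a k l.
    by rewrite addrC; exact: HN.
  rewrite (trG_sum _ _ oW Hrr Wp) aE; apply: eq_bigr => i _.
  rewrite (trGM _ oW (HrW i) (HrW i) Wp) rp mulr0 mul0r addr0 add0r.
  by rewrite mulr_natl mulr2n.
- by rewrite invr_gt0.
move=> y [My [U1y U2y]]; rewrite /g.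
have Sy := MS y My.
have ry i : r i y = 0.
  by have : (M `&` U2) y by []; rewrite MU2 => -[_]; apply.
have -> : rho y = 0.
  by have : (S `&` U1) y by []; rewrite SU1 => -[_]; apply.
rewrite mulr0 addr0 big1 ?mulr0// => i _; by rewrite ry mulr0.
Qed.
End LocalProperty.

(** * Sums of eigenvalues of the complex Hessian *)

Section EigenvalueSums.
Context {R : realType} {n : nat}.
Local Notation E := 'rV[R]_(n + n).
Local Notation C := R[i].
Local Notation RC := (real_complex R).
Local Notation J := (Jmx n R).
Local Notation ii := (0 +i* 1 : C).

Definition conj_mx {a b} (A : 'M[C]_(a, b)) : 'M[C]_(a, b) := map_mx (@conjc R) A.

(* The rows are the vectors d/dz_j. *)
Definition Zmx : 'M[C]_(n, n + n) := row_mx (2^-1)%:M (- (ii / 2))%:M.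

Lemma half_complex : (2^-1 : C) = (2^-1)%:C.
Proof. by rewrite fmorphV /= rmorph_nat. Qed.

(** The Hessian extended bilinearly and evaluated on row j of [Zmx] and the conjugate of row k. *)
Lemma complex_hessianE U (f : E -> R) x : open U -> Cr 2 U f -> U x ->
  complex_hessian f x = Zmx *m map_mx RC (hess f x) *m (conj_mx Zmx)^T.
Proof.
move=> oU Hf Ux.
have cZ : (conj_mx Zmx)^T = col_mx (2^-1)%:M (ii / 2)%:M.
  rewrite /conj_mx /Zmx map_row_mx tr_row_mx !map_scalar_mx !tr_scalar_mx half_complex /=.
  by congr (col_mx _%:M _%:M); apply/eqP; rewrite eq_complex /=; apply/andP; split; apply/eqP; ring.
rewrite cZ /Zmx -(submxK (map_mx RC (hess f x))) mul_row_block mul_row_col.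
rewrite !mul_scalar_mx !mul_mx_scalar.
apply/matrixP => j k.
have dzE y : dz j (fun y => (f y)%:C) y =
    (2^-1 * pderiv (lshift n j) f y) +i* (- 2^-1 * pderiv (rshift n j) f y).
  rewrite /dz !cpderiv_real half_complex.
  by apply/eqP; rewrite eq_complex /=; apply/andP; split; apply/eqP; ring.
have d2 l i := Cr_differentiable (Cr_pderiv i Hf) Ux.
have cp l : cpderiv l (dz j (fun y => (f y)%:C)) x =
    (2^-1 * pderiv l (pderiv (lshift n j) f) x) +i* (- 2^-1 * pderiv l (pderiv (rshift n j) f) x).
  rewrite (_ : dz j _ = fun y => (2^-1 * pderiv (lshift n j) f y) +i* (- 2^-1 * pderiv (rshift n
    j) f y)).
    by rewrite /cpderiv /= !pderivZ//; exact: (Cr_differentiable (Cr_pderiv _ Hf) Ux).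
  by apply/funext => y; exact: dzE.
rewrite mxE /dzbar !cp half_complex !mxE.
rewrite (pderivC (lshift n k) (lshift n j) oU Hf Ux) (pderivC (lshift n k) (rshift n j) oU Hf Ux).
rewrite (pderivC (rshift n k) (lshift n j) oU Hf Ux) (pderivC (rshift n k) (rshift n j) oU Hf Ux).
move: (pderiv _ _ _) (pderiv _ _ _) (pderiv _ _ _) (pderiv _ _ _) => p1 p2 p3 p4.
by apply/eqP; rewrite eq_complex /=; apply/andP; split; apply/eqP; ring.
Qed.

Definition realify q (X : 'M[C]_(q, n)) : 'M[R]_(q, n + n) :=
  row_mx (map_mx (@complex.Re R) X) (map_mx (@complex.Im R) X).

(** The vector x - i Jx of a real tangent vector x is twice its (1,0) part; squared, this 2 is the
    source of the factor 4. *)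
Lemma cframe_realify q (X : 'M[C]_(q, n)) : cframe (realify X) = 2 *: (X *m Zmx).
Proof.
rewrite /cframe /realify /Jmx mul_row_block !mulmx0 add0r addr0 mulmx1 mulmxN mulmx1.
rewrite /Zmx mul_mx_row !mul_mx_scalar !map_row_mx !scale_row_mx opp_row_mx add_row_mx.
have n2 : 2 != 0 :> C by rewrite pnatr_eq0.
rewrite !scalerA mulrN [2 * (ii / 2)]mulrCA divff// mulr1 scale1r.
by congr row_mx; apply/matrixP => i j; rewrite !mxE; case: (X i j) => a b;
  apply/eqP; rewrite eq_complex /=; apply/andP; split; apply/eqP; ring.
Qed.

Lemma conj_mxM a b c (A : 'M[C]_(a, b)) (B : 'M[C]_(b, c)) :
  conj_mx (A *m B) = conj_mx A *m conj_mx B.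
Proof. by rewrite /conj_mx map_mxM. Qed.

(** The real and imaginary parts of the hermitian products of the rows are the entries of V V^T and
    of -V J V^T. *)
Lemma frame_realify q (X : 'M[C]_(q, n)) : X *m (conj_mx X)^T = 1%:M -> frame (realify X).
Proof.
move=> /matrixP X1.
suff H i k : ((realify X *m (realify X)^T) i k) +i* (- (realify X *m J *m (realify X)^T) i k) =
  (i == k)%:R.
  split; apply/matrixP => i k; have /eqP := H i k;
    rewrite eq_complex => /andP[/eqP /= H1 /eqP /= H2].
    by rewrite H1 mxE; case: (i == k).
  by rewrite -[LHS]opprK H2 mxE; case: (i == k); rewrite /= oppr0.
transitivity ((X *m (conj_mx X)^T) i k); last by rewrite X1 mxE.
rewrite /realify /Jmx mul_row_block !mulmx0 add0r addr0 mulmx1 mulmxN mulmx1.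
rewrite tr_row_mx !mul_row_col !mxE -!big_split /= -sumrN -sum_complex.
apply: eq_bigr => j _; rewrite !mxE; case: (X i j) (X k j) => a b [c d].
by apply/eqP; rewrite eq_complex /=; apply/andP; split; apply/eqP; ring.
Qed.

Lemma char_poly_diag (d : 'rV[C]_n) : char_poly (diag_mx d) = \prod_(i < n) ('X - (d 0 i)%:P).
Proof.
rewrite char_poly_trig ?diag_mx_is_trig//; apply: eq_bigr => i _.
by rewrite mxE eqxx mulr1n.
Qed.

Lemma char_poly_similar (P A B : 'M[C]_n) : P \in unitmx -> A = invmx P *m B *m P ->
  char_poly A = char_poly B.
Proof.
move=> PU ->; rewrite /char_poly /char_poly_mx !map_mxM.
set Q := map_mx polyC P; set Qi := map_mx polyC (invmx P).
have QiQ : Qi *m Q = 1%:M by rewrite -map_mxM mulVmx// map_mx1.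
have -> : 'X%:M - Qi *m map_mx polyC B *m Q = Qi *m ('X%:M - map_mx polyC B) *m Q.
  by rewrite mulmxBr mulmxBl scalar_mxC -(mulmxA _ Qi Q) QiQ mulmx1.
rewrite !det_mulmx mulrC mulrA -det_mulmx.
by rewrite (mulmx1C QiQ) det1 mul1r.
Qed.

(** The complex Hessian is hermitian, so the spectral theorem gives a unitary basis of eigenvectors;
    those indexed by I form the frame, on whose plane the trace of the complex Hessian is the sum of
    the eigenvalues. *)
Lemma eigenvalue_sum U (f : E -> R) x (mu : 'I_n -> C) (I : {set 'I_n}) :
  open U -> Cr 2 U f -> U x -> eigenvalues_of (complex_hessian f x) mu ->
  exists2 V : 'M[R]_(#|I|, n + n), frame V &
    \sum_(i in I) mu i = (4^-1 * trG (Gmx V) f x)%:C.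
Proof.
move=> oU Hf Ux; set H := complex_hessian f x => muE.
have HE := complex_hessianE oU Hf Ux.
have hsymm : (hess f x)^T = hess f x.
  by apply/matrixP => k l; rewrite !mxE; exact: (pderivC _ _ oU Hf Ux).
have conjK a b (A : 'M[C]_(a, b)) : conj_mx (conj_mx A) = A.
  by apply/matrixP => i j; rewrite !mxE; exact: conjcK.
have conjR a b (A : 'M[R]_(a, b)) : conj_mx (map_mx RC A) = map_mx RC A.
  by apply/matrixP => i j; rewrite !mxE; exact: conj_real.
have Hherm : map_mx Num.conj H^T = H.
  rewrite -[LHS]/(conj_mx H^T) /H HE !trmx_mul trmxK map_trmx hsymm !conj_mxM.
  by rewrite conjR conjK mulmxA /conj_mx map_trmx.
have /orthomx_spectralP : H \is normalmx by apply/normalmxP; rewrite Hherm.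
set P := spectralmx H; set d := spectral_diag H => HP.
have PU : P \is unitarymx := spectral_unitarymx H.
have PP : P *m (conj_mx P)^T = 1%:M.
  by have /unitarymxP := PU; rewrite -[map_mx _ P^T]/(conj_mx P^T) /conj_mx map_trmx.
have HdE : P *m H *m (conj_mx P)^T = diag_mx d.
  have Pinv : invmx P = (conj_mx P)^T.
    by rewrite invmx_unitary// -[map_mx _ P^T]/(conj_mx P^T) /conj_mx map_trmx.
  rewrite {1}HP Pinv !mulmxA PP mul1mx -mulmxA PP mulmx1.
  by [].
(* Since mu is known only through the characteristic polynomial, unique factorization matches it
   with the spectral diagonal up to a permutation. *)
have /tuple_permP[s sE] : perm_eq [tuple mu i | i < n] [tuple d 0 i | i < n].
  apply: prod_XsubC_eq; rewrite !big_map.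
  move: muE; rewrite /eigenvalues_of (char_poly_similar (spectral_unit H) HP) char_poly_diag => muE.
  by rewrite -enumT !big_enum.
have muE' i : mu i = d 0 (s i).
  have := congr1 (fun t => nth 0 t i) sE.
  by rewrite -!tnth_nth !tnth_mktuple.
pose X := \matrix_(i < #|I|, j < n) P (s (enum_val i)) j.
have rowX i : row i X = row (s (enum_val i)) P by apply/rowP => j; rewrite !mxE.
have entry (A : 'M[C]_n) i k : (X *m A *m (conj_mx X)^T) i k =
    (P *m A *m (conj_mx P)^T) (s (enum_val i)) (s (enum_val k)).
  rewrite !mxE; apply: eq_bigr => j _; rewrite !mxE; congr (_ * _).
  by apply: eq_bigr => l _; rewrite !mxE.
have X1 : X *m (conj_mx X)^T = 1%:M.
  apply/matrixP => i k; have := entry 1%:M i k; rewrite !mulmx1 PP => ->.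
  by rewrite !mxE (inj_eq perm_inj) (inj_eq enum_val_inj).
exists (realify X); first exact: frame_realify.
have -> : \sum_(i in I) mu i = \sum_(i < #|I|) (X *m H *m (conj_mx X)^T) i i.
  rewrite big_enum_val; apply: eq_bigr => i _.
  by rewrite entry HdE muE' mxE eqxx mulr1n.
rewrite trG_Gmx mulr_sumr rmorph_sum /=; apply: eq_bigr => i _.
rewrite rmorphM /= -(hessform_cframe _ i oU Hf Ux) cframe_realify linearZ /=.
rewrite conjvZ hessformZl hessformZr.
have -> : (X *m H *m (conj_mx X)^T) i i = hessform f x (row i (X *m Zmx)) (conjv (row i (X *m
  Zmx))).
  rewrite /hessform -row_mul /conjv map_row -/(conj_mx (X *m Zmx)) conj_mxM /H HE.
  rewrite (_ : X *m _ *m _ = X *m Zmx *m map_mx RC (hess f x) *m (conj_mx X *m conj_mx Zmx)^T).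
    by rewrite !mxE; apply: eq_bigr => k _; rewrite !mxE.
  by rewrite trmx_mul !mulmxA.
rewrite (_ : (2^*)%C = 2 :> C) ?rmorph_nat// mulrA -[2 * 2]natrM fmorphV /= rmorph_nat.
by rewrite mulrA mulVf ?mul1r// pnatr_eq0.
Qed.
End EigenvalueSums.

Theorem proposition1p17 (R : realType) (n q : nat) (S : set 'rV[R]_(n + n))
    (hq : (1 <= q <= n - 1)%N) (Scompact : compact S) (Shyp : hypersurface S)
    (Spsc : pseudoconvex S) (Sreg : countably_regular q S) :
  property_P q S.
Proof.
have [Sk [SE Sdisj Sloc Sreg']] := Sreg.
have /choice[OC HOC] : forall k, exists OC : set 'rV[R]_(n + n) * set 'rV[R]_(n + n),
    [/\ open OC.1, closed OC.2 & Sk k = S `&` (OC.1 `&` OC.2)].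
  by move=> k; have [A [F [oA cF E]]] := Sloc k; exists (A, F).
have PG : property_G (@frame_forms R n q) S.
  apply: (property_G_bigcup (B := q%:R + q%:R) _ _ Scompact SE
    (O := fun k => (OC k).1) (C := fun k => (OC k).2)).
  - by move=> G [V _ ->]; exact: psd_Gmx.
  - by move=> G k l; exact: Gmx_bound.
  - by move=> k; have [] := HOC k.
  - by move=> k; have [] := HOC k.
  - by move=> k; have [] := HOC k.
  - move=> k p Skp; have [M [[MS Msub _] [V [oV Vp SkM]] Mdim]] := Sreg' k p Skp.
    have Mp : M p by exact: SkM.
    have [d dq Hd] := Mdim p Mp.
    have [r r0 Hr] := local_property_G Shyp Spsc MS Msub Mp dq Hd.
    have /nbhs_ballP[r' /= r'0 Hr'] := open_nbhs_nbhs (conj oV Vp).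
    (* r' keeps the points of S_k inside M, r is the radius of the local statement on M. *)
    exists (Num.min r r'); first by rewrite lt_min r0.
    move=> K _ KS; apply: Hr => y /KS[Sky py]; split.
      by apply: SkM; split => //; apply: Hr'; apply: le_ball py; rewrite ge_min lexx orbT.
    by apply: le_ball py; rewrite ge_min lexx.
(* T_G f is four times the sum of the eigenvalues, hence 4 c. *)
move=> c c0; have [U [f [oU SU Hf bf tf]]] := PG (4 * c).
exists U, f; split => // x Ux mu Hmu I hI.
have [V fV ->] := eigenvalue_sum I oU Hf Ux Hmu.
rewrite ltcR -(ltr_pM2l (x := 4)) // mulrA divff ?mul1r ?pnatr_eq0 //.
by apply: tf => //; rewrite -hI; exists V.
Qed.
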